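(* Let $R$ be a field of arbitrary characteristic, let $S$ be a quasi-thin association scheme on a nonempty finite set $X$, let $x\in X$, and let $\mathcal{T}=\mathcal{T}_R(x)$ be the Terwilliger $R$-algebra of $S$ with respect to $x$. Then $\mathcal{T}$ is quasi-hereditary (in the sense of Cline-Parshall-Scott) and cellular (in the sense of Graham-Lehrer). Moreover, if $R$ has characteristic $2$, then the basic algebra of $\mathcal{T}$ is isomorphic to the dual extension of a star, and has global dimension at most $2$.
   Context: **Notation.** For $n\in\mathbb{N}$, $[n]=\{0,1,\ldots,n\}$. **Association schemes.** An association scheme (scheme) of size $d$ on a nonempty finite set $X$ is a partition $S=\{R_0,R_1,\ldots,R_d\}$ of $X\times X$ with all parts $R_i$ nonempty such that: (S1) $R_0=\{(x,x)\mid x\in X\}$; (S2) for each $i\in[d]$ there is $i'\in[d]$ with $R_{i'}=\{(x,y)\mid (y,x)\in R_i\}$; (S3) for $i,j,\ell\in[d]$ and $(x,y)\in R_\ell$, the number $p_{ij}^\ell:=|\{z\in X\mid (x,z)\in R_i,\ (z,y)\in R_j\}|$ does not depend on the choice of $(x,y)\in R_\ell$. The valency of $R_i$ is $k_i:=p_{ii'}^0$; it equals $|xR_i|$ for every $x\in X$, where $xR_i:=\{y\in X\mid (x,y)\in R_i\}$. The scheme $S$ is quasi-thin if $k_i\le 2$ for all $i\in[d]$. **Terwilliger algebra.** Let $M_X(R)$ be the algebra of $X\times X$ matrices over $R$, with matrix units $E_{yz}$. For $i\in[d]$, the adjacency matrix $A_i\in M_X(R)$ has $(y,z)$-entry $1$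 if $(y,z)\in R_i$ and $0$ otherwise. For $x\in X$, put $E_i^*(x):=\sum_{y\in xR_i}E_{yy}$. The Terwilliger $R$-algebra $\mathcal{T}_R(x)$ of $S$ with respect to $x$ is the $R$-subalgebra of $M_X(R)$ generated by $A_0,\ldots,A_d,E_0^*(x),\ldots,E_d^*(x)$. **Cellular algebra (Graham-Lehrer).** A unitary $R$-algebra $A$ is cellular if there is a cell datum $(I,M,C,t)$ such that: (C1) $I$ is a finite partially ordered set, to each $\lambda\in I$ is associated a finite set $M(\lambda)$, and $A$ has an $R$-basis consisting of elements $C^\lambda_{U,V}$ with $(U,V)\in M(\lambda)\times M(\lambda)$ and $\lambda\in I$; (C2) $t$ is an $R$-linear anti-automorphism of $A$ with $t^2=\mathrm{id}$, sending $C^\lambda_{U,V}$ to $C^\lambda_{V,U}$; (C3) for each $a\in A$, $aC^\lambda_{U,V}=\sum_{W\in M(\lambda)}r_a(W,U)C^\lambda_{W,V}+r'$, where $r_a(W,U)\in R$ does not depend on $V$ and $r'$ is a linear combination of basis elements with upper index $\mu<\lambda$. **Quasi-hereditary algebra (Cline-Parshall-Scott).** An ideal $J$ of a finite-dimensional algebra $A$ over a field is a heredity ideal if $J$ is idempotent ($J^2=J$), $J\,\mathrm{rad}(A)\,J=0$, and $J$ is projective as a left (or right) $A$-module. $A$ is quasi-hereditary if there is a finite chain of ideals $0=J_0\subset J_1\subset\cdots\subset J_n=A$ such that $J_j/J_{j-1}$ is a heredity ideal of $A/J_{j-1}$ for all $j$. **Basic algebra.** For a finite-dimensional algebra $A$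 over a field, let $P_1,\ldots,P_n$ be a complete set of non-isomorphic indecomposable projective $A$-modules. The basic algebra of $A$ is the endomorphism algebra of the $A$-module $\bigoplus_{i=1}^nP_i$. **Dual extension and star.** Let an algebra over $R$ be given by a quiver $Q=(Q_0,Q_1)$ with relations $\{\rho_i\mid i\in I\}$. For each arrow $\alpha:i\to j$ in $Q_1$ let $\alpha':j\to i$ be an opposite arrow, $Q_1':=\{\alpha'\mid\alpha\in Q_1\}$, and let $\rho_i'$ be the relation on $Q_1'$ obtained from $\rho_i$ by reversing arrows. The dual extension is the algebra over $R$ given by the quiver $(Q_0,Q_1\cup Q_1')$ with relations $\{\rho_i\}\cup\{\rho_i'\}\cup\{\alpha'\beta\mid\alpha,\beta\in Q_1\}$, where here $\alpha'\beta$ denotes the path that first traverses $\alpha'$ and then $\beta$ (whenever composable). A star is a quiver (without relations) with vertices $0,1,\ldots,r$ for some $r\ge0$ and exactly one arrow $i\to0$ for each $1\le i\le r$ (all arrows point to the center $0$), and no other arrows; the dual extension of a star means the dual extension of its path algebra. *)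

(* Defs.v *)
From HB Require Import structures.
From mathcomp Require Import all_boot all_order all_algebra all_field.
From mathcomp Require Import finmap monalg.

Set Implicit Arguments.
Unset Strict Implicit.
Unset Printing Implicit Defensive.

Import GRing.Theory.

Local Open Scope ring_scope.

(* An association scheme of size [d]: its parts are indexed by 0, ..., d.
   Injectivity makes the parts R_0, ..., R_d pairwise distinct, so that together
   with [partition] (disjoint nonempty blocks covering X * X) they form a
   partition with exactly [d.+1] parts.                                       *)
Record assoc_scheme (X : finType) (d : nat) := AssocScheme {
  srel :> 'I_d.+1 -> {set X * X};
  srel_inj : injective srel;
  srel_partition : partition [set srel i | i : 'I_d.+1] [set: X * X];
  srel_diag : srel ord0 = [set p | p.1 == p.2];
  srel_conv : forall i, exists i', srel i' = [set p | (p.2, p.1) \in srel i];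
  srel_reg : forall i j l (p q : X * X), p \in srel l -> q \in srel l ->
    #|[set z | ((p.1, z) \in srel i) && ((z, p.2) \in srel j)]| =
    #|[set z | ((q.1, z) \in srel i) && ((z, q.2) \in srel j)]|
}.

Section Scheme.
Variables (X : finType) (d : nat) (S : assoc_scheme X d).
Implicit Types (i j l : 'I_d.+1) (x y z : X).

(* p_{ij}^l, computed at an arbitrary pair of R_l; see [inumE]. *)
Definition inum i j l : nat :=
  if [pick p in S l] is Some p
  then #|[set z | ((p.1, z) \in S i) && ((z, p.2) \in S j)]| else 0%N.

Definition conv_idx i : 'I_d.+1 :=
  odflt i [pick i' | S i' == [set p | (p.2, p.1) \in S i]].

Definition valency i : nat := inum i (conv_idx i) ord0.

Definition quasi_thin : Prop := forall i, (valency i <= 2)%N.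

Definition nbhd x i : {set X} := [set y | (x, y) \in S i].

Lemma inumE i j l x y : (x, y) \in S l ->
  inum i j l = #|[set z | ((x, z) \in S i) && ((z, y) \in S j)]|.
Proof.
rewrite /inum => Sxy; case: pickP => [p Sp|/(_ (x, y))]; last by rewrite Sxy.
exact: srel_reg Sp Sxy.
Qed.

Lemma conv_idxE i : S (conv_idx i) = [set p | (p.2, p.1) \in S i].
Proof.
rewrite /conv_idx; case: pickP => [i' /eqP //|no].
by have [i' /eqP] := srel_conv S i; rewrite no.
Qed.

Lemma valencyE i x : valency i = #|nbhd x i|.
Proof.
rewrite /valency (@inumE _ _ _ x x) ?srel_diag ?inE //.
by apply: eq_card => y; rewrite !inE conv_idxE inE /= andbb.
Qed.

End Scheme.

Section Terwilliger.
Variables (R : fieldType) (X : finType) (d : nat) (S : assoc_scheme X d).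

(* For nonempty X, [xidx] is a bijection from X to 'I_#|X|.-1.+1; the successor
   form of the dimension is what gives square matrices their algebra structure. *)
Definition xidx (y : X) : 'I_#|X|.-1.+1 := inord (enum_rank y).

Lemma xidx_bij (x0 : X) : bijective xidx.
Proof.
have X_gt0 : (0 < #|X|)%N by apply/card_gt0P; exists x0.
apply: inj_card_bij; last by rewrite card_ord prednK.
move=> y z /(congr1 val); rewrite /= !inordK ?prednK //.
by move/val_inj/enum_rank_inj.
Qed.

Definition unit_mx (y z : X) : 'M[R]_#|X|.-1.+1 := delta_mx (xidx y) (xidx z).

Definition adj_mx (i : 'I_d.+1) : 'M[R]_#|X|.-1.+1 :=
  \sum_(p in S i) unit_mx p.1 p.2.

Lemma adj_mxE i y z : adj_mx i (xidx y) (xidx z) = ((y, z) \in S i)%:R.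
Proof.
have xI := bij_inj (xidx_bij y).
rewrite summxE; under eq_bigr do rewrite mxE !(inj_eq xI).
have [yz|nyz] := boolP ((y, z) \in S i).
  rewrite (bigD1 (y, z)) //= !eqxx big1 ?addr0 // => -[u v] /andP[_].
  by rewrite xpair_eqE [u == y]eq_sym [v == z]eq_sym => /negPf->.
rewrite big1 // => -[u v] /= uv; case: andP => // -[/eqP yu /eqP zv].
by rewrite yu zv uv in nyz.
Qed.

Definition dual_idem (x : X) (i : 'I_d.+1) : 'M[R]_#|X|.-1.+1 :=
  \sum_(y in nbhd S x i) unit_mx y y.

Definition terwilliger_gens (x : X) : seq 'M[R]_#|X|.-1.+1 :=
  [seq adj_mx i | i : 'I_d.+1] ++ [seq dual_idem x i | i : 'I_d.+1].

Definition terwilliger (x : X) : falgType R :=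
  subvs_of <<<<terwilliger_gens x>>%VS>>%AS.

End Terwilliger.

Section Cellular.
Variables (R : fieldType) (A : falgType R).

Record cell_datum disp (I : finPOrderType disp) (M : I -> finType)
    (C : forall l, M l -> M l -> A) (t : {linear A -> A}) : Prop := CellDatum {
  cell_basis : basis_of {:A}
    [seq C (tag u) (tagged u).1 (tagged u).2 | u : {l : I & (M l * M l)%type}];
  cell_antimorph : forall a b, t (a * b) = t b * t a;
  cell_invol : involutive t;
  cell_flip : forall l (U V : M l), t (C l U V) = C l V U;
  cell_mul : forall (a : A) (l : I), exists r : M l -> M l -> R,
    forall U V : M l,
      a * C l U V - \sum_W r W U *: C l W V \in
        (\sum_(m : I | (m < l)%O)
            <<[seq C m p.1 p.2 | p : (M m * M m)%type]>>)%VS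
}.

Definition cellular : Prop :=
  exists disp (I : finPOrderType disp) (M : I -> finType)
    (C : forall l, M l -> M l -> A) (t : {linear A -> A}), cell_datum C t.

End Cellular.

(* All modules are left modules, of arbitrary dimension. *)
Section Modules.
Variable A : nzRingType.

Definition surjective (T U : Type) (f : T -> U) := forall u, exists t, f t = u.

Definition trivial_mod (M : lmodType A) : Prop := forall m : M, m = 0.

Definition mod_iso (M N : lmodType A) : Prop :=
  exists f : {linear M -> N}, bijective f.

Definition projective (P : lmodType A) : Prop :=
  forall (M N : lmodType A) (g : {linear M -> N}) (f : {linear P -> N}),
    surjective g -> exists h : {linear P -> M}, g \o h =1 f.

Definition indecomposable (M : lmodType A) : Prop :=
  ~ trivial_mod M /\
  forall M1 M2 : lmodType A, mod_iso M (M1 * M2)%type ->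
    trivial_mod M1 \/ trivial_mod M2.

Definition complete_indec_projectives n (P : 'I_n -> lmodType A) : Prop :=
  [/\ forall i, projective (P i) /\ indecomposable (P i),
      forall i j, mod_iso (P i) (P j) -> i = j
    & forall Q : lmodType A, projective Q -> indecomposable Q ->
        exists i, mod_iso Q (P i)].

(* A projective resolution 0 -> P_n -> ... -> P_1 -> P_0 -> M -> 0. *)
Definition proj_dim_le (n : nat) (M : lmodType A) : Prop :=
  exists (P : nat -> lmodType A) (e : {linear P 0%N -> M})
      (D : forall i, {linear P i.+1 -> P i}),
    [/\ forall i, projective (P i),
        forall i, (n < i)%N -> trivial_mod (P i),
        surjective e,
        forall p, e p = 0 <-> exists q, D 0%N q = p
      & forall i p, D i p = 0 <-> exists q, D i.+1 q = p].

Definition gldim_le (n : nat) : Prop := forall M : lmodType A, proj_dim_le n M.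

End Modules.

Section DirectSum.
Variables (A : nzRingType) (n : nat) (P : 'I_n -> lmodType A).

Definition dsum := {dffun forall i, P i}.

HB.instance Definition _ := Choice.on dsum.

Implicit Types f g : dsum.

Definition dsum_zero : dsum := [ffun i => 0].
Definition dsum_opp f : dsum := [ffun i => - f i].
Definition dsum_add f g : dsum := [ffun i => f i + g i].
Definition dsum_scale (a : A) f : dsum := [ffun i => a *: f i].

Fact dsum_addA : associative dsum_add.
Proof. by move=> f g h; apply/ffunP=> i; rewrite !ffunE addrA. Qed.
Fact dsum_addC : commutative dsum_add.
Proof. by move=> f g; apply/ffunP=> i; rewrite !ffunE addrC. Qed.
Fact dsum_add0 : left_id dsum_zero dsum_add.
Proof. by move=> f; apply/ffunP=> i; rewrite !ffunE add0r. Qed.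
Fact dsum_addN : left_inverse dsum_zero dsum_opp dsum_add.
Proof. by move=> f; apply/ffunP=> i; rewrite !ffunE addNr. Qed.

HB.instance Definition _ := GRing.isZmodule.Build dsum
  dsum_addA dsum_addC dsum_add0 dsum_addN.

Fact dsum_scaleA a b f : dsum_scale a (dsum_scale b f) = dsum_scale (a * b) f.
Proof. by apply/ffunP=> i; rewrite !ffunE scalerA. Qed.
Fact dsum_scale1 : left_id 1 dsum_scale.
Proof. by move=> f; apply/ffunP=> i; rewrite !ffunE scale1r. Qed.
Fact dsum_scaleDr : right_distributive dsum_scale +%R.
Proof. by move=> a f g; apply/ffunP=> i; rewrite !ffunE scalerDr. Qed.
Fact dsum_scaleDl f : {morph dsum_scale^~ f : a b / a + b}.
Proof. by move=> a b; apply/ffunP=> i; rewrite !ffunE scalerDl. Qed.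

HB.instance Definition _ := GRing.Zmodule_isLmodule.Build A dsum
  dsum_scaleA dsum_scale1 dsum_scaleDr dsum_scaleDl.

End DirectSum.

Section Ideals.
Variables (R : fieldType) (A : falgType R).
Implicit Types J : {vspace A}.

(* Ideals of an R-algebra are in particular R-subspaces. *)
Definition left_ideal J : bool := ({:A} * J <= J)%VS.
Definition right_ideal J : bool := (J * {:A} <= J)%VS.
Definition two_sided_ideal J : bool := left_ideal J && right_ideal J.

Definition maximal_left_ideal J : Prop :=
  [/\ left_ideal J, J != {:A}%VS
    & forall L : {vspace A}, left_ideal L -> (J <= L)%VS ->
        L = J \/ L = {:A}%VS].

Definition jacobson_rad (a : A) : Prop :=
  forall J, maximal_left_ideal J -> a \in J.

Definition lideal_mod J (Jl : left_ideal J) := subvs_of J.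

Section LeftIdealModule.
Variables (J : {vspace A}) (Jl : left_ideal J).
Local Notation M := (lideal_mod Jl).

HB.instance Definition _ := GRing.Zmodule.on M.

Fact lideal_scale_in (a : A) (u : M) : a * vsval (u : subvs_of J) \in J.
Proof. by apply: (subvP Jl); apply: memv_mul; rewrite ?memvf ?subvsP. Qed.

Definition lideal_scale (a : A) (u : M) : M := Subvs (lideal_scale_in a u).

Fact lideal_scaleA a b u :
  lideal_scale a (lideal_scale b u) = lideal_scale (a * b) u.
Proof. by apply: val_inj; rewrite /= mulrA. Qed.
Fact lideal_scale1 : left_id 1 lideal_scale.
Proof. by move=> u; apply: val_inj; rewrite /= mul1r. Qed.
Fact lideal_scaleDr : right_distributive lideal_scale +%R.
Proof. by move=> a u v; apply: val_inj; rewrite /= mulrDr. Qed.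
Fact lideal_scaleDl u : {morph lideal_scale^~ u : a b / a + b}.
Proof. by move=> a b; apply: val_inj; rewrite /= mulrDl. Qed.

HB.instance Definition _ := GRing.Zmodule_isLmodule.Build A M
  lideal_scaleA lideal_scale1 lideal_scaleDr lideal_scaleDl.

End LeftIdealModule.

Definition heredity_ideal J : Prop :=
  [/\ two_sided_ideal J,
      (J * J)%VS = J,
      forall u a v, u \in J -> jacobson_rad a -> v \in J -> u * a * v = 0
    & exists Jl : left_ideal J, projective (lideal_mod Jl)].

End Ideals.

Section QuasiHereditary.
Variables (R : fieldType) (A : falgType R).

(* [B], with the projection [pi], is the quotient algebra A / J. *)
Definition quotient_map (J : {vspace A}) (B : falgType R) (pi : 'AHom(A, B)) :=
  lker pi = J /\ limg pi = {:B}%VS.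

(* The quotient A / J_j (for j < n) is nonzero since the inclusions are strict,
   hence it is an [falgType]; (pi @: J_(j+1)) is the ideal J_(j+1) / J_j. *)
Definition quasi_hereditary : Prop :=
  exists (n : nat) (J : nat -> {vspace A}),
    [/\ J 0%N = 0%VS,
        J n = {:A}%VS,
        forall j, (j <= n)%N -> two_sided_ideal (J j),
        forall j, (j < n)%N -> (J j <= J j.+1)%VS /\ J j <> J j.+1
      & forall j, (j < n)%N -> exists (B : falgType R) (pi : 'AHom(A, B)),
          quotient_map (J j) pi /\ heredity_ideal (pi @: J j.+1)%VS].

End QuasiHereditary.

Section BasicAlgebra.
Variables (R : fieldType) (A : falgType R).

(* [B] is isomorphic, as an R-algebra, to the algebra of A-endomorphisms of [M]
   under composition, where R acts on [M] through k |-> k%:A. *)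
Definition is_End_algebra (M : lmodType A) (B : falgType R) : Prop :=
  exists phi : B -> {linear M -> M},
    [/\ forall b c, phi b =1 phi c -> b = c,
        forall f : {linear M -> M}, exists b, phi b =1 f,
        forall (k : R) b c m, phi (k *: b + c) m = k%:A *: phi b m + phi c m,
        phi 1 =1 id
      & forall b c, phi (b * c) =1 phi b \o phi c].

Definition is_basic_algebra (B : falgType R) : Prop :=
  exists (n : nat) (P : 'I_n -> lmodType A),
    complete_indec_projectives P /\ is_End_algebra (dsum P) B.

End BasicAlgebra.

Record quiver := Quiver {
  vertex : finType;
  arrow : finType;
  src : arrow -> vertex;
  tgt : arrow -> vertex
}.

Section Paths.
Variable Q : quiver.
Implicit Types (v : vertex Q) (s : seq (arrow Q)).

Fixpoint is_walk v s : bool :=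
  if s is a :: s' then (src a == v) && is_walk (tgt a) s' else true.

Definition walk_end v s : vertex Q := last v [seq tgt a | a <- s].

(* A path: a start vertex and the arrows, in the order they are traversed. *)
Record qpath := QPath {
  qpath_val : vertex Q * seq (arrow Q);
  _ : is_walk qpath_val.1 qpath_val.2
}.
HB.instance Definition _ := [isSub for qpath_val].
HB.instance Definition _ := [Countable of qpath by <:].

Implicit Types p q : qpath.

Definition pstart p := (val p).1.
Definition parrows p := (val p).2.
Definition pend p := walk_end (pstart p) (parrows p).

Lemma walk_cat v s s' :
  is_walk v (s ++ s') = is_walk v s && is_walk (walk_end v s) s'.
Proof. by elim: s v => //= a s IHs v; rewrite IHs andbA. Qed.

Lemma walk_end_cat v s s' :
  walk_end v (s ++ s') = walk_end (walk_end v s) s'.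
Proof. by rewrite /walk_end map_cat last_cat. Qed.

Definition vertex_path v : qpath := @QPath (v, [::]) isT.

Fact arrow_path_subproof (a : arrow Q) : is_walk (src a) [:: a].
Proof. by rewrite /= eqxx. Qed.
Definition arrow_path (a : arrow Q) : qpath :=
  @QPath (src a, [:: a]) (arrow_path_subproof a).

(* First [p], then [q]; [None] if they are not composable. *)
Definition pcat p q : option qpath :=
  if pend p == pstart q then insub (pstart p, parrows p ++ parrows q) else None.

Lemma pcatP p q : pend p = pstart q ->
  exists2 r, pcat p q = Some r & val r = (pstart p, parrows p ++ parrows q).
Proof.
move=> pq; rewrite /pcat pq eqxx; case: insubP => [r _ <-|]; first by exists r.
by rewrite /= walk_cat -/(pend p) pq (valP p) (valP q).
Qed.

Lemma pcat_neq p q : pend p != pstart q -> pcat p q = None.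
Proof. by rewrite /pcat => /negPf->. Qed.

Lemma pcatA p q r :
  obind (pcat^~ r) (pcat p q) = obind (pcat p) (pcat q r).
Proof.
have [pq|npq] := eqVneq (pend p) (pstart q); last first.
  rewrite (pcat_neq npq) /=; have [qr|nqr] := eqVneq (pend q) (pstart r).
    have [u -> uE] /= := pcatP qr.
    by rewrite pcat_neq // [pstart u]/pstart uE.
  by rewrite (pcat_neq nqr).
have [u -> uE] /= := pcatP pq.
have pendu : pend u = pend q.
  by rewrite /pend /pstart /parrows uE /= walk_end_cat -/(pend p) pq.
have [qr|nqr] := eqVneq (pend q) (pstart r); last first.
  by rewrite (pcat_neq nqr) pcat_neq // pendu.
have [w -> wE] /= := pcatP qr.
have [a -> aE] := pcatP (etrans pendu qr).
have pw : pend p = pstart w by rewrite pq [pstart w]/pstart wE.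
have [b -> bE] := pcatP pw.
congr Some; apply: val_inj.
by rewrite aE bE /pstart /parrows uE wE /= catA.
Qed.

Lemma pcat_vertexl v q :
  pcat (vertex_path v) q = if v == pstart q then Some q else None.
Proof.
have [vq|nvq] := eqVneq v (pstart q); last by rewrite pcat_neq.
have [r -> rE] := @pcatP (vertex_path v) q vq; congr Some; apply: val_inj.
by rewrite rE [pstart (vertex_path _)]/= vq /pstart /parrows /=; case: (val q).
Qed.

Lemma pcat_vertexr p v :
  pcat p (vertex_path v) = if v == pend p then Some p else None.
Proof.
have [vp|nvp] := eqVneq v (pend p); last by rewrite pcat_neq // eq_sym.
have [r -> rE] := @pcatP p (vertex_path v) (esym vp); congr Some.
by apply: val_inj; rewrite rE cats0 /pstart /parrows; case: (val p).
Qed.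

End Paths.

Section PathAlgebra.
Variables (R : fieldType) (Q : quiver).

(* Finitely supported R-linear combinations of paths. The type is a wrapper
   around {malg R[qpath Q]}, with locked operations, because unification is
   intractable on the unfolded operations.                                    *)
Record path_alg := PathAlg { path_malg : {malg R[(qpath Q : choiceType)]} }.
HB.instance Definition _ := [isNew for path_malg].
HB.instance Definition _ := [Choice of path_alg by <:].

Implicit Types (f g h : path_alg) (p q : qpath Q).

Fact path_key : unit. Proof. by []. Qed.

Definition pcoef : qpath Q -> path_alg -> R :=
  locked_with path_key (fun p f => mcoeff p (path_malg f)).
Canonical pcoef_unlockable := [unlockable fun pcoef].

Definition psupp : path_alg -> {fset qpath Q} :=
  locked_with path_key (fun f => msupp (path_malg f)).
Canonical psupp_unlockable := [unlockable fun psupp].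

Definition path_elt : qpath Q -> path_alg :=
  locked_with path_key (fun p => PathAlg << p >>).
Canonical path_elt_unlockable := [unlockable fun path_elt].

Definition path_zero : path_alg := locked_with path_key (PathAlg 0).
Canonical path_zero_unlockable := [unlockable of path_zero].

Definition path_opp : path_alg -> path_alg :=
  locked_with path_key (fun f => PathAlg (- path_malg f)).
Canonical path_opp_unlockable := [unlockable fun path_opp].

Definition path_add : path_alg -> path_alg -> path_alg :=
  locked_with path_key (fun f g => PathAlg (path_malg f + path_malg g)).
Canonical path_add_unlockable := [unlockable fun path_add].

Definition path_scale : R -> path_alg -> path_alg :=
  locked_with path_key (fun k f => PathAlg (k *: path_malg f)).
Canonical path_scale_unlockable := [unlockable fun path_scale].

Lemma path_algP f g : (forall p, pcoef p f = pcoef p g) -> f = g.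
Proof.
by rewrite unlock => fg; apply: val_inj; apply/malgP => p; apply: fg.
Qed.

Lemma psuppP p f : (p \in psupp f) = (pcoef p f != 0).
Proof. by rewrite !unlock mcoeff_neq0. Qed.

Fact path_zeroE p : pcoef p path_zero = 0.
Proof. by rewrite !unlock mcoeff0. Qed.
Fact path_oppE p f : pcoef p (path_opp f) = - pcoef p f.
Proof. by rewrite !unlock mcoeffN. Qed.
Fact path_addE p f g : pcoef p (path_add f g) = pcoef p f + pcoef p g.
Proof. by rewrite !unlock mcoeffD. Qed.
Fact path_scaleE p k f : pcoef p (path_scale k f) = k * pcoef p f.
Proof. by rewrite !unlock mcoeffZ. Qed.

Fact path_addA : associative path_add.
Proof. by move=> f g h; apply: path_algP => p; rewrite !path_addE addrA. Qed.
Fact path_addC : commutative path_add.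
Proof. by move=> f g; apply: path_algP => p; rewrite !path_addE addrC. Qed.
Fact path_add0 : left_id path_zero path_add.
Proof.
by move=> f; apply: path_algP => p; rewrite path_addE path_zeroE add0r.
Qed.
Fact path_addN : left_inverse path_zero path_opp path_add.
Proof.
by move=> f; apply: path_algP => p; rewrite path_addE path_oppE path_zeroE addNr.
Qed.

HB.instance Definition _ := GRing.isZmodule.Build path_alg
  path_addA path_addC path_add0 path_addN.

Fact path_scaleA a b f : path_scale a (path_scale b f) = path_scale (a * b) f.
Proof. by apply: path_algP => p; rewrite !path_scaleE mulrA. Qed.
Fact path_scale1 : left_id 1 path_scale.
Proof. by move=> f; apply: path_algP => p; rewrite path_scaleE mul1r. Qed.
Fact path_scaleDr : right_distributive path_scale +%R.
Proof.
move=> a f g; apply: path_algP => p.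
by rewrite path_scaleE !path_addE !path_scaleE mulrDr.
Qed.
Fact path_scaleDl f : {morph path_scale^~ f : a b / a + b}.
Proof.
by move=> a b; apply: path_algP => p; rewrite path_addE !path_scaleE mulrDl.
Qed.

HB.instance Definition _ := GRing.Zmodule_isLmodule.Build R path_alg
  path_scaleA path_scale1 path_scaleDr path_scaleDl.

Lemma pcoef0 p : pcoef p 0 = 0. Proof. exact: path_zeroE. Qed.
Lemma pcoefN p f : pcoef p (- f) = - pcoef p f. Proof. exact: path_oppE. Qed.
Lemma pcoefD p f g : pcoef p (f + g) = pcoef p f + pcoef p g.
Proof. exact: path_addE. Qed.
Lemma pcoefZ p k f : pcoef p (k *: f) = k * pcoef p f.
Proof. exact: path_scaleE. Qed.
Lemma pcoefU p q : pcoef q (path_elt p) = (p == q)%:R.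
Proof. by rewrite !unlock mcoeffU. Qed.
Lemma pcoef_sum p (T : Type) (r : seq T) (F : T -> path_alg) :
  pcoef p (\sum_(t <- r) F t) = \sum_(t <- r) pcoef p (F t).
Proof. exact: (big_morph (pcoef p) (pcoefD p) (pcoef0 p)). Qed.

Lemma pcoef_out p f : p \notin psupp f -> pcoef p f = 0.
Proof. by rewrite psuppP negbK => /eqP. Qed.

Lemma psuppU_le p : (psupp (path_elt p) `<=` [fset p])%fset.
Proof.
apply/fsubsetP => q; rewrite psuppP pcoefU inE [q == p]eq_sym.
by case: (p == q); rewrite //= eqxx.
Qed.

Lemma psuppD_le f g : (psupp (f + g)%R `<=` psupp f `|` psupp g)%fset.
Proof.
apply/fsubsetP => p; rewrite inE !psuppP pcoefD; apply: contraR.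
by rewrite negb_or !negbK => /andP[/eqP-> /eqP->]; rewrite addr0.
Qed.

Lemma psuppZ_le k f : (psupp (k *: f)%R `<=` psupp f)%fset.
Proof.
apply/fsubsetP => p; rewrite !psuppP pcoefZ; apply: contraNneq => ->.
by rewrite mulr0.
Qed.

Definition opath_elt (o : option (qpath Q)) : path_alg :=
  if o is Some p then path_elt p else 0.

Definition path_one : path_alg := \sum_(v : vertex Q) path_elt (vertex_path v).

Definition path_mul : path_alg -> path_alg -> path_alg :=
  locked_with path_key (fun f g => \sum_(p <- psupp f) \sum_(q <- psupp g)
    (pcoef p f * pcoef q g) *: opath_elt (pcat p q)).
Canonical path_mul_unlockable := [unlockable fun path_mul].

Lemma psupp0 : psupp 0 = fset0.
Proof. by apply/fsetP => p; rewrite psuppP pcoef0 eqxx inE. Qed.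

Lemma path_mulw (d1 d2 : {fset qpath Q}) f g :
  (psupp f `<=` d1)%fset -> (psupp g `<=` d2)%fset ->
  path_mul f g = \sum_(p <- d1) \sum_(q <- d2)
    (pcoef p f * pcoef q g) *: opath_elt (pcat p q).
Proof.
move=> le1 le2; rewrite [path_mul]unlock (big_fset_incl _ le1) /=.
  apply: eq_bigr => p _; apply: big_fset_incl => // q _ /pcoef_out ->.
  by rewrite mulr0 scale0r.
move=> p _ /pcoef_out fp.
by rewrite big1 // => q _; rewrite fp mul0r scale0r.
Qed.

Fact path_mulDl : left_distributive path_mul +%R.
Proof.
move=> f g h; set d := (psupp f `|` psupp g)%fset.
have sh := fsubset_refl (psupp h).
rewrite (path_mulw (psuppD_le f g) sh) (path_mulw (fsubsetUl _ _ : _ `<=` d)%fset sh).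
rewrite (path_mulw (fsubsetUr _ _ : _ `<=` d)%fset sh) -big_split /=.
apply: eq_bigr => p _; rewrite -big_split /=; apply: eq_bigr => q _.
by rewrite pcoefD mulrDl scalerDl.
Qed.

Fact path_mulDr : right_distributive path_mul +%R.
Proof.
move=> h f g; set d := (psupp f `|` psupp g)%fset.
have sh := fsubset_refl (psupp h).
rewrite (path_mulw sh (psuppD_le f g)) (path_mulw sh (fsubsetUl _ _ : _ `<=` d)%fset).
rewrite (path_mulw sh (fsubsetUr _ _ : _ `<=` d)%fset) -big_split /=.
apply: eq_bigr => p _; rewrite -big_split /=; apply: eq_bigr => q _.
by rewrite pcoefD mulrDr scalerDl.
Qed.

Fact path_mul0l f : path_mul 0 f = 0.
Proof. by rewrite [path_mul]unlock psupp0 big_seq_fset0. Qed.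

Fact path_mul0r f : path_mul f 0 = 0.
Proof. by rewrite [path_mul]unlock big1 // => p _; rewrite psupp0 big_seq_fset0. Qed.

Fact path_mulZl k f g : path_mul (k *: f) g = k *: path_mul f g.
Proof.
rewrite (path_mulw (psuppZ_le k f) (fsubset_refl _)) [path_mul]unlock scaler_sumr.
apply: eq_bigr => p _; rewrite scaler_sumr; apply: eq_bigr => q _.
by rewrite pcoefZ -mulrA scalerA.
Qed.

Fact path_mulZr k f g : path_mul f (k *: g) = k *: path_mul f g.
Proof.
rewrite (path_mulw (fsubset_refl _) (psuppZ_le k g)) [path_mul]unlock scaler_sumr.
apply: eq_bigr => p _; rewrite scaler_sumr; apply: eq_bigr => q _.
by rewrite pcoefZ mulrCA scalerA.
Qed.

Lemma path_mulE p q : path_mul (path_elt p) (path_elt q) = opath_elt (pcat p q).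
Proof.
rewrite (path_mulw (psuppU_le p) (psuppU_le q)) !big_seq_fset1.
by rewrite !pcoefU !eqxx mulr1 scale1r.
Qed.

Lemma path_algE f : f = \sum_(p <- psupp f) pcoef p f *: path_elt p.
Proof.
apply: path_algP => q; rewrite pcoef_sum; have [qf|nqf] := boolP (q \in psupp f).
  rewrite (big_fsetD1 q) //= pcoefZ pcoefU eqxx mulr1 big1_fset ?addr0 // => p.
  by rewrite in_fsetD1 => /andP[/negPf nq _] _; rewrite pcoefZ pcoefU nq mulr0.
rewrite (pcoef_out nqf) big1_fset // => p pf _; rewrite pcoefZ pcoefU.
by case: eqP pf nqf => [-> ->//|_ _ _]; rewrite mulr0.
Qed.

Lemma path_alg_ind (T : path_alg -> Prop) :
    T 0 -> (forall f g, T f -> T g -> T (f + g)) ->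
    (forall k f, T f -> T (k *: f)) -> (forall p, T (path_elt p)) ->
  forall f, T f.
Proof.
move=> T0 TD TZ Tp f; rewrite [f]path_algE.
by elim/big_ind: _ => // p _; apply: TZ.
Qed.

Fact path_mulA : associative path_mul.
Proof.
move=> f g h; elim/path_alg_ind: f => [|f1 f2 E1 E2|k f E|p].
- by rewrite !path_mul0l.
- by rewrite (path_mulDl f1 f2 g) !(path_mulDl _ _ h) path_mulDl E1 E2.
- by rewrite (path_mulZl k f g) !(path_mulZl k _ h) path_mulZl E.
set fp := path_elt p; elim/path_alg_ind: g => [|g1 g2 E1 E2|k g E|q].
- by rewrite path_mul0l !path_mul0r path_mul0l.
- by rewrite (path_mulDl g1) (path_mulDr fp g1) (path_mulDl (path_mul fp g1))
    (path_mulDr fp (path_mul g1 h)) E1 E2.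
- by rewrite (path_mulZl k g) (path_mulZr k fp g) (path_mulZl k (path_mul fp g))
    (path_mulZr k fp (path_mul g h)) E.
set gq := path_elt q; elim/path_alg_ind: h => [|h1 h2 E1 E2|k h E|r].
- by rewrite !path_mul0r.
- by rewrite (path_mulDr gq h1) (path_mulDr fp (path_mul gq h1))
    (path_mulDr (path_mul fp gq) h1) E1 E2.
- by rewrite (path_mulZr k gq) (path_mulZr k fp (path_mul gq h))
    (path_mulZr k (path_mul fp gq)) E.
rewrite /fp /gq {fp gq}.
rewrite !path_mulE; have := congr1 opath_elt (pcatA p q r).
case: (pcat p q) (pcat q r) => [u|] [w|] /= /esym;
  by rewrite ?path_mul0l ?path_mul0r ?path_mulE.
Qed.

Fact path_mul1l : left_id path_one path_mul.
Proof.
move=> f; elim/path_alg_ind: f => [|f1 f2 E1 E2|k f E|p].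
- exact: path_mul0r.
- by rewrite path_mulDr E1 E2.
- by rewrite path_mulZr E.
rewrite /path_one.
rewrite (big_morph (path_mul^~ _) (fun f g => path_mulDl f g _) (path_mul0l _)).
rewrite (bigD1 (pstart p)) //= path_mulE pcat_vertexl eqxx big1 ?addr0 // => v.
by move=> /negPf nv; rewrite path_mulE pcat_vertexl nv.
Qed.

Fact path_mul1r : right_id path_one path_mul.
Proof.
move=> f; elim/path_alg_ind: f => [|f1 f2 E1 E2|k f E|p].
- exact: path_mul0l.
- by rewrite path_mulDl E1 E2.
- by rewrite path_mulZl E.
rewrite /path_one (big_morph (path_mul _) (path_mulDr _) (path_mul0r _)).
rewrite (bigD1 (pend p)) //= path_mulE pcat_vertexr eqxx big1 ?addr0 // => v.
by move=> /negPf nv; rewrite path_mulE pcat_vertexr nv.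
Qed.

(* Possibly zero: the quiver may have no vertex. *)
HB.instance Definition _ := GRing.Zmodule_isPzRing.Build path_alg
  path_mulA path_mul1l path_mul1r path_mulDl path_mulDr.

Lemma path_eltM p q : path_elt p * path_elt q = opath_elt (pcat p q).
Proof. exact: path_mulE. Qed.

Definition vertex_elt (v : vertex Q) : path_alg := path_elt (vertex_path v).
Definition arrow_elt (a : arrow Q) : path_alg := path_elt (arrow_path a).

Definition ring_ideal (J : path_alg -> Prop) : Prop :=
  [/\ J 0, forall f g, J f -> J g -> J (f + g)
    & forall f g h, J g -> J (f * g * h)].

Definition ideal_gen (rel : path_alg -> Prop) (f : path_alg) : Prop :=
  forall J, ring_ideal J -> (forall g, rel g -> J g) -> J f.

(* [B] is isomorphic to the algebra given by the quiver [Q] with relations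
   [rel], i.e. to the quotient of the path algebra by [ideal_gen rel].        *)
Definition is_quiver_algebra (rel : path_alg -> Prop) (B : falgType R) : Prop :=
  exists pi : {linear path_alg -> B},
    [/\ monoid_morphism pi, surjective pi
      & forall f, pi f = 0 <-> ideal_gen rel f].

End PathAlgebra.

Section DualExtension.
Variables (R : fieldType) (Q : quiver) (I : Type) (rho : I -> path_alg R Q).

(* [inl a] is the arrow a of Q, [inr a] the opposite arrow a'. *)
Definition double_quiver : quiver :=
  @Quiver (vertex Q) (arrow Q + arrow Q)%type
    (fun a => match a with inl b => src b | inr b => tgt b end)
    (fun a => match a with inl b => tgt b | inr b => src b end).

Local Notation D := (path_alg R double_quiver).

Definition dual_arrow (a : arrow Q) : D := @arrow_elt R double_quiver (inl a).
Definition dual_arrow' (a : arrow Q) : D := @arrow_elt R double_quiver (inr a).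

Definition dual_path (p : qpath Q) : D :=
  @vertex_elt R double_quiver (pstart p) *
  \prod_(a <- parrows p) dual_arrow a.

Definition dual_path' (p : qpath Q) : D :=
  @vertex_elt R double_quiver (pend p) *
  \prod_(a <- rev (parrows p)) dual_arrow' a.

Definition dual_lift (f : path_alg R Q) : D :=
  \sum_(p <- psupp f) pcoef p f *: dual_path p.
Definition dual_lift' (f : path_alg R Q) : D :=
  \sum_(p <- psupp f) pcoef p f *: dual_path' p.

(* Products in the path algebra read from left to right, so that
   [dual_arrow' a * dual_arrow b] is the path a' followed by b, or 0 when these
   are not composable.                                                        *)
Inductive dual_relation : D -> Prop :=
  | DualRel i : dual_relation (dual_lift (rho i))
  | DualRel' i : dual_relation (dual_lift' (rho i))
  | DualRelMixed a b : dual_relation (dual_arrow' a * dual_arrow b).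

Definition is_dual_extension (B : falgType R) : Prop :=
  is_quiver_algebra dual_relation B.

End DualExtension.

(* Vertices 0, ..., r; the arrow indexed by i : 'I_r goes from i + 1 to 0. *)
Definition star (r : nat) : quiver :=
  @Quiver 'I_r.+1 'I_r (fun i => lift ord0 i) (fun=> ord0).

Definition no_relations (R : fieldType) (Q : quiver) (i : void) :
  path_alg R Q := match i with end.

Definition is_dual_extension_of_star (R : fieldType) (B : falgType R) : Prop :=
  exists r : nat, is_dual_extension (@no_relations R (star r)) B.

(* Main.v *)
Require Import Defs.
From HB Require Import structures.
From mathcomp Require Import all_boot all_order all_algebra all_field.
From mathcomp Require Import boolp.
From mathcomp Require finmap monalg classical_sets.

Set Implicit Arguments.
Unset Strict Implicit.
Unset Printing Implicit Defensive.

Import GRing.Theory.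
Local Open Scope ring_scope.

(** Cut X into the blocks x R_i; quasi-thinness says that each has one or two
points.  Regularity of the scheme leaves few possibilities for the block of an
adjacency matrix between x R_i and x R_j: it is zero or the all-ones matrix
J_ij or, when both blocks have two points, one of the two permutation matrices
P_ij and J_ij - P_ij [block_pattern].  Write i ~ j when P_ij lies in the
Terwilliger algebra T.  Then ~ is an equivalence relation on the two-point
blocks, and the J_ij together with the P_ij for i ~ j form a basis of T.  Its
multiplication table is that of matrix units, except that
J_ij J_jl = |x R_j| J_il [terwilliger_block_basis].  Everything else is deduced
from this table, which is the content of the record [block_basis].

The J_ij span an ideal, and modulo this ideal the P_ij are the matrix units of
a product of matrix algebras, one for each class of ~.  Taking the span of the
J_ij as the lowest cell and the classes of ~ as incomparable cells above it
gives a cell datum, with transposition as anti-automorphism [bb_cellular].  As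
x R_0 = {x} has one point, J_00 is an idempotent; it generates the ideal of the
J_ij, its corner is the ground field, and the columns of the ideal are copies
of the projective module T J_00.  So this ideal is a heredity ideal, and the
quotient by it is semisimple: two steps suffice for a heredity chain
[bb_quasi_hereditary].

In characteristic 2 the table degenerates: J_ij J_jl = 0 when x R_j has two
points.  The J_ij for which i or j is a two-point block span a nilpotent ideal,
and every element of T e outside it generates T e, for e one of the idempotents
J_00 and P_cc, with c running over representatives of the classes of ~.  Hence
the T e are the indecomposable projective modules [std_complete_indec], and a
basic algebra of T is opposite to the corner f T f where f is the sum of these
idempotents.  So it has a block basis again, with trivial ~ [basic_block_basis].
In such an algebra J_i0 and J_0i, for i <> 0, are the arrows of a star and
their opposites, J_ij = J_i0 J_0j, and the only relation is
J_0i J_i0 = 2 J_00 = 0 [star_dual_extension].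

For the global dimension, a module over this star algebra is projective as soon
as, for each i <> 0, the maps given by the two arrows form an exact sequence
0 -> M_0 -> M_i -> M_0 and the images of the M_i in M_0 are independent
[star_projective].  Free modules satisfy these conditions, and so does the
kernel of a map from a free module to a submodule of a free module; hence
second syzygies are projective [star_gldim].  Modules may have infinite
dimension here, so linear complements come from Zorn's lemma
[linear_projector]. *)

(** * Modules over a ring *)

Definition mk_linear (A : nzRingType) (M N : lmodType A) (f : M -> N)
    (f_lin : linear f) : {linear M -> N} :=
  HB.pack f (GRing.isLinear.Build A M N _ f f_lin).

(** Projectivity for the identity map: an epimorphism onto a projective splits. *)
Lemma projective_lift (A : nzRingType) (P N : lmodType A) (g : {linear N -> P}) :
  projective P -> surjective g -> exists h : {linear P -> N}, forall p, g (h p) = p.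
Proof.
move=> prP g_surj; have [h hE] := prP _ _ g (idfun : {linear P -> P}) g_surj.
by exists h => p; apply: hE.
Qed.

Section Kernel.
Variables (A : nzRingType) (M N : lmodType A) (f : {linear M -> N}).

Definition ker_pred : {pred M} := fun m => f m == 0.

Fact ker_pred_submod : GRing.submod_closed ker_pred.
Proof.
split; first by rewrite unfold_in linear0.
by move=> a u v; rewrite !unfold_in linearP => /eqP-> /eqP->; rewrite scaler0 addr0.
Qed.

HB.instance Definition _ := GRing.isSubmodClosed.Build A M ker_pred ker_pred_submod.

(** A subtype, so that kernels are modules again and can enter resolutions. *)
Record ker_mod := KerMod { ker_val : M; _ : ker_val \in ker_pred }.
HB.instance Definition _ := [isSub for ker_val].
HB.instance Definition _ := [Choice of ker_mod by <:].
HB.instance Definition _ := [SubChoice_isSubLmodule of ker_mod by <:].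

Lemma ker_valP (u : ker_mod) : f (val u) = 0.
Proof. by apply/eqP; apply: (valP u). Qed.

Lemma ker_ex m : f m = 0 -> exists u : ker_mod, val u = m.
Proof. by move=> fm; have km : m \in ker_pred by [rewrite unfold_in fm]; exists (KerMod km). Qed.

End Kernel.

Section FreeModule.
Import finmap monalg.
Variables (A : nzRingType) (K : choiceType).

Definition free_mod : lmodType A := {malg A[K]}.

(** The universal property; the explicit formula is kept because it recovers
an element of a module from its coordinates in a free cover. *)
Lemma free_modP (M : lmodType A) (v : K -> M) :
  exists h : {linear free_mod -> M}, (forall k, h << k >> = v k) /\
   forall f : free_mod, h f = \sum_(k <- msupp f) f@_k *: v k.
Proof.
pose h (f : free_mod) := \sum_(k <- msupp f) f@_k *: v k.
have hw (d : {fset K}) (f : free_mod) :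
    (msupp f `<=` d)%fset -> h f = \sum_(k <- d) f@_k *: v k.
  move=> le; apply: big_fset_incl => // k _ kf.
  by rewrite mcoeff_outdom // scale0r.
have hlin : linear h.
  move=> a f g; set d := (msupp f `|` msupp g)%fset.
  rewrite (hw d f) ?fsubsetUl // (hw d g) ?fsubsetUr // (hw d (a *: f + g)); last first.
    apply: fsubset_trans (msuppD_le _ _) _; apply: fsetUSS => //.
    exact: msuppZ_le.
  rewrite scaler_sumr -big_split; apply: eq_bigr => k _.
  by rewrite mcoeffD mcoeffZ scalerDl scalerA.
exists (mk_linear hlin); split=> // k.
rewrite /mk_linear /= (hw [fset k]%fset) ?msuppU_le //.
by rewrite big_seq_fset1 mcoeffUU scale1r.
Qed.

End FreeModule.

Section FreeCover.
Import finmap monalg.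

Lemma free_mod_projective (A : nzRingType) (K : choiceType) :
  projective (free_mod A K).
Proof.
move=> M N g f g_surj.
have [h [hU _]] := free_modP (fun k => projT1 (cid (g_surj (f (monalg.mkmalgU k 1))))).
exists h => u /=; rewrite [u]monalg.monalgE !linear_sum; apply: eq_bigr => k _.
have -> : monalg.mkmalgU k (monalg.mcoeff k u) =
    monalg.mcoeff k u *: (monalg.mkmalgU k 1 : free_mod A K).
  apply/monalg.malgP => k'; rewrite monalg.mcoeffZ !monalg.mcoeffU.
  by case: eqP; rewrite ?mulr1 ?mulr0.
by rewrite !linearZ hU /=; case: cid => m /= ->.
Qed.

Lemma free_cover (A : nzRingType) (M : lmodType A) :
  exists2 h : {linear free_mod A M -> M}, surjective h &
    forall f, h f = \sum_(k <- monalg.msupp f) monalg.mcoeff k f *: k.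
Proof.
have [h [hU hE]] := @free_modP A M M id.
by exists h => // m; exists (monalg.mkmalgU m 1).
Qed.

End FreeCover.

(** The resolution is prolonged by zero modules, realised as the kernel of an
identity map. *)
Lemma proj_dim_le2 (A : nzRingType) (M P0 P1 P2 : lmodType A)
    (e : {linear P0 -> M}) (d0 : {linear P1 -> P0}) (d1 : {linear P2 -> P1}) :
  projective P0 -> projective P1 -> projective P2 -> surjective e ->
  (forall p, e p = 0 <-> exists q, d0 q = p) ->
  (forall p, d0 p = 0 <-> exists q, d1 q = p) -> injective d1 ->
  proj_dim_le 2 M.
Proof.
move=> pr0 pr1 pr2 e_surj ex0 ex1 inj1.
pose Z : lmodType A := ker_mod (idfun : {linear P0 -> P0}).
have Z0 : forall z : Z, z = 0 by move=> z; apply: val_inj; apply: (ker_valP z).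
pose P i := match i with 0 => P0 | 1 => P1 | 2 => P2 | _ => Z end.
pose D i : {linear P i.+1 -> P i} := match i with
  0 => d0 | 1 => d1 | 2 => \0 : {linear Z -> P2}
  | _ => (idfun : {linear Z -> Z}) end.
exists P, e, D; split=> //.
- case=> [|[|[|i]]] //= N N' g f g_surj.
  exists (\0 : {linear Z -> N}) => z /=.
  by rewrite [z](Z0 z) !linear0.
- by case=> [|[|[|i]]].
- case=> [|[|[|i]]] p /=.
  + exact: ex1.
  + split=> [p0|[q <-]]; last exact: linear0.
    by exists 0; apply: inj1; rewrite p0; apply: linear0.
  + by split=> // _; exists 0; rewrite (Z0 p).
  + by split=> [_|_]; [exists 0; rewrite (Z0 p) | rewrite (Z0 p)].
Qed.

(** It suffices to treat second syzygies: cover M by a free module, cover the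
kernel by another one, and stop there. *)
Lemma gldim_le2 (A : nzRingType) :
  (forall (K0 K1 : choiceType) (N : lmodType A)
     (d0 : {linear free_mod A K1 -> N}) (j : {linear N -> free_mod A K0}),
     injective j -> projective (ker_mod d0)) -> gldim_le A 2.
Proof.
move=> prK M; have [e e_surj _] := free_cover M.
have [d d_surj _] := free_cover (ker_mod e).
pose i0 : {linear ker_mod e -> free_mod A M} := val.
pose i1 : {linear ker_mod d -> free_mod A (ker_mod e)} := val.
have i0I : injective i0 by apply: val_inj.
apply: (@proj_dim_le2 _ M _ _ (ker_mod d) e (i0 \o d) i1) => //.
- exact: free_mod_projective.
- exact: free_mod_projective.
- exact: (prK _ _ _ d i0).
- move=> p; split=> [/ker_ex[u uE]|[q <-]]; last exact: ker_valP.
  by have [q qE] := d_surj u; exists q; rewrite /= qE.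
- move=> p; split=> [dp0|[q <-]]; last by rewrite /= ker_valP; apply: (linear0 i0).
  by apply: ker_ex; apply: i0I; rewrite (linear0 i0).
- exact: val_inj.
Qed.

Lemma mod_iso_sym (A : nzRingType) (M N : lmodType A) : mod_iso M N -> mod_iso N M.
Proof.
move=> [f [g fK gK]].
have g_lin : linear g.
  by move=> a u v; rewrite -{1}[u]gK -{1}[v]gK -linearP fK.
by exists (mk_linear g_lin); exists f.
Qed.

Lemma mod_iso_trans (A : nzRingType) (M N P : lmodType A) :
  mod_iso M N -> mod_iso N P -> mod_iso M P.
Proof.
by move=> [f f_bij] [g g_bij]; exists (g \o f); apply: bij_comp.
Qed.

(** The epimorphism splits, so P is a direct summand of M, and the complement
(its kernel) has to vanish. *)
Lemma indecomposable_epi (A : nzRingType) (M P : lmodType A) (f : {linear M -> P}) :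
  indecomposable M -> projective P -> ~ trivial_mod P -> surjective f -> mod_iso M P.
Proof.
move=> [_ indM] prP P_nt f_surj; have [h hK] := projective_lift prP f_surj.
have phi_in m : m - h (f m) \in ker_pred f.
  by rewrite unfold_in linearB /= hK subrr.
pose phi m : (P * ker_mod f)%type := (f m, KerMod (phi_in m)).
have phi_lin : linear phi.
  move=> a u v; apply/pair_equal_spec; split; first exact: linearP.
  by apply: val_inj; rewrite /= (linearP f) (linearP h) scalerBr opprD addrACA.
have iso : mod_iso M (P * ker_mod f)%type.
  exists (mk_linear phi_lin); exists (fun pq => h pq.1 + val pq.2) => [m|[p k]] /=.
    by rewrite addrC subrK.
  have fhk : f (h p + val k) = p by rewrite linearD /= hK ker_valP addr0.
  rewrite /phi; apply/pair_equal_spec; split=> //.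
  by apply: val_inj; rewrite /= fhk addrC addKr.
have [//|K0] := indM _ _ iso.
exists f; exists h => // m; apply/eqP; rewrite eq_sym -subr_eq0.
by have /(congr1 val)/= -> := K0 (KerMod (phi_in m)).
Qed.

(** * Vector spaces of arbitrary dimension *)

Section LinearProjector.
Variables (R : fieldType) (V : lmodType R) (U : V -> Prop).
Hypotheses (U0 : U 0) (U_lin : forall a u v, U u -> U v -> U (a *: u + v)).

Definition indep_complement (W : V -> Prop) :=
  (forall a u v, W u -> W v -> W (a *: u + v)) /\ (forall w, W w -> U w -> w = 0).

(** A maximal W meeting U trivially is a complement: a vector outside U + W could
be added to W.  The empty set is a legal W (it is the union of the empty chain),
hence the disjunction in the decomposition. *)
Lemma complement_ex : exists2 W, indep_complement W &
  forall v, exists u w, [/\ U u, w = 0 \/ W w & v = u + w].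
Proof.
have [|W [Wc Wmax]] := @classical_sets.Zorn_bigcup V indep_complement.
  move=> F Fc Ftot; split=> [a u v [A FA Au] [B FB Bv]|w [A FA Aw]].
    have [AB|BA] := Ftot _ _ FA FB.
      by exists B => //; apply: (Fc _ FB).1 => //; apply: AB.
    by exists A => //; apply: (Fc _ FA).1 => //; apply: BA.
  exact: (Fc _ FA).2.
exists W => // v; apply: contrapT => no_dec.
pose W' z := exists c w, (w = 0 \/ W w) /\ z = c *: v + w.
have W0l a u w : u = 0 \/ W u -> w = 0 \/ W w -> (a *: u + w) = 0 \/ W (a *: u + w).
  move=> [->|Wu] [->|Ww]; rewrite ?scaler0 ?add0r; [by left|by right| |].
  - by right; have := Wc.1 (a - 1) _ _ Wu Wu; rewrite scalerBl scale1r subrK addr0.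
  - by right; apply: Wc.1.
have W'c : indep_complement W'.
  split=> [a u z [c [w [Ww ->]]] [c' [w' [Ww' ->]]]|z [c [w [Ww ->]]] Uz].
    exists (a * c + c'), (a *: w + w'); split; first exact: W0l.
    by rewrite scalerDl scalerDr scalerA addrACA.
  have [c0|c0] := eqVneq c 0.
    move: Uz; rewrite c0 scale0r add0r; case: Ww => [->|Ww] //.
    exact: Wc.2.
  case: no_dec; exists (c^-1 *: (c *: v + w)), (- c^-1 *: w); split.
  - by have := U_lin c^-1 Uz U0; rewrite addr0.
  - by have := W0l (- c^-1) w 0 Ww (or_introl erefl); rewrite addr0.
  - by rewrite scalerDr scalerA mulVf // scale1r scaleNr addrK.
apply: (Wmax W' _ W'c); split=> [z Wz|sub].
  by exists 0, z; rewrite scale0r add0r; split=> //; right.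
case: no_dec; exists 0, v; rewrite add0r; split=> //; right.
by apply: sub; exists 1, 0; rewrite scale1r addr0; split=> //; left.
Qed.

(** The projection along a complement.  No dimension is assumed to be finite, so it
is Zorn's lemma that provides the complement. *)
Lemma linear_projector : exists p : {linear V -> V},
  (forall v, U (p v)) /\ (forall u, U u -> p u = u).
Proof.
have [W [Wl W_disj] dec] := complement_ex.
pose W0 w := w = 0 \/ W w.
have W0l a u w : W0 u -> W0 w -> W0 (a *: u + w).
  move=> [->|Wu] [->|Ww]; rewrite ?scaler0 ?add0r; [by left|by right| |].
  - by right; have := Wl (a - 1) _ _ Wu Wu; rewrite scalerBl scale1r subrK addr0.
  - by right; apply: Wl.
have disj w : W0 w -> U w -> w = 0 by case=> [->|] //; apply: W_disj.
pose p v := projT1 (cid (dec v)).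
have pP v : U (p v) /\ W0 (v - p v).
  rewrite /p; case: cid => u /= [w [Uu Ww ->]].
  by rewrite addrC addKr.
have p_eq v u : U u -> W0 (v - u) -> p v = u.
  move=> Uu Wvu; have [Up Wp] := pP v; apply/eqP; rewrite -subr_eq0; apply/eqP.
  apply: disj; last by have := U_lin (-1) Uu Up; rewrite scaleN1r addrC.
  have := W0l (-1) _ _ Wp Wvu; rewrite scaleN1r opprB addrA subrK //.
have p_lin : linear p.
  move=> a u v; have [Uu Wu] := pP u; have [Uv Wv] := pP v.
  apply: p_eq; first exact: U_lin.
  by have := W0l a _ _ Wu Wv; rewrite scalerBr opprD addrACA.
exists (mk_linear p_lin); split=> [v|u Uu]; first by have [] := pP v.
by apply: p_eq; rewrite ?subrr //; left.
Qed.

End LinearProjector.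

(** Lift each vector at random, then subtract its component in the kernel: the
result no longer depends on the lift, hence is linear. *)
Lemma linear_section (R : fieldType) (V W : lmodType R) (g : {linear V -> W}) :
  surjective g -> exists s : {linear W -> V}, forall w, g (s w) = w.
Proof.
move=> g_surj.
have [|a u v /= gu gv|p [pK pid]] := @linear_projector R V (fun v => g v = 0).
- exact: linear0.
- by rewrite linearP /= gu gv scaler0 addr0.
pose m w := projT1 (cid (g_surj w)).
have gm w : g (m w) = w by rewrite /m; case: cid.
pose s w := m w - p (m w).
have s_eq v : s (g v) = v - p v.
  have /eqP : p (m (g v) - v) = m (g v) - v.
    by apply: pid; rewrite linearB /= gm subrr.
  rewrite linearB /= subr_eq => /eqP pm.
  by rewrite /s pm opprD opprB addrA [m _ + _]addrC subrK.
have s_lin : linear s.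
  move=> a u w; rewrite -{1}[u]gm -{1}[w]gm -linearP s_eq linearP /= /s.
  by rewrite scalerBr opprD addrACA.
by exists (mk_linear s_lin) => w; rewrite /= /s linearB /= pK subr0.
Qed.

(** * Algebras with a block basis *)

(** The idempotent attached to a block: P i i is the identity matrix of a two-point
block and J i i that of a one-point block. *)
Definition bb_idem (I : Type) (V : Type) (dbl : pred I) (J P : I -> I -> V) i :=
  if dbl i then P i i else J i i.

(** The multiplication table of a Terwilliger algebra of a quasi-thin scheme,
isolated from matrices so that it applies to basic algebras as well.  [dbl]
marks the two-point blocks, [o] is a one-point block, and [cJ], [cP] are the
coordinate functions on the basis formed by all [J i j] and by the [P i j] with
[E i j].  The factor [(dbl j).+1] is the size of block j. *)
Record block_basis (R : fieldType) (A : falgType R) (I : finType) (o : I)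
    (dbl : pred I) (E : rel I) (J P : I -> I -> A) (cJ cP : I -> I -> A -> R) :
  Prop := BlockBasis {
  bb_o : ~~ dbl o;
  bb_refl : forall i, E i i = dbl i;
  bb_sym : symmetric E;
  bb_trans : transitive E;
  bb_JJ : forall i j k l,
    J i j * J k l = ((j == k) * (dbl j).+1)%:R *: J i l;
  bb_JP : forall i j k l, E k l -> J i j * P k l = (j == k)%:R *: J i l;
  bb_PJ : forall i j k l, E i j -> P i j * J k l = (j == k)%:R *: J i l;
  bb_PP : forall i j k l, E i j -> E k l -> P i j * P k l = (j == k)%:R *: P i l;
  bb_1 : \sum_i bb_idem dbl J P i = 1;
  bb_peirce : forall i j a,
    bb_idem dbl J P i * a * bb_idem dbl J P j = cJ i j a *: J i j + cP i j a *: P i j;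
  bb_cP0 : forall i j a, ~~ E i j -> cP i j a = 0;
  bb_cJlin : forall i j k a b, cJ i j (k *: a + b) = k * cJ i j a + cJ i j b;
  bb_cPlin : forall i j k a b, cP i j (k *: a + b) = k * cP i j a + cP i j b;
  bb_cJJ : forall i j k l, cJ i j (J k l) = ((i == k) && (j == l))%:R;
  bb_cJP : forall i j k l, E k l -> cJ i j (P k l) = 0;
  bb_cPJ : forall i j k l, cP i j (J k l) = 0;
  bb_cPP : forall i j k l, E k l -> cP i j (P k l) = ((i == k) && (j == l))%:R
}.

Section BlockBasisTheory.
Variables (R : fieldType) (A : falgType R) (I : finType) (o : I) (dbl : pred I).
Variables (E : rel I) (J P : I -> I -> A) (cJ cP : I -> I -> A -> R).
Hypothesis bbA : block_basis o dbl E J P cJ cP.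
Local Notation e := (bb_idem dbl J P).
Implicit Types (i j k l : I) (a b : A).

Lemma bb_dbl i j : E i j -> dbl i && dbl j.
Proof.
move=> Eij; have Eji : E j i by rewrite (bb_sym bbA).
rewrite -!(bb_refl bbA); apply/andP; split.
  exact: (bb_trans bbA) Eij Eji.
exact: (bb_trans bbA) Eji Eij.
Qed.

Lemma bb_J1 i j l : J i j * J j l = (dbl j).+1%:R *: J i l.
Proof. by rewrite (bb_JJ bbA) eqxx mul1n. Qed.

Lemma bb_J0 i j k l : j != k -> J i j * J k l = 0.
Proof. by rewrite (bb_JJ bbA) => /negPf->; rewrite scale0r. Qed.

Lemma bb_Joo i l : J i o * J o l = J i l.
Proof. by rewrite bb_J1 (negPf (bb_o bbA)) scale1r. Qed.

Lemma bb_eE j k l : e j * J k l = (j == k)%:R *: J k l.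
Proof.
rewrite /bb_idem; case: ifP => dj; last rewrite (bb_JJ bbA) dj muln1.
  by rewrite (bb_PJ bbA) ?(bb_refl bbA) //; case: eqP => [->|] //; rewrite !scale0r.
by case: eqP => [->|] //; rewrite !scale0r.
Qed.

Lemma bb_Ee j k l : J k l * e j = (l == j)%:R *: J k l.
Proof.
rewrite /bb_idem; case: ifP => dj.
  by rewrite (bb_JP bbA) ?(bb_refl bbA) //; case: eqP => [->|] //; rewrite !scale0r.
by rewrite (bb_JJ bbA); case: eqP => [->|]; rewrite ?dj ?mul1n // !scale0r.
Qed.

Lemma bb_eP j k l : E k l -> e j * P k l = (j == k)%:R *: P k l.
Proof.
move=> Ekl; have /andP[dk _] := bb_dbl Ekl; rewrite /bb_idem; case: ifP => dj.
  by rewrite (bb_PP bbA) ?(bb_refl bbA) //; case: eqP => [->|] //; rewrite !scale0r.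
rewrite (bb_JP bbA) //; case: eqP => [jk|]; last by rewrite !scale0r.
by rewrite jk dk in dj.
Qed.

Lemma bb_Pe j k l : E k l -> P k l * e j = (l == j)%:R *: P k l.
Proof.
move=> Ekl; have /andP[_ dl] := bb_dbl Ekl; rewrite /bb_idem; case: ifP => dj.
  by rewrite (bb_PP bbA) ?(bb_refl bbA) //; case: eqP => [->|] //; rewrite !scale0r.
rewrite (bb_PJ bbA) //; case: eqP => [jk|]; last by rewrite !scale0r.
by rewrite -jk dl in dj.
Qed.

Lemma bb_ee i j : e i * e j = (i == j)%:R *: e i.
Proof.
rewrite {2}/bb_idem; case: ifP => dj; last rewrite bb_eE.
  by rewrite bb_eP ?(bb_refl bbA) // /bb_idem; case: eqP => [->|]; rewrite ?dj // !scale0r.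
by rewrite /bb_idem; case: eqP => [->|]; rewrite ?dj // !scale0r.
Qed.

Lemma bb_idem_id i : e i * e i = e i. Proof. by rewrite bb_ee eqxx scale1r. Qed.

Lemma bb_decomp a :
  a = \sum_i \sum_j (cJ i j a *: J i j + cP i j a *: P i j).
Proof.
rewrite -{1}[a]mul1r -[1 * a]mulr1 -(bb_1 bbA) -mulrA mulr_suml.
by apply: eq_bigr => i _; rewrite mulrA mulr_sumr; apply: eq_bigr => j _; rewrite (bb_peirce bbA).
Qed.

Lemma bb_cPJ_mul i j k l a :
  cP i j a *: P i j * J k l = ((j == k)%:R * cP i j a) *: J i l.
Proof.
have [Eij|/(bb_cP0 bbA)->] := boolP (E i j); last by rewrite mulr0 !scale0r mul0r.
by rewrite -scalerAl (bb_PJ bbA) // scalerA mulrC.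
Qed.

Lemma bb_JcP_mul i j k l a :
  J k l * (cP i j a *: P i j) = ((l == i)%:R * cP i j a) *: J k j.
Proof.
have [Eij|/(bb_cP0 bbA)->] := boolP (E i j); last by rewrite mulr0 !scale0r mulr0.
by rewrite -scalerAr (bb_JP bbA) // scalerA mulrC.
Qed.

Lemma sum_delta (V : lmodType R) j (F : I -> V) :
  \sum_i (i == j)%:R *: F i = F j.
Proof.
by rewrite (bigD1 j) //= eqxx scale1r big1 ?addr0 // => i /negPf->; rewrite scale0r.
Qed.

(** The coefficients do not depend on l: all columns of the ideal spanned by the
J i j are isomorphic left modules, as cellularity demands. *)
Lemma bb_mulJ a k l :
  a * J k l = \sum_i ((dbl k).+1%:R * cJ i k a + cP i k a) *: J i l.
Proof.
rewrite {1}[a]bb_decomp mulr_suml; apply: eq_bigr => i _; rewrite mulr_suml.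
rewrite -(sum_delta k (fun j => ((dbl j).+1%:R * cJ i j a + cP i j a) *: J i l)).
apply: eq_bigr => j _; rewrite mulrDl bb_cPJ_mul -scalerAl (bb_JJ bbA) scalerA natrM.
by rewrite -scalerDl scalerA mulrDr mulrC -mulrA.
Qed.

Lemma bb_Jmul a k l :
  J k l * a = \sum_j ((dbl l).+1%:R * cJ l j a + cP l j a) *: J k j.
Proof.
rewrite {1}[a]bb_decomp exchange_big mulr_sumr; apply: eq_bigr => j _; rewrite mulr_sumr.
rewrite -(sum_delta l (fun i => ((dbl i).+1%:R * cJ i j a + cP i j a) *: J k j)).
apply: eq_bigr => i _; rewrite mulrDr bb_JcP_mul -scalerAr (bb_JJ bbA) scalerA natrM.
rewrite -scalerDl scalerA mulrDr [l == i]eq_sym mulrCA [cJ _ _ _ * _]mulrC.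
by case: eqP => [->|]; rewrite ?mul0r.
Qed.

(** Modulo the J i j, the coefficients do not depend on l. *)
Lemma bb_mulP a k l : E k l ->
  a * P k l = \sum_i (cJ i k a *: J i l + cP i k a *: P i l).
Proof.
move=> Ekl; rewrite {1}[a]bb_decomp mulr_suml; apply: eq_bigr => i _; rewrite mulr_suml.
rewrite -(sum_delta k (fun j => cJ i j a *: J i l + cP i j a *: P i l)).
apply: eq_bigr => j _; rewrite mulrDl -!scalerAl (bb_JP bbA) // scalerDr; congr (_ + _).
  by rewrite scalerA mulrC -scalerA.
have [Eij|/(bb_cP0 bbA)->] := boolP (E i j); last by rewrite !scale0r scaler0.
by rewrite (bb_PP bbA) // !scalerA mulrC.
Qed.

Lemma bb_Pmul a k l : E k l ->
  P k l * a = \sum_j (cJ l j a *: J k j + cP l j a *: P k j).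
Proof.
move=> Ekl; rewrite {1}[a]bb_decomp exchange_big mulr_sumr.
apply: eq_bigr => j _; rewrite mulr_sumr.
rewrite -(sum_delta l (fun i => cJ i j a *: J k j + cP i j a *: P k j)).
apply: eq_bigr => i _; rewrite mulrDr -!scalerAr (bb_PJ bbA) // scalerDr.
rewrite [l == i]eq_sym; congr (_ + _).
  by rewrite scalerA mulrC -scalerA.
have [Eij|/(bb_cP0 bbA)->] := boolP (E i j); last by rewrite !scale0r scaler0.
by rewrite (bb_PP bbA) // !scalerA mulrC eq_sym.
Qed.

Lemma bb_cJ0 i j : cJ i j 0 = 0.
Proof. by have := bb_cJlin bbA i j (-1) 0 0; rewrite scaler0 addr0 mulN1r addNr. Qed.
Lemma bb_cP00 i j : cP i j 0 = 0.
Proof. by have := bb_cPlin bbA i j (-1) 0 0; rewrite scaler0 addr0 mulN1r addNr. Qed.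
Lemma bb_cJZ i j r a : cJ i j (r *: a) = r * cJ i j a.
Proof. by rewrite -[r *: a]addr0 (bb_cJlin bbA) bb_cJ0 addr0. Qed.
Lemma bb_cPZ i j r a : cP i j (r *: a) = r * cP i j a.
Proof. by rewrite -[r *: a]addr0 (bb_cPlin bbA) bb_cP00 addr0. Qed.
Lemma bb_cJD i j a b : cJ i j (a + b) = cJ i j a + cJ i j b.
Proof. by rewrite -[a]scale1r (bb_cJlin bbA) mul1r scale1r. Qed.
Lemma bb_cPD i j a b : cP i j (a + b) = cP i j a + cP i j b.
Proof. by rewrite -[a]scale1r (bb_cPlin bbA) mul1r scale1r. Qed.
Lemma bb_cJsum i j (T : Type) (s : seq T) (Q : pred T) (F : T -> A) :
  cJ i j (\sum_(t <- s | Q t) F t) = \sum_(t <- s | Q t) cJ i j (F t).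
Proof. exact: (big_morph _ (bb_cJD i j) (bb_cJ0 i j)). Qed.
Lemma bb_cPsum i j (T : Type) (s : seq T) (Q : pred T) (F : T -> A) :
  cP i j (\sum_(t <- s | Q t) F t) = \sum_(t <- s | Q t) cP i j (F t).
Proof. exact: (big_morph _ (bb_cPD i j) (bb_cP00 i j)). Qed.

Lemma bb_J_neq0 i j : J i j <> 0.
Proof. by move=> /(congr1 (cJ i j)) /eqP; rewrite bb_cJ0 (bb_cJJ bbA) !eqxx oner_eq0. Qed.

Lemma bb_P_neq0 i j : E i j -> P i j <> 0.
Proof. by move=> Eij /(congr1 (cP i j)) /eqP; rewrite bb_cP00 (bb_cPP bbA) // !eqxx oner_eq0. Qed.

End BlockBasisTheory.

(** * The block basis of the Terwilliger algebra *)

Section Blocks.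
Variables (R : fieldType) (X : finType) (d : nat) (S : assoc_scheme X d) (x : X).
Hypothesis qtS : quasi_thin S.
Local Notation I := 'I_d.+1.
Local Notation MX := 'M[R]_#|X|.-1.+1.
Implicit Types (i j k l : I) (y z w : X) (M N : MX).

Lemma srel_ex y z : exists i, (y, z) \in S i.
Proof.
have /and3P[/eqP cov _ _] := srel_partition S.
have : (y, z) \in cover [set S i | i : I] by rewrite cov inE.
by case/bigcupP=> B /imsetP[i _ ->]; exists i.
Qed.

Lemma srel_uniq i j p : p \in S i -> p \in S j -> i = j.
Proof.
have /and3P[_ /trivIsetP triv _] := srel_partition S.
move=> pi pj; apply: (srel_inj (a := S)); apply/eqP/negPn/negP => Sij.
have := triv _ _ (imset_f _ (erefl : i \in predT)) (imset_f _ (erefl : j \in predT)) Sij.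
by move/disjointFr/(_ pi); rewrite pj.
Qed.

Definition blk y : I := odflt ord0 [pick i | (x, y) \in S i].

Lemma mem_nbhd i y : (y \in nbhd S x i) = (blk y == i).
Proof.
rewrite inE /blk; case: pickP => [k /= Sk|none]; last first.
  by have [k] := srel_ex x y; rewrite none.
by apply/idP/eqP => [Si|<-] //; apply: srel_uniq Sk Si.
Qed.

Lemma card_nbhd i : (0 < #|nbhd S x i| <= 2)%N.
Proof.
rewrite -(valencyE S i x) qtS andbT.
have /and3P[_ _ n0] := srel_partition S.
have /set0Pn[[y z] Syz] : S i != set0.
  by apply: contraNneq n0 => <-; apply: imset_f.
by rewrite (valencyE S i y); apply/card_gt0P; exists z; rewrite inE.
Qed.

Definition is_pair i := #|nbhd S x i| == 2.
Definition base_pt i := odflt x [pick y in nbhd S x i].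
(** On a one-point block the twin is the base point itself; thus the entry at (base
point, twin) always reads off the coefficient of J. *)
Definition twin_pt i := odflt (base_pt i) [pick y in nbhd S x i :\ base_pt i].

Lemma nbhd_base_pt i : base_pt i \in nbhd S x i.
Proof.
rewrite /base_pt; case: pickP => // none; have /andP[] := card_nbhd i.
by case/card_gt0P => y; rewrite none.
Qed.

Lemma card_nbhdD i : #|nbhd S x i| = (#|nbhd S x i :\ base_pt i|).+1.
Proof. by rewrite (cardsD1 (base_pt i)) nbhd_base_pt. Qed.

Lemma is_pair_twin i : is_pair i = (twin_pt i != base_pt i).
Proof.
rewrite /is_pair card_nbhdD eqSS /twin_pt; have /andP[_] := card_nbhd i; rewrite card_nbhdD ltnS.
case: pickP => [y yi|none] le1 /=.
  have -> : (y != base_pt i) = true by case/setD1P: yi.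
  rewrite eqn_leq le1 /=; apply/card_gt0P; by exists y.
by rewrite eqxx (eq_card0 none).
Qed.

Lemma blk_base i : blk (base_pt i) = i.
Proof. by apply/eqP; rewrite -mem_nbhd nbhd_base_pt. Qed.

Lemma blk_twin i : blk (twin_pt i) = i.
Proof.
apply/eqP; rewrite -mem_nbhd /twin_pt; case: pickP => [y /setD1P[]//|_].
exact: nbhd_base_pt.
Qed.

Lemma blkP y : y = base_pt (blk y) \/ y = twin_pt (blk y).
Proof.
have yi : y \in nbhd S x (blk y) by rewrite mem_nbhd.
have [yE|yp] := eqVneq y (base_pt (blk y)); first by left.
right; have yD : y \in nbhd S x (blk y) :\ base_pt (blk y) by apply/setD1P.
have /andP[_] := card_nbhd (blk y); rewrite card_nbhdD ltnS => le1.
rewrite /twin_pt; case: pickP => [z zD|/(_ y)]; last by rewrite yD.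
exact: (card_le1_eqP le1).
Qed.

Lemma big_blk (T : Type) (idx : T) (op : Monoid.com_law idx) i (F : X -> T) :
  \big[op/idx]_(y | blk y == i) F y =
  op (F (base_pt i)) (if is_pair i then F (twin_pt i) else idx).
Proof.
rewrite (bigD1 (base_pt i)) ?blk_base //=; congr (op _ _); rewrite is_pair_twin.
have [tp|tp] := eqVneq (twin_pt i) (base_pt i).
  rewrite big1 // => y /andP[/eqP yi yp].
  by case: (blkP y) yp; rewrite yi => ->; rewrite ?tp eqxx.
rewrite (bigD1 (twin_pt i)) /= ?blk_twin ?eqxx // big1 ?Monoid.mulm1 //.
move=> y /andP[/andP[/eqP yi yp] yt].
by case: (blkP y) yp yt; rewrite yi => ->; rewrite eqxx.
Qed.

Lemma is_pair0 : ~~ is_pair ord0.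
Proof.
rewrite /is_pair (_ : nbhd S x ord0 = [set x]) ?cards1 //.
by apply/setP => y; rewrite !inE srel_diag inE eq_sym.
Qed.

Lemma card_blk i (b : pred X) :
  #|[set y in nbhd S x i | b y]| = (b (base_pt i) + (is_pair i && b (twin_pt i)))%N.
Proof.
transitivity (\sum_(y | blk y == i) b y)%N; last by rewrite big_blk; case: (is_pair i).
rewrite -sum1_card big_mkcond [RHS]big_mkcond; apply: eq_bigr => y _.
by rewrite inE mem_nbhd; case: eqP => //= _; case: (b y).
Qed.

(** The points z of x R_j with (y, z) in R_l are counted by an intersection number
of the pair (x, y), which lies in R_i. *)
Lemma row_regular (i j l : I) y y' : blk y = i -> blk y' = i ->
  #|[set z in nbhd S x j | (y, z) \in S l]| = #|[set z in nbhd S x j | (y', z) \in S l]|.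
Proof.
move=> yi yi'; have Sy : (x, y) \in S i by have := mem_nbhd i y; rewrite inE yi eqxx => ->.
have Sy' : (x, y') \in S i by have := mem_nbhd i y'; rewrite inE yi' eqxx => ->.
have := srel_reg (a := S) j (conv_idx S l) Sy Sy'; rewrite conv_idxE /=.
have eqs u : [set z | ((x, z) \in S j) && ((z, u) \in [set p | (p.2, p.1) \in S l])] =
    [set z in nbhd S x j | (u, z) \in S l] by apply/setP => z; rewrite !inE.
by rewrite !eqs.
Qed.

Lemma col_regular i j l z z' : blk z = j -> blk z' = j ->
  #|[set y in nbhd S x i | (y, z) \in S l]| = #|[set y in nbhd S x i | (y, z') \in S l]|.
Proof.
move=> zj zj'.
have Sz : (x, z) \in S j by have := mem_nbhd j z; rewrite inE zj eqxx => ->.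
have Sz' : (x, z') \in S j by have := mem_nbhd j z'; rewrite inE zj' eqxx => ->.
have := srel_reg (a := S) i l Sz Sz' => /=.
have eqs u : [set y | ((x, y) \in S i) && ((y, u) \in S l)] =
    [set y in nbhd S x i | (y, u) \in S l] by apply/setP => y; rewrite !inE.
by rewrite !eqs.
Qed.

(** Equal row sums and equal column sums of a 0-1 matrix of size at most 2 x 2 leave
only the pattern of a combination of J and P. *)
Lemma block_pattern i j l y z : blk y = i -> blk z = j ->
  ((y, z) \in S l) = if (y == base_pt i) == (z == base_pt j) then (base_pt i, base_pt j) \in S l
                     else (base_pt i, twin_pt j) \in S l.
Proof.
move=> yi zj.
have rowE := row_regular j l (blk_base i) (blk_twin i).
have colE := col_regular i l (blk_base j) (blk_twin j).
rewrite !card_blk in rowE colE.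
have := blkP y; have := blkP z; rewrite yi zj.
have := is_pair_twin i; have := is_pair_twin j.
case: (is_pair i) rowE colE; case: (is_pair j) => rowE colE /esym tj /esym ti;
  rewrite ?tj ?ti.
- case=> -> [] ->; rewrite ?eqxx ?(negPf tj) ?(negPf ti) //=; move: rowE colE;
  by do 4![case: (_ \in S l)].
- move/negbFE/eqP: tj rowE colE => -> rowE colE.
  case=> -> [] ->; rewrite ?eqxx ?(negPf ti) //=; move: rowE colE;
  by do 4?[case: (_ \in S l)].
- move/negbFE/eqP: ti rowE colE => -> rowE colE.
  case=> -> [] ->; rewrite ?eqxx ?(negPf tj) //=; move: rowE colE;
  by do 4?[case: (_ \in S l)].
move/negbFE/eqP: tj => ->; move/negbFE/eqP: ti => ->.
by case=> -> [] ->; rewrite ?eqxx.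
Qed.

(** If block i is a point, equal column sums make the matrix constant; if block j is
a point, its twin is its base point. *)
Lemma block_constant i j l : ~~ (is_pair i && is_pair j) ->
  ((base_pt i, base_pt j) \in S l) = ((base_pt i, twin_pt j) \in S l).
Proof.
have colE := col_regular i l (blk_base j) (blk_twin j); rewrite !card_blk in colE.
have := is_pair_twin j; case: (is_pair j); last by move/esym/negbFE/eqP->.
by rewrite andbT => _ /negPf di; move: colE; rewrite di /= !addn0; do 2![case: (_ \in S l)].
Qed.


Definition xinv (a : 'I_#|X|.-1.+1) : X := nth x (enum X) a.

Lemma xidxK : cancel (@xidx X) xinv.
Proof.
move=> y; have X0 : (0 < #|X|)%N by apply/card_gt0P; exists x.
by rewrite /xinv /xidx inordK ?prednK // nth_enum_rank.
Qed.

Lemma xinvK : cancel xinv (@xidx X).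
Proof. by apply/(bij_can_sym (xidx_bij x))/xidxK. Qed.

Definition entry M y z : R := M (xidx y) (xidx z).

Definition mx_of_fun (f : X -> X -> R) : MX := \matrix_(a, b) f (xinv a) (xinv b).

Lemma entry_fun f y z : entry (mx_of_fun f) y z = f y z.
Proof. by rewrite /entry mxE !xidxK. Qed.

Lemma entryP M N : (forall y z, entry M y z = entry N y z) -> M = N.
Proof.
move=> MN; apply/matrixP => a b.
by have := MN (xinv a) (xinv b); rewrite /entry !xinvK.
Qed.

Lemma entryM M N y z : entry (M * N) y z = \sum_w entry M y w * entry N w z.
Proof.
rewrite /entry [LHS]mxE (reindex (@xidx X)) //.
by apply: onW_bij; apply: xidx_bij x.
Qed.

Lemma entryD M N y z : entry (M + N) y z = entry M y z + entry N y z.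
Proof. by rewrite /entry mxE. Qed.
Lemma entryZ r M y z : entry (r *: M) y z = r * entry M y z.
Proof. by rewrite /entry mxE. Qed.
Lemma entry1 y z : entry 1 y z = (y == z)%:R.
Proof. by rewrite /entry mxE (inj_eq (can_inj xidxK)). Qed.
Lemma entry_sum (K : Type) (s : seq K) (Q : pred K) (F : K -> MX) y z :
  entry (\sum_(k <- s | Q k) F k) y z = \sum_(k <- s | Q k) entry (F k) y z.
Proof. by rewrite /entry summxE. Qed.

Definition mJ i j : MX := mx_of_fun (fun y z => ((blk y == i) && (blk z == j))%:R).
(** The choice of the base points identifies any two two-point blocks.  An arbitrary
choice is harmless: the other identification is J - P. *)
Definition mP i j : MX := mx_of_fun (fun y z =>
  [&& blk y == i, blk z == j & (y == base_pt i) == (z == base_pt j)]%:R).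
Local Notation me := (bb_idem is_pair mJ mP).
Local Notation TX := <<<<terwilliger_gens R S x>>%VS>>%AS.
(** The equivalence relation ~, defined by membership in the whole algebra and not
only in the span of the triple products, so that transitivity is immediate. *)
Definition mE i j := [&& is_pair i, is_pair j & mP i j \in TX].

Lemma entry_adj l y z : entry (adj_mx R S l) y z = ((y, z) \in S l)%:R.
Proof. exact: adj_mxE. Qed.

Lemma entry_dual i y z : entry (dual_idem R S x i) y z = ((blk y == i) && (y == z))%:R.
Proof.
rewrite entry_sum; under eq_bigr do rewrite /entry /unit_mx mxE !(inj_eq (can_inj xidxK)).
rewrite (eq_bigl (fun w => blk w == i)) => [|w]; last by rewrite mem_nbhd.
have [yi|yi] := boolP (blk y == i); last first.
  rewrite big1 // => w wi; case: eqP => [yw|] //=.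
  by rewrite yw wi in yi.
rewrite (bigD1 y) //= eqxx /= eq_sym big1 ?addr0 // => w /andP[_ /negPf].
by rewrite eq_sym => ->.
Qed.

Lemma entry_me i y z : entry (me i) y z = ((blk y == i) && (y == z))%:R.
Proof.
rewrite /bb_idem; have ti := is_pair_twin i.
case: ifP ti => _ ti; rewrite entry_fun; congr (_ : bool)%:R.
  case: eqP => [yi|] //=; case: (blk z =P i) => [zi|zi] /=; last first.
    by apply/esym/eqP => yz; rewrite yz in yi.
  have := blkP y; have := blkP z; rewrite yi zi.
  by case=> -> [] ->; rewrite ?eqxx // 1?(eq_sym (base_pt i)) (negPf (esym ti)).
case: eqP => [yi|] //=; case: (blk z =P i) => [zi|zi] /=; last first.
  by apply/esym/eqP => yz; rewrite yz in yi.
have := blkP y; have := blkP z; rewrite yi zi; move/esym/negbFE/eqP: ti => ->.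
by case=> -> [] ->; rewrite eqxx.
Qed.

Lemma me_dual i : me i = dual_idem R S x i.
Proof. by apply: entryP => y z; rewrite entry_me entry_dual. Qed.

Lemma entry_peirce i j M y z :
  entry (me i * M * me j) y z = ((blk y == i) && (blk z == j))%:R * entry M y z.
Proof.
rewrite entryM (bigD1 z) //= big1 => [|w wz]; last first.
  by rewrite entry_me (negPf wz) andbF mulr0.
rewrite entry_me eqxx andbT addr0 entryM (bigD1 y) //= big1 => [|w wy]; last first.
  by rewrite entry_me [y == w]eq_sym (negPf wy) andbF mul0r.
rewrite entry_me eqxx andbT addr0.
by case: eqP => _; case: eqP => _; rewrite ?mul1r ?mul0r ?mulr1 ?mulr0.
Qed.

Lemma gen_in M : M \in terwilliger_gens R S x -> M \in TX.
Proof. by move=> Mg; apply: (subvP (sub_agenv _)); apply: memv_span. Qed.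

Lemma adj_in l : adj_mx R S l \in TX.
Proof. by apply: gen_in; rewrite mem_cat; apply/orP; left; apply: image_f. Qed.

Lemma me_in i : me i \in TX.
Proof. by rewrite me_dual; apply: gen_in; rewrite mem_cat; apply/orP; right; apply: image_f. Qed.

Lemma twl_one : 1 \in TX.
Proof. by rewrite memvE; apply: sub1_agenv. Qed.

Lemma twl_mul M N : M \in TX -> N \in TX -> M * N \in TX.
Proof. exact: (memvM (A := TX)). Qed.

(** The relations partition X x X, so the adjacency matrices add up to the all-ones
matrix. *)
Lemma mJ_in i j : mJ i j \in TX.
Proof.
have -> : mJ i j = \sum_l me i * adj_mx R S l * me j.
  apply: entryP => y z; rewrite entry_sum entry_fun.
  under eq_bigr do rewrite entry_peirce entry_adj.
  rewrite -mulr_sumr; have [l Sl] := srel_ex y z.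
  rewrite (bigD1 l) //= Sl big1 ?addr0 ?mulr1 // => k kl.
  by case: (boolP ((y, z) \in S k)) => // Sk; rewrite (srel_uniq Sk Sl) eqxx in kl.
apply: memv_suml => l _.
by apply: twl_mul; [apply: twl_mul; [apply: me_in|apply: adj_in]|apply: me_in].
Qed.

(** The set of generators is stable under transposition. *)
Lemma twl_tr M : M \in TX -> M^T \in TX.
Proof.
pose t : 'End(MX) := linfun (trmx : {linear MX -> MX}).
suff le : (TX <= t @^-1: TX)%VS.
  by move/(subvP le); rewrite -memv_preim lfunE.
apply: agenv_sub_modl.
  apply/subvP => _ /vlineP[r ->].
  by rewrite -memv_preim lfunE /= linearZ /= trmx1 memvZ // twl_one.
apply/prodvP => g N gens; rewrite -!memv_preim !lfunE /= => Nt.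
rewrite trmx_mul; apply: twl_mul => //.
suff le : (<<terwilliger_gens R S x>> <= t @^-1: TX)%VS.
  by have := subvP le _ gens; rewrite -memv_preim lfunE.
apply/span_subvP => h; rewrite -memv_preim lfunE mem_cat /= => /orP[]/imageP[i _ ->].
  have -> : (adj_mx R S i)^T = adj_mx R S (conv_idx S i); last exact: adj_in.
  apply: entryP => y z; rewrite /entry mxE !adj_mxE conv_idxE inE //.
have -> : (dual_idem R S x i)^T = dual_idem R S x i; last by rewrite -me_dual; apply: me_in.
apply: entryP => y z; rewrite [LHS]mxE -/(entry _ z y) !entry_dual [z == y]eq_sym.
by case: (y =P z) => [->|]; rewrite ?andbF.
Qed.

Lemma mP_tr i j : (mP i j)^T = mP j i.
Proof.
apply: entryP => y z; rewrite [LHS]mxE -/(entry _ z y) !entry_fun.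
by rewrite andbCA [(y == base_pt j) == _]eq_sym.
Qed.

Lemma mE_refl i : mE i i = is_pair i.
Proof.
rewrite /mE; case: (boolP (is_pair i)) => //= di.
by have := me_in i; rewrite /bb_idem di.
Qed.

Lemma mE_sym : symmetric mE.
Proof.
move=> i j; rewrite /mE andbCA; congr [&& _, _ & _].
by apply/idP/idP => /twl_tr; rewrite mP_tr.
Qed.

Lemma entry_mJ i j y z : entry (mJ i j) y z = [&& blk y == i, blk z == j & true]%:R.
Proof. by rewrite entry_fun andbT. Qed.

Lemma entry_mP i j y z : entry (mP i j) y z =
  [&& blk y == i, blk z == j & (y == base_pt i) == (z == base_pt j)]%:R.
Proof. by rewrite entry_fun. Qed.

Lemma sum_block_prod (a c : bool) j k (f g : pred X) :
  \sum_w [&& a, blk w == j & f w]%:R * [&& blk w == k, c & g w]%:R =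
  (a && c)%:R * ((j == k) * ((f (base_pt j) && g (base_pt j)) +
    [&& is_pair j, f (twin_pt j) & g (twin_pt j)]))%:R :> R.
Proof.
pose h w : R := [&& a && c, j == k & f w && g w]%:R.
transitivity (\sum_(w | blk w == j) h w).
  rewrite [RHS]big_mkcond; apply: eq_bigr => w _; rewrite /h.
  case: (blk w =P j) => [->|]; last by rewrite andbF mul0r.
  rewrite -natrM mulnb; congr (_ : bool)%:R.
  by case: (a); case: (c); case: (f w); case: (g w); rewrite ?andbF ?andbT.
rewrite big_blk /h -natrM; case: (a && c); case: (j == k) => /=; rewrite ?mul0n ?mul1n //=.
- by rewrite natrD; case: (is_pair j).
- by case: ifP; rewrite addr0.
- by case: ifP; rewrite addr0.
- by case: ifP; rewrite addr0.
Qed.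

Lemma mJJ i j k l : mJ i j * mJ k l = ((j == k) * (is_pair j).+1)%:R *: mJ i l.
Proof.
apply: entryP => y z; rewrite entryZ entryM.
under eq_bigr do rewrite !entry_mJ.
by rewrite sum_block_prod entry_mJ andbT mulrC !andbT.
Qed.

Lemma twin_base_pt j : is_pair j -> (twin_pt j == base_pt j) = false.
Proof. by rewrite is_pair_twin => /negPf. Qed.

Lemma mJP i j k l : is_pair k -> mJ i j * mP k l = (j == k)%:R *: mJ i l.
Proof.
move=> dk; apply: entryP => y z; rewrite entryZ entryM.
under eq_bigr do rewrite entry_mJ entry_mP.
rewrite sum_block_prod entry_mJ andbT mulrC; congr (_ %:R * _).
case: eqP => [->|]; rewrite ?mul0n // dk eqxx twin_base_pt //=.
by case: (z == base_pt l).
Qed.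

Lemma mPJ i j k l : is_pair j -> mP i j * mJ k l = (j == k)%:R *: mJ i l.
Proof.
move=> dj; apply: entryP => y z; rewrite entryZ entryM.
under eq_bigr do rewrite entry_mJ entry_mP.
rewrite sum_block_prod entry_mJ !andbT mulrC; congr (_ %:R * _).
case: eqP => _; rewrite ?mul0n // dj eqxx twin_base_pt //.
by case: (y == base_pt i).
Qed.

Lemma mPP i j k l : is_pair j -> mP i j * mP k l = (j == k)%:R *: mP i l.
Proof.
move=> dj; apply: entryP => y z; rewrite entryZ entryM.
under eq_bigr do rewrite !entry_mP.
rewrite sum_block_prod entry_mP -!natrM; congr (_ %:R).
case: (j =P k) => [<-|]; rewrite ?mul0n ?muln0 // dj eqxx twin_base_pt //=.
by case: (y == base_pt i); case: (z == base_pt l); case: (blk y == i); case: (blk z == l).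
Qed.

Lemma mE_trans : transitive mE.
Proof.
move=> j i k /and3P[di dj Pij] /and3P[_ dk Pjk]; rewrite /mE di dk /=.
have -> : mP i k = mP i j * mP j k by rewrite mPP // eqxx scale1r.
exact: twl_mul.
Qed.

Lemma me_sum : \sum_i me i = 1.
Proof.
apply: entryP => y z; rewrite entry_sum entry1 (bigD1 (blk y)) //= entry_me eqxx /=.
rewrite big1 ?addr0 // => i /negPf iy.
by rewrite entry_me eq_sym iy.
Qed.

Lemma span_ind (V : vectType R) (s : seq V) (Q : V -> Prop) :
  Q 0 -> (forall r u v, Q u -> Q v -> Q (r *: u + v)) -> {in s, forall u, Q u} ->
  {in <<s>>%VS, forall u, Q u}.
Proof.
move=> Q0 Ql Qs u us; rewrite (coord_span (X := in_tuple s) us).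
apply: (big_ind Q) => // [v w Qv Qw|i _].
  by rewrite -[v]scale1r; apply: (Ql).
by rewrite -[_ *: _]addr0; apply: (Ql) => //; apply: Qs; apply: mem_nth.
Qed.

Definition mcJ i j M : R := entry M (base_pt i) (twin_pt j).
Definition mcP i j M : R :=
  if mE i j then entry M (base_pt i) (base_pt j) - entry M (base_pt i) (twin_pt j) else 0.

Definition blocked M := forall i j,
  me i * M * me j = mcJ i j M *: mJ i j + mcP i j M *: mP i j.

Lemma blocked_lin r M N : blocked M -> blocked N -> blocked (r *: M + N).
Proof.
move=> bM bN i j; rewrite mulrDr mulrDl -scalerAr -scalerAl bM bN.
have -> : mcJ i j (r *: M + N) = r * mcJ i j M + mcJ i j N by rewrite /mcJ entryD entryZ.
have -> : mcP i j (r *: M + N) = r * mcP i j M + mcP i j N.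
  rewrite /mcP; case: ifP => _; last by rewrite mulr0 addr0.
  by rewrite !entryD !entryZ mulrBr opprD addrACA.
by rewrite !scalerDl scalerDr !scalerA addrACA.
Qed.

Lemma blockedP M : (forall y z, entry M y z = mcJ (blk y) (blk z) M +
    mcP (blk y) (blk z) M * ((y == base_pt (blk y)) == (z == base_pt (blk z)))%:R) -> blocked M.
Proof.
move=> ME i j; apply: entryP => y z; rewrite entry_peirce entryD !entryZ !entry_fun.
have [yi|] := eqVneq (blk y) i; last by rewrite !mul0r !mulr0 addr0.
have [zj|] := eqVneq (blk z) j; last by rewrite !mul0r !mulr0 addr0.
by rewrite /= mul1r mulr1 ME yi zj.
Qed.

Lemma blocked_mJ k l : blocked (mJ k l).
Proof.
apply: blockedP => y z; rewrite /mcJ /mcP !entry_fun !blk_base !blk_twin subrr.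
by case: ifP; rewrite mul0r addr0.
Qed.

Lemma blocked_mP k l : mE k l -> blocked (mP k l).
Proof.
move=> Ekl; have /and3P[_ dl _] := Ekl; apply: blockedP => y z.
rewrite /mcJ /mcP !entry_fun !blk_base !blk_twin.
have [->|] := eqVneq (blk y) k; last by rewrite /= subrr; case: ifP; rewrite mul0r addr0.
have [->|] := eqVneq (blk z) l; last by rewrite /= subrr; case: ifP; rewrite mul0r addr0.
by rewrite Ekl !eqxx twin_base_pt //= subr0 mul1r add0r.
Qed.

Definition block_seq := [seq mJ p.1 p.2 | p : I * I] ++
  [seq mP p.1 p.2 | p <- enum [pred p : I * I | mE p.1 p.2]].
Local Notation U := (<<block_seq>>%VS).

Lemma block_span_J i j : mJ i j \in U.
Proof.
apply: memv_span; rewrite mem_cat; apply/orP; left.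
by apply/imageP; exists (i, j).
Qed.

Lemma block_span_P i j : mE i j -> mP i j \in U.
Proof.
move=> Eij; apply: memv_span; rewrite mem_cat; apply/orP; right.
by apply/mapP; exists (i, j) => //; rewrite mem_enum.
Qed.

Lemma block_span_ind (Q : MX -> Prop) : (forall r M N, Q M -> Q N -> Q (r *: M + N)) ->
  (forall i j, Q (mJ i j)) -> (forall i j, mE i j -> Q (mP i j)) -> {in U, forall M, Q M}.
Proof.
move=> Ql QJ QP; apply: span_ind => //.
  by have := Ql (-1) _ _ (QJ ord0 ord0) (QJ ord0 ord0); rewrite scaleN1r addNr.
move=> M; rewrite mem_cat => /orP[/imageP[p _ ->]|/mapP[p]]; first exact: QJ.
by rewrite mem_enum => Ep ->; apply: QP.
Qed.

Lemma block_span_lin r M N : M \in U -> N \in U -> r *: M + N \in U.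
Proof. by move=> UM UN; rewrite memvD ?memvZ. Qed.

Lemma block_span_mul M N : M \in U -> N \in U -> M * N \in U.
Proof.
move=> UM UN; move: M UM; apply: block_span_ind => [r M M' UM UM'|i j|i j Eij].
- by rewrite mulrDl -scalerAl; apply: block_span_lin.
- move: N UN; apply: block_span_ind => [r M M' UM UM'|k l|k l Ekl].
  + by rewrite mulrDr -scalerAr; apply: block_span_lin.
  + by rewrite mJJ memvZ ?block_span_J.
  + by rewrite mJP ?memvZ ?block_span_J //; case/and3P: Ekl.
have /and3P[_ dj _] := Eij; move: N UN; apply: block_span_ind => [r M M' UM UM'|k l|k l Ekl].
- by rewrite mulrDr -scalerAr; apply: block_span_lin.
- by rewrite mPJ // memvZ ?block_span_J.
rewrite mPP //; have [jk|_] := eqVneq j k; last by rewrite scale0r mem0v.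
by rewrite memvZ // block_span_P //; apply: mE_trans Eij _; rewrite jk.
Qed.

Lemma block_span_idem i : me i \in U.
Proof.
rewrite /bb_idem; case: ifP => di; last exact: block_span_J.
by apply: block_span_P; rewrite mE_refl.
Qed.

Lemma adj_block i j l :
  let p : R := ((base_pt i, base_pt j) \in S l)%:R in
  let q : R := ((base_pt i, twin_pt j) \in S l)%:R in
  me i * adj_mx R S l * me j = q *: mJ i j + (p - q) *: mP i j.
Proof.
move=> p q; apply: entryP => y z; rewrite entry_peirce entry_adj entryD !entryZ !entry_fun.
have [yi|] := eqVneq (blk y) i; last by rewrite !mul0r !mulr0 addr0.
have [zj|] := eqVneq (blk z) j; last by rewrite !mul0r !mulr0 addr0.
rewrite /= mul1r mulr1 (block_pattern l yi zj).
by case: ifP => _; rewrite /= ?mulr1 ?mulr0 ?addr0 // addrC subrK.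
Qed.

(** A block of an adjacency matrix is q J + (p - q) P.  If p = q there is no P, and
if p and q differ then P is a combination of J and of this block, both in T. *)
Lemma block_span_adj l : adj_mx R S l \in U.
Proof.
have -> : adj_mx R S l = \sum_i \sum_j me i * adj_mx R S l * me j.
  rewrite -[LHS]mul1r -[1 * _]mulr1 -me_sum mulr_sumr exchange_big.
  by apply: eq_bigr => j _; rewrite mulr_suml mulr_suml.
apply: memv_suml => i _; apply: memv_suml => j _.
have := adj_block i j l; set p : R := _%:R; set q : R := _%:R => /= blE.
have [pq|pq] := eqVneq p q; first by rewrite blE pq subrr scale0r addr0 memvZ ?block_span_J.
rewrite blE memvD ?memvZ ?block_span_J // block_span_P //.
apply/and3P; have : is_pair i && is_pair j.
  by apply: contraNT pq => /(@block_constant i j l); rewrite /p /q => ->.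
case/andP=> -> ->; split=> //.
have -> : mP i j = (p - q)^-1 *: (me i * adj_mx R S l * me j - q *: mJ i j).
  by rewrite blE [q *: _ + _]addrC addrK scalerA mulVf ?scale1r // subr_eq0.
apply/memvZ/memvB; last by apply/memvZ/mJ_in.
by apply: twl_mul; [apply: twl_mul; [apply: me_in|apply: adj_in]|apply: me_in].
Qed.

(** The span of the J and P contains the generators and is closed under products,
so it contains T; and blockwise decomposition is clear on this span. *)
Lemma twl_blocked M : M \in TX -> blocked M.
Proof.
suff le : (TX <= U)%VS.
  move/(subvP le); move: M; apply: block_span_ind; first exact: blocked_lin.
    exact: blocked_mJ.
  exact: blocked_mP.
apply: agenv_sub_modl.
  by rewrite -memvE -me_sum; apply: memv_suml => i _; apply: block_span_idem.
apply/prodvP => g N gens UN; apply: block_span_mul => //.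
suff le : (<<terwilliger_gens R S x>> <= U)%VS by apply: (subvP le).
apply/span_subvP => h; rewrite mem_cat => /orP[]/imageP[i _ ->]; first exact: block_span_adj.
by rewrite -me_dual; apply: block_span_idem.
Qed.

Local Notation T := (terwilliger R S x).
Definition tJ i j : T := vsproj TX (mJ i j).
Definition tP i j : T := vsproj TX (mP i j).
Definition tcJ i j (a : T) : R := mcJ i j (vsval a).
Definition tcP i j (a : T) : R := mcP i j (vsval a).

Lemma tJE i j : vsval (tJ i j) = mJ i j. Proof. by rewrite vsprojK // mJ_in. Qed.
Lemma tPE i j : mE i j -> vsval (tP i j) = mP i j.
Proof. by case/and3P=> _ _ Pij; rewrite vsprojK. Qed.

Lemma teE i : vsval (bb_idem is_pair tJ tP i) = me i.
Proof. by rewrite /bb_idem; case: ifP => di; rewrite ?tJE // tPE // mE_refl. Qed.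

Theorem terwilliger_block_basis : block_basis ord0 is_pair mE tJ tP tcJ tcP.
Proof.
split.
- exact: is_pair0.
- exact: mE_refl.
- exact: mE_sym.
- exact: mE_trans.
- by move=> i j k l; apply: val_inj; rewrite /= !tJE mJJ.
- by move=> i j k l Ekl; apply: val_inj; rewrite /= tPE // !tJE mJP //; case/and3P: Ekl.
- by move=> i j k l Eij; apply: val_inj; rewrite /= tPE // !tJE mPJ //; case/and3P: Eij.
- move=> i j k l Eij Ekl; apply: val_inj; have /and3P[_ dj _] := Eij.
  rewrite /= (tPE Eij) (tPE Ekl) mPP //; have [jk|_] := eqVneq j k; last by rewrite !scale0r.
  by rewrite tPE //; apply: mE_trans Eij _; rewrite jk.
- apply: val_inj; rewrite raddf_sum /=; under eq_bigr do rewrite teE.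
  by rewrite me_sum; apply/esym/eqP; rewrite algid_eq1 twl_one.
- move=> i j a; apply: val_inj; rewrite /= !teE twl_blocked ?subvsP // tJE.
  by rewrite /tcP /mcP; case: ifP => Eij; rewrite ?scale0r // tPE.
- by move=> i j a /negPf nE; rewrite /tcP /mcP nE.
- by move=> i j r a b; rewrite /tcJ /mcJ /= entryD entryZ.
- move=> i j r a b; rewrite /tcP /mcP; case: ifP => _; last by rewrite mulr0 addr0.
  by rewrite /= !entryD !entryZ mulrBr opprD addrACA.
- move=> i j k l; rewrite /tcJ tJE /mcJ entry_fun blk_base blk_twin //.
- move=> i j k l Ekl; rewrite /tcJ tPE // /mcJ entry_fun blk_base blk_twin.
  have [->|] := eqVneq i k => //=; have [->|] := eqVneq j l => //=.
  by have /and3P[_ dl _] := Ekl; rewrite eqxx twin_base_pt.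
- move=> i j k l; rewrite /tcP tJE /mcP !entry_fun !blk_base blk_twin subrr.
  by case: ifP.
- move=> i j k l Ekl; rewrite /tcP tPE // /mcP !entry_fun !blk_base blk_twin.
  have [->|] := eqVneq i k => /=; last by rewrite subrr; case: ifP.
  have [->|] := eqVneq j l => /=; last by rewrite subrr; case: ifP.
  by have /and3P[_ dl _] := Ekl; rewrite Ekl !eqxx twin_base_pt //= subr0.
Qed.

End Blocks.

(** * Cellularity *)

Lemma dual_free (R : fieldType) (V : vectType R) (K : finType) (F : K -> V)
    (phi : K -> V -> R) :
  (forall k r u v, phi k (r *: u + v) = r * phi k u + phi k v) ->
  (forall k l, phi k (F l) = (k == l)%:R) ->
  free [seq F k | k : K].
Proof.
move=> lin dual; have phi0 k : phi k 0 = 0.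
  by have := lin k (-1) 0 0; rewrite scaler0 addr0 mulN1r addNr.
have -> : [seq F k | k : K] = codom_tuple F by [].
apply/freeP => c c0 i; have /(congr1 (phi (enum_val i))) := c0.
have phiD k u v : phi k (u + v) = phi k u + phi k v.
  by rewrite -[u]scale1r lin mul1r scale1r.
have phiZ k r u : phi k (r *: u) = r * phi k u by rewrite -[r *: u]addr0 lin phi0 addr0.
rewrite (big_morph _ (phiD _) (phi0 _)) phi0 (bigD1 i) //= big1 => [|j ji].
  rewrite addr0 phiZ nth_codom dual.
  by rewrite eqxx mulr1.
rewrite phiZ nth_codom dual (inj_eq enum_val_inj).
by rewrite eq_sym (negPf ji) mulr0.
Qed.

Lemma tag_neq (R : pzSemiRingType) (I : eqType) (T_ : I -> eqType) (u v : {i : I & T_ i}) :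
  tag u <> tag v -> (u == v)%:R = 0 :> R.
Proof. by move=> uv; case: eqP => // /(congr1 tag). Qed.

(** [None] is the cell of the J i j; [Some c] is the cell of the class represented
by c, and an empty cell when c represents no class. *)
Definition cell_idx (I : Type) := option I.

Section CellOrder.
Variable I : finType.
HB.instance Definition _ := Finite.on (cell_idx I).
Definition cell_le (l m : cell_idx I) := (l == None) || (l == m).
Fact cell_le_refl : reflexive cell_le. Proof. by move=> l; rewrite /cell_le eqxx orbT. Qed.
Fact cell_le_anti : antisymmetric cell_le.
Proof. by move=> [c|] [c'|] //= /andP[/eqP]. Qed.
Fact cell_le_trans : transitive cell_le.
Proof. by move=> [c|] [c'|] [c''|] //= /eqP-> /eqP->; apply: cell_le_refl. Qed.
HB.instance Definition _ := Order.Le_isPOrder.Build (Order.Disp tt tt) (cell_idx I)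
  cell_le_refl cell_le_anti cell_le_trans.

Lemma cell_bot_lt (c : I) : ((None : cell_idx I) < (Some c : cell_idx I))%O.
Proof. by rewrite Order.POrderTheory.lt_def. Qed.
End CellOrder.

Section BlockAlgebra.
Variables (R : fieldType) (A : falgType R) (I : finType) (o : I) (dbl : pred I).
Variables (E : rel I) (J P : I -> I -> A) (cJ cP : I -> I -> A -> R).
Hypothesis bbA : block_basis o dbl E J P cJ cP.
Local Notation e := (bb_idem dbl J P).
Implicit Types (i j k l : I) (a b : A).

Lemma bb_ind (Q : A -> Prop) :
  (forall r a b, Q a -> Q b -> Q (r *: a + b)) -> (forall i j, Q (J i j)) ->
  (forall i j, E i j -> Q (P i j)) -> forall a, Q a.
Proof.
move=> Qlin QJ QP a; have Q0 : Q 0.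
  by have := Qlin (-1) _ _ (QJ o o) (QJ o o); rewrite scaleN1r addNr.
have QD b c : Q b -> Q c -> Q (b + c) by move=> Qb Qc; rewrite -[b]scale1r; apply: Qlin.
rewrite [a](bb_decomp bbA); apply: (big_ind Q) => // i _; apply: (big_ind Q) => // j _.
apply: (Qlin) => //; have [Eij|/(bb_cP0 bbA)->] := boolP (E i j); last by rewrite scale0r.
by rewrite -[_ *: _]addr0; apply: Qlin => //; apply: QP.
Qed.

Definition bb_flip_fun a : A := \sum_i \sum_j (cJ j i a *: J i j + cP j i a *: P i j).

Fact bb_flip_lin : linear bb_flip_fun.
Proof.
move=> r a b; rewrite /bb_flip_fun scaler_sumr -big_split; apply: eq_bigr => i _.
rewrite scaler_sumr -big_split; apply: eq_bigr => j _ /=.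
rewrite (bb_cJlin bbA) (bb_cPlin bbA) !scalerDl scalerDr !scalerA.
by rewrite addrACA.
Qed.

Definition bb_flip : {linear A -> A} := mk_linear bb_flip_lin.

Lemma sum2_delta (V : lmodType R) k l (F : I -> I -> V) :
  \sum_i \sum_j ((k == i) && (l == j))%:R *: F i j = F k l.
Proof.
rewrite (bigD1 k) //= [X in _ + X]big1 ?addr0 => [|i /negPf ik].
  rewrite (bigD1 l) //= !eqxx scale1r big1 ?addr0 // => j /negPf jl.
  by rewrite [l == j]eq_sym jl scale0r.
by rewrite big1 // => j _; rewrite eq_sym ik scale0r.
Qed.

Lemma bb_flipJ k l : bb_flip (J k l) = J l k.
Proof.
rewrite -[RHS](sum2_delta l k J); apply: eq_bigr => i _; apply: eq_bigr => j _.
by rewrite (bb_cJJ bbA) (bb_cPJ bbA) scale0r addr0 andbC ![_ == k]eq_sym ![_ == l]eq_sym.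
Qed.

Lemma bb_flipP k l : E k l -> bb_flip (P k l) = P l k.
Proof.
move=> Ekl; rewrite -[RHS](sum2_delta l k P); apply: eq_bigr => i _; apply: eq_bigr => j _.
by rewrite (bb_cJP bbA) // (bb_cPP bbA) // scale0r add0r andbC ![_ == k]eq_sym ![_ == l]eq_sym.
Qed.

Lemma bb_flipZ r a : bb_flip (r *: a) = r *: bb_flip a.
Proof. exact: linearZ. Qed.

Lemma bb_E_sym i j : E i j -> E j i. Proof. by rewrite (bb_sym bbA). Qed.

(** Transposition on the basis; bilinearity reduces the claim to products of basis
elements. *)
Lemma bb_flipM a b : bb_flip (a * b) = bb_flip b * bb_flip a.
Proof.
move: a; apply: bb_ind => [r a a' E1 E2|i j|i j Eij].
- by rewrite mulrDl -scalerAl !(linearP bb_flip) E1 E2 mulrDr -scalerAr.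
- move: b; apply: bb_ind => [r b b' E1 E2|k l|k l Ekl].
  + by rewrite mulrDr -scalerAr !(linearP bb_flip) E1 E2 mulrDl -scalerAl.
  + rewrite (bb_JJ bbA) bb_flipZ !bb_flipJ (bb_JJ bbA) [k == j]eq_sym.
    by case: eqP => [->|] //=; rewrite !scale0r.
  + have Elk := bb_E_sym Ekl.
    rewrite (bb_JP bbA _ _ Ekl) bb_flipZ !bb_flipJ (bb_flipP Ekl) (bb_PJ bbA _ _ Elk).
    by rewrite [k == j]eq_sym.
have Eji := bb_E_sym Eij; move: b; apply: bb_ind => [r b b' E1 E2|k l|k l Ekl].
- by rewrite mulrDr -scalerAr !(linearP bb_flip) E1 E2 mulrDl -scalerAl.
- rewrite (bb_PJ bbA _ _ Eij) bb_flipZ !bb_flipJ (bb_flipP Eij) (bb_JP bbA _ _ Eji).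
  by rewrite [k == j]eq_sym.
have Elk := bb_E_sym Ekl.
rewrite (bb_PP bbA Eij Ekl) bb_flipZ (bb_flipP Eij) (bb_flipP Ekl) (bb_PP bbA Elk Eji).
rewrite [k == j]eq_sym; case: eqP => [jk|_]; last by rewrite !scale0r.
by rewrite jk in Eij; rewrite (bb_flipP (bb_trans bbA Eij Ekl)).
Qed.

Lemma bb_flipK : involutive bb_flip.
Proof.
apply: bb_ind => [r a b E1 E2|i j|i j Eij]; first by rewrite !linearP E1 E2.
  by rewrite !bb_flipJ.
by rewrite (bb_flipP Eij) (bb_flipP (bb_E_sym Eij)).
Qed.

(** Depends only on the class of i, since [pick] is extensional. *)
Definition bb_rep i := odflt i [pick k | E i k].

Lemma bb_repE i : dbl i -> E i (bb_rep i).
Proof.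
by move=> di; rewrite /bb_rep; case: pickP => //= /(_ i); rewrite (bb_refl bbA) di.
Qed.

Lemma bb_rep_eq i j : E i j -> bb_rep i = bb_rep j.
Proof.
move=> Eij; have Eji : E j i by rewrite (bb_sym bbA).
have Ek : E i =1 E j.
  by move=> k; apply/idP/idP => [/(bb_trans bbA Eji)|/(bb_trans bbA Eij)].
rewrite /bb_rep (eq_pick Ek); case: pickP => //= /(_ i); rewrite Eji //.
Qed.

Lemma bb_rep_E i j : dbl i -> dbl j -> bb_rep i = bb_rep j -> E i j.
Proof.
move=> /bb_repE Ei /bb_repE /bb_E_sym Ej ij; apply: (bb_trans bbA) Ei _.
by rewrite ij.
Qed.

Local Notation cellI := (cell_idx I).

Definition cell_set (l : cellI) : finType :=
  match l with None => I | Some c => {i : I | dbl i && (bb_rep i == c)} end.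

Definition cell_elt (l : cellI) : cell_set l -> cell_set l -> A :=
  match l with
  | None => J
  | Some c => fun U V => P (val U) (val V)
  end.

Lemma cell_E c (U V : cell_set (Some c)) : E (val U) (val V).
Proof.
have /andP[dU /eqP cU] := valP U; have /andP[dV /eqP cV] := valP V.
by apply: bb_rep_E; rewrite ?cU.
Qed.

Definition cell_coord (l : cellI) : cell_set l -> cell_set l -> A -> R :=
  match l with
  | None => cJ
  | Some c => fun U V => cP (val U) (val V)
  end.

Lemma cell_basisP : basis_of {:A}
  [seq cell_elt (tagged u).1 (tagged u).2 | u : {l : cellI & (cell_set l * cell_set l)%type}].
Proof.
rewrite /basis_of andbC; apply/andP; split.
  apply: (@dual_free _ _ _ _ (fun u => cell_coord (tagged u).1 (tagged u).2)).
    case=> -[c|] [U V] /= r a b; first exact: (bb_cPlin bbA).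
    exact: (bb_cJlin bbA).
  case=> -[c|] [U V] [[c'|] [U' V']] /=.
  - rewrite (bb_cPP bbA) ?cell_E //.
    have [cc|ncc] := eqVneq c c'.
      by case: c' / cc U' V' => U' V'; rewrite eq_Tagged /= xpair_eqE !(inj_eq val_inj).
    have -> : (val U == val U') && (val V == val V') = false.
      apply/negP => /andP[/eqP UU _]; move/eqP: ncc; apply.
      have /andP[_ /eqP eU] := valP U; have /andP[_ /eqP eU'] := valP U'.
      exact: etrans (esym eU) (etrans (congr1 bb_rep UU) eU').
    rewrite tag_neq //= => -[] /eqP.
    by rewrite (negPf ncc).
  - by rewrite (bb_cPJ bbA).
  - by rewrite (bb_cJP bbA) ?cell_E.
  - by rewrite (bb_cJJ bbA) eq_Tagged /= xpair_eqE.
rewrite eqEsubv subvf /=; apply/subvP => a _; move: a; apply: bb_ind => [r a b Ua Ub|i j|i j Eij].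
- by rewrite memvD ?memvZ.
- apply: memv_span; apply/imageP.
  by exists (Tagged (fun m => cell_set m * cell_set m)%type
    ((i, j) : cell_set None * cell_set None)).
have /andP[di dj] := bb_dbl bbA Eij.
have ui : dbl i && (bb_rep i == bb_rep i) by rewrite di eqxx.
have uj : dbl j && (bb_rep j == bb_rep i) by rewrite dj (bb_rep_eq Eij) eqxx.
apply: memv_span; apply/imageP.
by exists (Tagged (fun m => cell_set m * cell_set m)%type
  ((exist _ i ui, exist _ j uj) : cell_set (Some (bb_rep i)) * cell_set (Some (bb_rep i)))).
Qed.

Lemma sum_cell (V : lmodType R) c (F : I -> V) :
  (forall i, ~~ (dbl i && (bb_rep i == c)) -> F i = 0) ->
  \sum_i F i = \sum_(W : cell_set (Some c)) F (val W).
Proof.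
move=> F0; rewrite (bigID (fun i => dbl i && (bb_rep i == c))) /=.
rewrite [X in _ + X]big1 // addr0.
rewrite (reindex_omap (val : cell_set (Some c) -> I) insub); last first.
  by move=> i Pi; rewrite insubT.
by apply: eq_bigl => W; rewrite (valP W) valK eqxx.
Qed.

(** The rule for a times a basis element is the column independence in [bb_mulJ] and [bb_mulP]; in
the latter the J-part is the error term in the lower cell. *)
Theorem bb_cellular : cellular A.
Proof.
exists (Order.Disp tt tt), (cell_idx I), cell_set, cell_elt, bb_flip; split.
- exact: cell_basisP.
- exact: bb_flipM.
- exact: bb_flipK.
- by case=> [c|] U V; [apply: bb_flipP; apply: cell_E | apply: bb_flipJ].
move=> a [c|]; last first.
  exists (fun W U => (dbl U).+1%:R * cJ W U a + cP W U a) => U V.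
  by rewrite (bb_mulJ bbA) subrr mem0v.
exists (fun W U => cP (val W) (val U) a) => U V; have EUV := cell_E U V.
rewrite (bb_mulP bbA _ EUV) big_split /= [X in _ + X - _](sum_cell (c := c)); last first.
  move=> i ni; rewrite (bb_cP0 bbA) ?scale0r //; apply: contra ni => EiU.
  have /andP[di _] := bb_dbl bbA EiU; rewrite di (bb_rep_eq EiU) /=.
  by have /andP[] := valP U.
rewrite addrK; apply: memv_suml => i _; apply: memvZ.
apply: (subvP (sumv_sup (None : cell_idx I) (cell_bot_lt c) (subvv _))).
apply: memv_span; apply/imageP.
by exists ((i, val V) : cell_set None * cell_set None).
Qed.

End BlockAlgebra.

(** * Quasi-heredity *)

Section LeftIdeals.
Variables (R : fieldType) (A : falgType R).
Implicit Types (L : {vspace A}) (a b : A).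

Lemma left_idealP L : reflect (forall a b, b \in L -> a * b \in L) (left_ideal L).
Proof.
apply: (iffP prodvP) => [h a b Lb|h a b _ Lb]; last exact: h.
by apply: h; rewrite ?memvf.
Qed.

Lemma right_idealP L : reflect (forall a b, b \in L -> b * a \in L) (right_ideal L).
Proof.
apply: (iffP prodvP) => [h a b Lb|h a b Lb _]; last exact: h.
by apply: h; rewrite ?memvf.
Qed.

Lemma maximal_left_ideal_ex L : left_ideal L -> L != {:A}%VS ->
  exists2 M, maximal_left_ideal M & (L <= M)%VS.
Proof.
move: {2}(\dim {:A} - \dim L)%N (leqnn (\dim {:A} - \dim L)) => n.
elim: n L => [|n IHn] L le_n Lid Lprop.
  by case/negP: Lprop; rewrite eqEdim subvf /= -subn_eq0 -leqn0.
case: (pselect (exists2 L', left_ideal L' & [/\ (L <= L')%VS, L' != L & L' != {:A}%VS])).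
  move=> [L' L'id [LL' nLL' L'prop]].
  have dimLL' : (\dim L < \dim L')%N.
    rewrite ltn_neqAle dimvS // andbT; apply: contraNneq nLL' => dimE.
    by rewrite eq_sym eqEdim LL' dimE /=.
  have [|M Mmax L'M] := IHn L' _ L'id L'prop; last by exists M => //; apply: subv_trans L'M.
  rewrite -ltnS; apply: leq_trans le_n; apply: ltn_sub2l => //.
  by apply: leq_trans dimLL' _; apply/dimvS/subvf.
move=> noL; exists L => //; split=> // L' L'id LL'.
have [->|nLL'] := eqVneq L' L; first by left.
have [->|nL'A] := eqVneq L' {:A}%VS; first by right.
by case: noL; exists L'.
Qed.

Lemma jacobson_rad_mull a b : @jacobson_rad R A b -> @jacobson_rad R A (a * b).
Proof. by move=> rb M Mmax; have [/left_idealP Mid _ _] := Mmax; apply/Mid/rb. Qed.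

(** After rescaling, z is an idempotent; a maximal left ideal containing 1 - z would
also contain z, hence 1. *)
Lemma jacobson_rad_quasi_idem s z :
  @jacobson_rad R A z -> z * z = s *: z -> s != 0 -> z = 0.
Proof.
move=> rz zz s0; pose y := 1 - s^-1 *: z.
have zy0 : y * z = 0.
  by rewrite /y mulrBl mul1r -scalerAl zz scalerA mulVf // scale1r subrr.
pose L := ({:A} * <[y]>)%VS.
have Lid : left_ideal L.
  apply/left_idealP => a b /memv_cosetP[c _ ->].
  by rewrite mulrA; apply/memv_cosetP; exists (a * c); rewrite ?memvf.
have [Lfull|Lprop] := eqVneq L {:A}%VS.
  have : 1 \in L by rewrite Lfull memvf.
  by case/memv_cosetP=> c _ /(congr1 (fun a => a * z)); rewrite mul1r -mulrA zy0 mulr0.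
have [M Mmax LM] := maximal_left_ideal_ex Lid Lprop.
have [/left_idealP Mid Mprop _] := Mmax.
have M1 : 1 \in M.
  rewrite -[1](subrK (s^-1 *: z)); apply: memvD; last by rewrite memvZ // rz.
  by apply: (subvP LM); apply/memv_cosetP; exists 1; rewrite ?memvf ?mul1r.
case/eqP: Mprop; apply/eqP; rewrite eqEsubv subvf /=; apply/subvP => a _.
by rewrite -[a]mulr1; apply: Mid.
Qed.

(** The dual basis criterion, with maps f k that need only be linear on L. *)
Lemma dual_basis_projective L (Lid : left_ideal L) (K : finType)
    (f : K -> A -> A) (x : K -> A) :
  (forall k, x k \in L) ->
  (forall k, {in L &, {morph f k : u v / u + v}}) ->
  (forall k a, {in L, forall u, f k (a * u) = a * f k u}) ->
  {in L, forall u, u = \sum_k f k u * x k} ->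
  projective (lideal_mod Lid).
Proof.
move=> xL fD fM fE M N g h g_surj.
pose X k : lideal_mod Lid := Subvs (xL k).
have /choice[m mE] : forall k, exists m, g m = h (X k) by move=> k; apply: g_surj.
pose F (u : lideal_mod Lid) : M := \sum_k f k (vsval (u : subvs_of L)) *: m k.
have Flin : linear F.
  move=> a u v; rewrite /F scaler_sumr -big_split; apply: eq_bigr => k _ /=.
  have uL := subvsP (u : subvs_of L); have vL := subvsP (v : subvs_of L).
  by rewrite fD ?fM ?(left_idealP _ Lid) // scalerDl scalerA.
exists (mk_linear Flin) => u /=; rewrite /F linear_sum.
have {2}-> : u = \sum_k f k (vsval (u : subvs_of L)) *: X k.
  apply: val_inj; rewrite [LHS](fE _ (subvsP (u : subvs_of L))).
  have -> : forall s : seq K,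
      val (\sum_(k <- s) f k (vsval (u : subvs_of L)) *: X k : lideal_mod Lid) =
      \sum_(k <- s) f k (vsval (u : subvs_of L)) * x k; last by [].
  by elim=> [|k s IHs]; rewrite ?big_nil ?big_cons //= -IHs.
by rewrite linear_sum; apply: eq_bigr => k _; rewrite !linearZ /= mE.
Qed.

Lemma regular_projective (Lid : left_ideal {:A}%VS) : projective (lideal_mod Lid).
Proof.
apply: (@dual_basis_projective _ Lid unit (fun=> id) (fun=> 1)) => //.
- by move=> _; apply: memvf.
- by move=> u _; rewrite big_const card_unit /= mulr1 addr0.
Qed.

End LeftIdeals.

Section QuasiHereditary.
Variables (R : fieldType) (A : falgType R) (I : finType) (o : I) (dbl : pred I).
Variables (E : rel I) (J P : I -> I -> A) (cJ cP : I -> I -> A -> R).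
Hypothesis bbA : block_basis o dbl E J P cJ cP.
Local Notation e := (bb_idem dbl J P).
Implicit Types (i j k l : I) (a b : A).

Definition bb_proj_fun a : A := \sum_i \sum_j cP i j a *: P i j.

Fact bb_proj_lin : linear bb_proj_fun.
Proof.
move=> r a b; rewrite /bb_proj_fun scaler_sumr -big_split; apply: eq_bigr => i _.
rewrite scaler_sumr -big_split; apply: eq_bigr => j _ /=.
by rewrite (bb_cPlin bbA) scalerDl scalerA.
Qed.

(** Forgets the J-part.  It is multiplicative, so that its kernel is an ideal and its
image is a model of the quotient algebra, with its own unit. *)
Definition bb_proj : 'Hom(A, A) := linfun (mk_linear bb_proj_lin).

Lemma bb_projE a : bb_proj a = \sum_i \sum_j cP i j a *: P i j.
Proof. by rewrite lfunE. Qed.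

Lemma bb_projJ k l : bb_proj (J k l) = 0.
Proof.
by rewrite bb_projE big1 // => i _; rewrite big1 // => j _; rewrite (bb_cPJ bbA) scale0r.
Qed.

Lemma bb_projP k l : E k l -> bb_proj (P k l) = P k l.
Proof.
move=> Ekl; rewrite bb_projE -[RHS](sum2_delta k l P).
apply: eq_bigr => i _; apply: eq_bigr => j _.
by rewrite (bb_cPP bbA) // [i == k]eq_sym [j == l]eq_sym.
Qed.

Lemma bb_projM a b : bb_proj (a * b) = bb_proj a * bb_proj b.
Proof.
move: a; apply: (bb_ind bbA) => [r a a' E1 E2|i j|i j Eij].
- by rewrite mulrDl -scalerAl !linearP /= E1 E2 mulrDl -scalerAl.
- rewrite bb_projJ mul0r (bb_Jmul bbA) linear_sum big1 // => k _.
  by rewrite linearZ /= bb_projJ scaler0.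
move: b; apply: (bb_ind bbA) => [r b b' E1 E2|k l|k l Ekl].
- by rewrite mulrDr -scalerAr !linearP /= E1 E2 mulrDr -scalerAr.
- by rewrite (bb_PJ bbA _ _ Eij) linearZ /= !bb_projJ scaler0 mulr0.
rewrite (bb_PP bbA Eij Ekl) linearZ /= (bb_projP Eij) (bb_projP Ekl) (bb_PP bbA Eij Ekl).
case: eqP => [jk|_]; last by rewrite !scale0r.
by rewrite jk in Eij; rewrite (bb_projP (bb_trans bbA Eij Ekl)).
Qed.

Lemma bb_cP_proj i j a : cP i j (bb_proj a) = cP i j a.
Proof.
move: a; apply: (bb_ind bbA) => [r a b E1 E2|k l|k l Ekl].
- by rewrite linearP !(bb_cPlin bbA) E1 E2.
- by rewrite bb_projJ (bb_cP00 bbA) (bb_cPJ bbA).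
- by rewrite bb_projP.
Qed.

(** The ideal spanned by the J i j. *)
Definition bb_ideal : {vspace A} := lker bb_proj.

Lemma mem_bb_idealP a : reflect (forall i j, cP i j a = 0) (a \in bb_ideal).
Proof.
rewrite memv_ker; apply: (iffP eqP) => [a0 i j|a0].
  by rewrite -bb_cP_proj a0 (bb_cP00 bbA).
by rewrite bb_projE big1 // => i _; rewrite big1 // => j _; rewrite a0 scale0r.
Qed.

Lemma bb_idealE a : a \in bb_ideal -> a = \sum_i \sum_j cJ i j a *: J i j.
Proof.
move/mem_bb_idealP=> a0; rewrite {1}[a](bb_decomp bbA).
by apply: eq_bigr => i _; apply: eq_bigr => j _; rewrite a0 scale0r addr0.
Qed.

Lemma mem_bb_idealJ i j : J i j \in bb_ideal.
Proof. by apply/mem_bb_idealP => k l; apply: (bb_cPJ bbA). Qed.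

Lemma bb_ideal_two_sided : two_sided_ideal bb_ideal.
Proof.
apply/andP; split; [apply/left_idealP|apply/right_idealP] => a b;
  by rewrite !memv_ker bb_projM => /eqP->; rewrite ?mulr0 ?mul0r.
Qed.

(** The product is s J_oo for a scalar s, and z = J_ko J_oj a is in the radical and
satisfies z z = s z; if s were nonzero, z would vanish and s with it. *)
Lemma bb_ideal_rad a j k : @jacobson_rad R A a -> J o j * a * J k o = 0.
Proof.
move=> ra; pose y := J o j * a; rewrite -/y.
pose c l := (dbl j).+1%:R * cJ j l a + cP j l a.
have yE : y = \sum_l c l *: J o l by apply: (bb_Jmul bbA).
pose s := c k * (dbl k).+1%:R.
have yJ : y * J k o = s *: J o o.
  rewrite yE mulr_suml (bigD1 k) //= big1 ?addr0 => [|l lk].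
    by rewrite -scalerAl (bb_J1 bbA) scalerA.
  by rewrite -scalerAl (bb_J0 bbA) // scaler0.
rewrite yJ; have [s_0|s0] := eqVneq s 0; first by rewrite s_0 scale0r.
pose z := J k o * y.
have z0 : z = 0.
  apply: (@jacobson_rad_quasi_idem _ _ s z) => //.
    by rewrite /z /y mulrA; apply: jacobson_rad_mull.
  by rewrite /z mulrA -[J k o * y * _]mulrA yJ -scalerAr -scalerAl (bb_Joo bbA).
have {}z0 : z = \sum_l c l *: J k l -> c k = 0.
  move=> zE; have := congr1 (cJ k k) zE; rewrite z0 (bb_cJ0 bbA) (bb_cJsum bbA).
  rewrite (bigD1 k) //= big1 ?addr0 => [|l lk].
    by rewrite (bb_cJZ bbA) (bb_cJJ bbA) !eqxx mulr1.
  by rewrite (bb_cJZ bbA) (bb_cJJ bbA) [k == l]eq_sym (negPf lk) andbF mulr0.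
suff ck : c k = 0 by rewrite /s ck mul0r eqxx in s0.
apply: z0; rewrite /z yE mulr_sumr; apply: eq_bigr => l _.
by rewrite -scalerAr (bb_Joo bbA).
Qed.

(** The maps f j send column j to column o; they are left linear because the action
of A is the same on all columns, and u is the sum of the f j u times J o j. *)
Lemma bb_ideal_heredity : heredity_ideal bb_ideal.
Proof.
have /andP[Lid Rid] := bb_ideal_two_sided; split.
- exact: bb_ideal_two_sided.
- apply/eqP; rewrite eqEsubv; apply/andP; split.
    by apply: subv_trans Rid; apply: prodvSr; apply: subvf.
  apply/subvP => a /bb_idealE->; apply: memv_suml => i _; apply: memv_suml => j _.
  by apply: memvZ; rewrite -(bb_Joo bbA); apply: memv_mul; apply: mem_bb_idealJ.
- move=> u a v /bb_idealE-> ra /bb_idealE->; rewrite -mulrA.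
  rewrite !mulr_suml big1 // => i _; rewrite mulr_suml big1 // => j _.
  rewrite !mulr_sumr big1 // => k _; rewrite !mulr_sumr big1 // => l _.
  rewrite -scalerAl -!scalerAr -(bb_Joo bbA i j) -(bb_Joo bbA k l) !mulrA.
  rewrite -(mulrA (J i o)) -(mulrA (J i o)) bb_ideal_rad // mulr0 mul0r.
  by rewrite !scaler0.
exists Lid; pose f j u : A := \sum_i cJ i j u *: J i o.
apply: (@dual_basis_projective _ _ _ _ I f (fun j => J o j)).
- by move=> j; apply: mem_bb_idealJ.
- move=> j u v _ _; rewrite /f -big_split; apply: eq_bigr => i _.
  by rewrite (bb_cJD bbA) scalerDl.
- move=> j a u /bb_idealE uE; rewrite /f {1}uE.
  have cJau i : cJ i j (a * u) = \sum_k ((dbl k).+1%:R * cJ i k a + cP i k a) * cJ k j u.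
    rewrite {1}uE mulr_sumr (bb_cJsum bbA); apply: eq_bigr => k _.
    rewrite mulr_sumr (bb_cJsum bbA) (bigD1 j) //= big1 ?addr0 => [|l lj].
      rewrite -scalerAr (bb_cJZ bbA) (bb_mulJ bbA) (bb_cJsum bbA) (bigD1 i) //=.
      rewrite big1 ?addr0 => [|m mi].
        by rewrite (bb_cJZ bbA) (bb_cJJ bbA) !eqxx mulr1 mulrC.
      by rewrite (bb_cJZ bbA) (bb_cJJ bbA) [i == m]eq_sym (negPf mi) mulr0.
    rewrite -scalerAr (bb_cJZ bbA) (bb_mulJ bbA) (bb_cJsum bbA) big1 ?mulr0 // => m _.
    by rewrite (bb_cJZ bbA) (bb_cJJ bbA) [j == l]eq_sym (negPf lj) andbF mulr0.
  rewrite -uE mulr_sumr; under eq_bigr do rewrite cJau scaler_suml.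
  rewrite exchange_big; apply: eq_bigr => k _; rewrite -scalerAr (bb_mulJ bbA) scaler_sumr.
  by apply: eq_bigr => i _; rewrite scalerA mulrC.
- move=> u /bb_idealE uE; rewrite {1}uE exchange_big; apply: eq_bigr => j _.
  by rewrite /f mulr_suml; apply: eq_bigr => i _; rewrite -scalerAl (bb_Joo bbA).
Qed.

Lemma bb_no_dbl : (forall i, ~~ dbl i) -> bb_ideal = {:A}%VS.
Proof.
move=> nd; apply/eqP; rewrite eqEsubv subvf /=; apply/subvP => a _.
apply/mem_bb_idealP => i j; apply: (bb_cP0 bbA).
by apply/negP => /(bb_dbl bbA)/andP[]; rewrite (negPf (nd i)).
Qed.

Section Quotient.
Variable i0 : I.
Hypothesis di0 : dbl i0.

Fact bb_quot_aspace : is_aspace (limg bb_proj).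
Proof.
apply/andP; split; last first.
  apply/prodvP => _ _ /memv_imgP[a _ ->] /memv_imgP[b _ ->].
  by rewrite -bb_projM memv_img ?memvf.
apply/has_algidP; exists (bb_proj 1); split; first by rewrite memv_img ?memvf.
  apply/eqP => p1; have Eii : E i0 i0 by rewrite (bb_refl bbA).
  apply: (bb_P_neq0 bbA Eii); rewrite -(bb_projP Eii) -[P _ _]mul1r bb_projM p1.
  by rewrite mul0r.
by move=> _ /memv_imgP[a _ ->]; rewrite -!bb_projM mul1r mulr1.
Qed.

Definition bb_quot : {aspace A} := ASpace bb_quot_aspace.
Local Notation B := (subvs_of bb_quot).

Definition bb_pi_fun a : B := vsproj bb_quot (bb_proj a).

Lemma bb_pi_val a : vsval (bb_pi_fun a) = bb_proj a.
Proof. by rewrite vsprojK // memv_img ?memvf. Qed.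

Fact bb_pi_lin : linear bb_pi_fun.
Proof. by move=> r a b; apply: val_inj; rewrite /= !bb_pi_val linearP. Qed.

Definition bb_pi_hom : 'Hom(A, B) := linfun (mk_linear bb_pi_lin).

Lemma bb_pi_homE a : vsval (bb_pi_hom a) = bb_proj a.
Proof. by rewrite lfunE bb_pi_val. Qed.

Fact bb_pi_ahom : ahom_in {:A} bb_pi_hom.
Proof.
have piM a b : bb_pi_hom (a * b) = bb_pi_hom a * bb_pi_hom b.
  by apply: val_inj; rewrite /= !bb_pi_homE bb_projM.
have pi_surj (b : B) : exists a, bb_pi_hom a = b.
  have /memv_imgP[a _ bE] := subvsP b.
  by exists a; apply: val_inj; rewrite /= bb_pi_homE.
apply/ahom_inP; split=> [a b _ _|]; first exact: piM.
have [a a1] := pi_surj 1.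
by rewrite -[LHS]mulr1 -a1 -piM mul1r.
Qed.

Definition bb_pi : 'AHom(A, B) := AHom bb_pi_ahom.

Lemma bb_pi_eq0 a : (bb_pi a == 0) = (a \in bb_ideal).
Proof.
rewrite memv_ker -(inj_eq val_inj) /=.
by have -> : vsval (bb_pi a) = bb_proj a by apply: bb_pi_homE.
Qed.

Lemma bb_pi_surj (b : B) : exists a, bb_pi a = b.
Proof.
have /memv_imgP[a _ bE] := subvsP b.
by exists a; apply: val_inj; rewrite /= bE; apply: bb_pi_homE.
Qed.

Lemma bb_quotient : quotient_map bb_ideal bb_pi.
Proof.
split; first by apply/vspaceP => a; rewrite memv_ker bb_pi_eq0.
apply/eqP; rewrite eqEsubv subvf /=; apply/subvP => b _.
by have [a <-] := bb_pi_surj b; rewrite memv_img ?memvf.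
Qed.

(** If the P i j coefficient of a is y <> 0 then P j i a satisfies z z = y z, so it
is a nonzero quasi-idempotent; the radical contains none. *)
Lemma bb_quot_rad (b : B) : @jacobson_rad R B b -> b = 0.
Proof.
have [a <-] := bb_pi_surj b => ra; apply/eqP; rewrite bb_pi_eq0.
apply/mem_bb_idealP => i j.
have [Eij|/(bb_cP0 bbA)->//] := boolP (E i j).
have Eji := bb_E_sym bbA Eij; apply/eqP/negPn/negP => y0.
pose y k := cP i k a; pose X := \sum_k y k *: P j k.
have EyE k : ~~ E j k -> y k = 0.
  by move=> nEjk; apply: (bb_cP0 bbA); apply: contra nEjk; apply: (bb_trans bbA).
have projX : bb_proj (P j i * a) = X.
  rewrite (bb_Pmul bbA _ Eji) linear_sum; apply: eq_bigr => k _.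
  rewrite linearD !linearZ /= bb_projJ scaler0 add0r.
  have [Ejk|/EyE] := boolP (E j k); first by rewrite bb_projP.
  by rewrite /y => ->; rewrite !scale0r.
have PX k : E j k -> P j k * X = (k == j)%:R *: X.
  move=> Ejk; rewrite /X mulr_sumr scaler_sumr; apply: eq_bigr => l _.
  have [Ejl|/EyE->] := boolP (E j l); last by rewrite !scale0r mulr0 scaler0.
  by rewrite -scalerAr (bb_PP bbA Ejk Ejl) !scalerA mulrC.
have XX : X * X = y j *: X.
  rewrite {1}/X mulr_suml -(sum_delta j (fun k => y k *: X)); apply: eq_bigr => k _.
  have [Ejk|/EyE->] := boolP (E j k); last by rewrite !scale0r mul0r scaler0.
  by rewrite -scalerAl PX // !scalerA mulrC.
have piX : vsval (bb_pi (P j i * a)) = X by rewrite -projX; apply: bb_pi_homE.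
have z0 : bb_pi (P j i * a) = 0.
  apply: (@jacobson_rad_quasi_idem R B (y j)) => //.
    by rewrite rmorphM; apply: jacobson_rad_mull.
  by apply: val_inj; rewrite /= piX.
have X0 : X = 0 by rewrite -piX z0.
case/eqP: y0; rewrite -/(y j); have <- : cP j j X = y j; last by rewrite X0 (bb_cP00 bbA).
rewrite /X (bb_cPsum bbA) (bigD1 j) //= big1 ?addr0 => [|k kj].
  by rewrite (bb_cPZ bbA) (bb_cPP bbA) ?eqxx ?mulr1 // (bb_trans bbA Eji).
have [Ejk|/EyE->] := boolP (E j k); last by rewrite scale0r (bb_cP00 bbA).
by rewrite (bb_cPZ bbA) (bb_cPP bbA) // [j == k]eq_sym (negPf kj) andbF mulr0.
Qed.

Lemma bb_quot_heredity : heredity_ideal (bb_pi @: {:A})%VS.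
Proof.
have -> : (bb_pi @: {:A})%VS = {:B}%VS by have [] := bb_quotient.
have idl : left_ideal {:B}%VS by apply/left_idealP => a b _; apply: memvf.
have idr : right_ideal {:B}%VS by apply/right_idealP => a b _; apply: memvf.
split; first by rewrite /two_sided_ideal idl idr.
- exact: (prodv_id (aspacef B)).
- by move=> u a v _ /bb_quot_rad-> _; rewrite mulr0 mul0r.
by exists idl; apply: regular_projective.
Qed.

End Quotient.

Theorem bb_quasi_hereditary : quasi_hereditary A.
Proof.
pose F (j : nat) : {vspace A} := match j with 0 => 0%VS | 1 => bb_ideal | _ => {:A}%VS end.
have F01 : F 0 <> F 1.
  move=> F01; have := mem_bb_idealJ o o; rewrite -[bb_ideal]/(F 1) -F01 memv0 => /eqP.
  exact: (bb_J_neq0 bbA).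
have Fid (j : nat) : two_sided_ideal (F j).
  case: j => [|[|j]]; [|exact: bb_ideal_two_sided|].
    apply/andP; split; [apply/left_idealP|apply/right_idealP] => a b;
      by rewrite !memv0 => /eqP->; rewrite ?mulr0 ?mul0r.
  by apply/andP; split; [apply/left_idealP|apply/right_idealP] => a b _; apply: memvf.
have step0 : exists (B : falgType R) (pi : 'AHom(A, B)),
    quotient_map (F 0) pi /\ heredity_ideal (pi @: F 1%N)%VS.
  exists A, (id_ahom A); split; last by rewrite lim1g; apply: bb_ideal_heredity.
  split; last by rewrite lim1g.
  by apply/eqP; rewrite -subv0; apply/subvP => a; rewrite memv_ker id_lfunE memv0.
have [[i0 di0]|nd] := pselect (exists i, dbl i); last first.
  exists 1%N, F; split=> //.
  - by apply: bb_no_dbl => i; apply/negP => di; apply: nd; exists i.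
  - by case=> // _; split=> //; apply: sub0v.
  - by case.
exists 2%N, F; split=> //.
- case=> [|[|//]] _; split=> //; [exact: sub0v | exact: subvf |].
  move=> F12; have : P i0 i0 \in F 1 by rewrite F12 memvf.
  move/mem_bb_idealP/(_ i0 i0)/eqP.
  by rewrite (bb_cPP bbA) ?(bb_refl bbA) // !eqxx oner_eq0.
- case=> [|[|//]] _ //; exists (subvs_of (bb_quot di0)), (bb_pi di0).
  by split; [exact: bb_quotient | exact: bb_quot_heredity].
Qed.

End QuasiHereditary.

(** * Modules generated by an idempotent *)

Section IdempotentModules.
Variables (R : fieldType) (A : falgType R).
Implicit Types (a b t ep : A) (M N : lmodType A).

(** M is a copy of A ep with g in the role of ep.  Stated on M itself, so that the
arbitrary modules in the definition of a basic algebra need no transport. *)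
Definition idem_gen M (ep : A) (g : M) :=
  [/\ ep *: g = g, forall m, exists a, m = a *: g & forall a, a *: g = 0 -> a * ep = 0].

(** Homomorphisms out of A ep are freely determined by an image n with ep n = n. *)
Lemma idem_gen_hom M N ep (g : M) (n : N) : idem_gen ep g -> ep *: n = n ->
  exists f : {linear M -> N}, f g = n.
Proof.
move=> [eg gM g0] en; pose c m := projT1 (cid (gM m)).
have cE m : c m *: g = m by rewrite /c; case: cid.
have act_eq a b : a *: g = b *: g -> a *: n = b *: n.
  move=> ab; have /g0 abe : (a - b) *: g = 0 by rewrite scalerBl ab subrr.
  apply/eqP; rewrite -subr_eq0 -scalerBl -en scalerA abe scale0r //.
have flin : linear (fun m => c m *: n).
  move=> a u v; rewrite scalerA -scalerDl; apply: act_eq.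
  by rewrite cE scalerDl -scalerA !cE.
exists (mk_linear flin) => /=; rewrite -[RHS]scale1r; apply: act_eq.
by rewrite cE scale1r.
Qed.

Lemma idem_gen_transfer M N ep (g : N) : mod_iso M N -> idem_gen ep g ->
  exists h : M, idem_gen ep h.
Proof.
move=> /mod_iso_sym[f [f' fK f'K]] [eg gE g0]; exists (f g); split.
- by rewrite -linearZ eg.
- by move=> m; have [a ma] := gE (f' m); exists a; rewrite -linearZ -ma f'K.
- move=> a; rewrite -linearZ => /(congr1 f'); rewrite fK -(linear0 f) fK; exact: g0.
Qed.

Lemma prin_left_ideal a : left_ideal ({:A} * <[a]>)%VS.
Proof.
apply/left_idealP => b c /memv_cosetP[u _ ->].
by rewrite mulrA; apply/memv_cosetP; exists (b * u); rewrite ?memvf.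
Qed.

Definition prin_mod a : lmodType A := lideal_mod (prin_left_ideal a).

Lemma mem_prin a : a \in ({:A} * <[a]>)%VS.
Proof. by apply/memv_cosetP; exists 1; rewrite ?memvf ?mul1r. Qed.

Section Idempotent.
Variables (ep : A) (epK : ep * ep = ep).

Lemma prin_mod_mul u : u \in ({:A} * <[ep]>)%VS -> u * ep = u.
Proof. by case/memv_cosetP=> c _ ->; rewrite -mulrA epK. Qed.

Lemma prin_mod_gen : idem_gen ep (Subvs (mem_prin ep) : prin_mod ep).
Proof.
split; first exact: val_inj.
  move=> m; exists (vsval (m : subvs_of _)); apply: val_inj.
  by rewrite /= prin_mod_mul // subvsP.
by move=> a /(congr1 val).
Qed.

Lemma prin_mod_projective : projective (prin_mod ep).
Proof.
apply: (@dual_basis_projective _ _ _ _ unit (fun=> id) (fun=> ep)) => //.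
  by move=> _; apply: mem_prin.
by move=> u uL; rewrite big_const card_unit /= addr0 prin_mod_mul.
Qed.

End Idempotent.

(** The projection to a summand of M is right multiplication by an idempotent t of
the corner ep A ep. *)
Lemma idem_gen_indec M ep (g : M) : ep != 0 -> ep * ep = ep ->
  (forall t, ep * t = t -> t * ep = t -> t * t = t -> t = 0 \/ t = ep) ->
  idem_gen ep g -> indecomposable M.
Proof.
move=> ep0 epK prim [eg gE g0]; split.
  move=> M0; have g00 : g = 0 by apply: M0.
  have := g0 1; rewrite g00 scaler0 mul1r => /(_ erefl) e0.
  by rewrite e0 eqxx in ep0.
move=> M1 M2 [f [f' fK f'K]].
have [t0 t0E] := gE (f' ((f g).1, 0)); pose t := ep * t0 * ep.
have tg : t *: g = f' ((f g).1, 0).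
  rewrite /t -!scalerA eg -t0E; apply: (can_inj fK); rewrite linearZ /= !f'K.
  have fe : f g = ep *: f g by rewrite -linearZ eg.
  by rewrite {2}fe; congr pair; apply: scaler0.
have ft : f (t *: g) = ((f g).1, 0) by rewrite tg f'K.
have [|||t00|tep] := prim t.
- by rewrite /t !mulrA epK.
- by rewrite /t -!mulrA epK.
- have : (t * t - t) *: g = 0.
    rewrite scalerBl -scalerA; apply: (can_inj fK); rewrite linearB linear0 linearZ /= ft.
    have ft2 : t *: f g = ((f g).1, 0) by rewrite -linearZ.
    have -> : t *: ((f g).1, 0) = (((f g).1, 0) : M1 * M2); last by rewrite subrr.
    by congr pair; [have := congr1 fst ft2 | apply: scaler0].
  move/g0; rewrite mulrBl -mulrA.
  have -> : t * ep = t by rewrite /t -!mulrA epK.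
  by move/eqP; rewrite subr_eq0 => /eqP.
- left=> m; have [a aE] := gE (f' (m, 0)).
  have : f (a *: g) = (m, 0) by rewrite -aE f'K.
  have : (f g).1 = 0 by have := congr1 fst ft; rewrite t00 scale0r linear0.
  by move=> f1; rewrite linearZ => /(congr1 fst) /=; rewrite f1 scaler0.
right=> m; have [a aE] := gE (f' (0, m)).
have : f (a *: g) = (0, m) by rewrite -aE f'K.
have : (f g).2 = 0 by have := congr1 snd ft; rewrite tep eg.
by move=> f1; rewrite linearZ => /(congr1 snd) /=; rewrite f1 scaler0.
Qed.

(** If A ep and A de are isomorphic, ep factors through de. *)
Lemma idem_gen_common M ep de (g h : M) : idem_gen ep g -> idem_gen de h ->
  exists s t, ep * ep = ep * s * de * t * ep.
Proof.
move=> [eg gE g0] [dh hE h0]; have [s sE] := hE g; have [t tE] := gE h.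
exists s, t; apply/eqP; rewrite -subr_eq0 -mulrBl; apply/eqP/g0.
by rewrite scalerBl -!scalerA -tE dh -sE eg subrr.
Qed.

End IdempotentModules.

(** * Endomorphism algebras *)

Section EndAlgebra.
Variables (R : fieldType) (A B : falgType R) (M : lmodType A) (ep : A) (g : M).
Hypotheses (epK : ep * ep = ep) (gM : idem_gen ep g).

Lemma corner_eq (s t : A) : s * ep = s -> t * ep = t -> s *: g = t *: g -> s = t.
Proof.
have [_ _ g0] := gM; move=> sE tE st; apply/eqP; rewrite -subr_eq0; apply/eqP.
by rewrite -sE -tE -mulrBl; apply: g0; rewrite scalerBl st subrr.
Qed.

(** An endomorphism is right multiplication by the element t of the corner with
f g = t g; right multiplications compose in the opposite order. *)
Lemma End_algebra_corner : is_End_algebra M B -> exists chi : B -> A,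
  [/\ injective chi, forall k b c, chi (k *: b + c) = k *: chi b + chi c,
      chi 1 = ep, forall b c, chi (b * c) = chi c * chi b
    & (forall b, ep * chi b * ep = chi b) /\
      forall t, exists b, chi b = ep * t * ep].
Proof.
have [eg gE g0] := gM; move=> [phi [phiI phi_surj phi_lin phi1 phiM]].
have /choice[chi0 chi0E] : forall b, exists t, phi b g = t *: g by move=> b; apply: gE.
pose chi b := ep * chi0 b * ep.
have chiE b : phi b g = chi b *: g.
  rewrite /chi -!scalerA eg -chi0E -linearZ eg //.
have chi_r b : chi b * ep = chi b by rewrite /chi -!mulrA epK.
have chi_l b : ep * chi b = chi b by rewrite /chi !mulrA epK.
have chi_lr b : ep * chi b * ep = chi b by rewrite chi_l chi_r.
exists chi; split=> //.
- move=> b c bc; apply: phiI => m; have [a ->] := gE m.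
  by rewrite !linearZ /= !chiE bc.
- move=> k b c; apply: corner_eq => //; first by rewrite mulrDl -scalerAl !chi_r.
  rewrite -chiE phi_lin !chiE scalerDl; congr (_ + _).
  by rewrite scalerA -scalerAl mul1r.
- by apply: corner_eq => //; rewrite -chiE phi1 eg.
- move=> b c; apply: corner_eq => //; first by rewrite -mulrA chi_r.
  by rewrite -chiE phiM /= [phi c g]chiE linearZ /= chiE scalerA.
split=> // t; have [|f fg] := idem_gen_hom (n := (ep * t * ep) *: g) gM.
  by rewrite scalerA !mulrA epK.
have [b bE] := phi_surj f; exists b; apply: corner_eq => //.
  by rewrite -!mulrA epK.
by rewrite -chiE bE fg.
Qed.

(** Converse of [End_algebra_corner]. *)
Lemma corner_End_algebra (chi : B -> A) :
  injective chi -> (forall k b c, chi (k *: b + c) = k *: chi b + chi c) ->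
  chi 1 = ep -> (forall b c, chi (b * c) = chi c * chi b) ->
  (forall b, ep * chi b * ep = chi b) -> (forall t, exists b, chi b = ep * t * ep) ->
  is_End_algebra M B.
Proof.
move=> chiI chi_lin chi1 chiM chi_lr chi_surj; have [eg gE g0] := gM.
have chi_r b : chi b * ep = chi b by rewrite -[in LHS]chi_lr -!mulrA epK mulrA chi_lr.
have chi_l b : ep * chi b = chi b by rewrite -[in LHS]chi_lr !mulrA epK chi_lr.
have /choice[phi phiE] : forall b, exists f : {linear M -> M}, f g = chi b *: g.
  by move=> b; apply: (idem_gen_hom gM); rewrite scalerA chi_l.
exists phi; split.
- move=> b c bc; apply: chiI; apply: corner_eq => //.
  by rewrite -!phiE bc.
- move=> f; have [t tE] := gE (f g); have [b bE] := chi_surj t; exists b => m.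
  have [a ->] := gE m; rewrite !linearZ /= phiE bE -!scalerA eg -tE -linearZ eg //.
- move=> k b c m; have [a ->] := gE m; rewrite !linearZ /= !phiE chi_lin.
  by rewrite scalerDl scalerDr !scalerA mulr_algl -scalerAl -scalerAr.
- by move=> m; have [a ->] := gE m; rewrite linearZ /= phiE chi1 eg.
- move=> b c m; have [a ->] := gE m; rewrite !linearZ /= !phiE linearZ /= phiE.
  by rewrite chiM !scalerA mulrA.
Qed.

End EndAlgebra.

Lemma dsum_scaleE (A : nzRingType) n (P : 'I_n -> lmodType A) a (f : dsum P) k :
  (a *: f : dsum P) k = a *: f k.
Proof. exact: ffunE. Qed.

Lemma dsum_idem_gen (R : fieldType) (A : falgType R) n (P : 'I_n -> lmodType A)
    (ep : 'I_n -> A) (g : forall k, P k) :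
  (forall j k, ep j * ep k = (j == k)%:R * ep j) -> (forall k, idem_gen (ep k) (g k)) ->
  idem_gen (\sum_k ep k) ([ffun k => g k] : dsum P).
Proof.
move=> orth gP.
have epg j k : ep j *: g k = (j == k)%:R *: g k.
  have [eg _ _] := gP k; rewrite -{1}eg scalerA orth.
  by case: eqP => [->|_]; rewrite ?mul1r ?mul0r ?scale0r ?scale1r.
split.
- apply/ffunP => k; rewrite dsum_scaleE ffunE scaler_suml (bigD1 k) //=.
  rewrite big1 ?addr0 => [|j /negPf jk]; last by rewrite epg jk scale0r.
  by rewrite epg eqxx scale1r.
- move=> m; have /choice[a aE] : forall k, exists a, m k = a *: g k.
    by move=> k; have [_ gE _] := gP k; apply: gE.
  exists (\sum_k a k * ep k); apply/ffunP => k; rewrite dsum_scaleE ffunE.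
  rewrite scaler_suml (bigD1 k) //= big1 ?addr0 => [|j /negPf jk]; last first.
    by rewrite -scalerA epg jk scale0r scaler0.
  by rewrite -scalerA epg eqxx scale1r.
move=> a /ffunP a0; rewrite mulr_sumr big1 // => k _.
have [_ _ g0] := gP k; apply: g0.
by have := a0 k; rewrite dsum_scaleE !ffunE.
Qed.

(** * The indecomposable projective modules in characteristic two *)

Section CharTwo.
Variables (R : fieldType) (A : falgType R) (I : finType) (o : I) (dbl : pred I).
Variables (E : rel I) (J P : I -> I -> A) (cJ cP : I -> I -> A -> R).
Hypothesis bbA : block_basis o dbl E J P cJ cP.
Hypothesis char2 : 2%:R = 0 :> R.
Variables (r : nat) (idx : 'I_r.+1 -> I).
Hypothesis idx0 : idx ord0 = o.
Hypothesis dbl_idx : forall v, dbl (idx v) = (v != ord0).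
Hypothesis E_idx : forall v w, E (idx v) (idx w) -> v = w.
Hypothesis idx_ex : forall i, dbl i -> exists v, E i (idx v).
Local Notation e := (bb_idem dbl J P).
Local Notation V := 'I_r.+1.
Implicit Types (i j k l : I) (a b : A) (v w : V).

Lemma idx_inj : injective idx.
Proof.
move=> v w vw; have [v0|v0] := eqVneq v ord0.
  by apply/esym/eqP; rewrite v0; apply: contraTT isT => w0;
     have := dbl_idx w; rewrite -vw v0 idx0 (negPf (bb_o bbA)) w0.
by apply: E_idx; rewrite vw (bb_refl bbA) -vw dbl_idx.
Qed.

Lemma dbl_char2 i : (dbl i).+1%:R = (~~ dbl i)%:R :> R.
Proof. by case: (dbl i). Qed.

(** The hypothesis is needed because P i l is a basis element only when E i l. *)
Lemma cJ_comb i l r1 r2 : (r2 != 0 -> E i l) ->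
  cJ i l (r1 *: J i l + r2 *: P i l) = r1 /\ cP i l (r1 *: J i l + r2 *: P i l) = r2.
Proof.
move=> Eil; rewrite (bb_cJlin bbA) (bb_cPlin bbA) (bb_cJJ bbA) (bb_cPJ bbA) !eqxx mulr1 mulr0.
rewrite add0r.
have [->|/Eil{}Eil] := eqVneq r2 0; first by rewrite scale0r (bb_cJ0 bbA) (bb_cP00 bbA) addr0.
by rewrite (bb_cJZ bbA) (bb_cPZ bbA) (bb_cJP bbA) // (bb_cPP bbA) // !eqxx mulr0 mulr1 addr0.
Qed.

Lemma cP_E i j a : cP i j a != 0 -> E i j.
Proof. by apply: contraNT => /(bb_cP0 bbA)->. Qed.

(** The multiplication table read on coordinates.  Products through a two-point
block j carry the factor 2 = 0, whence the factor for J J. *)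
Lemma bb_cM i l a b :
  cJ i l (a * b) =
  \sum_j ((~~ dbl j)%:R * cJ i j a * cJ j l b + cJ i j a * cP j l b + cP i j a * cJ j l b)
  /\ cP i l (a * b) = \sum_j cP i j a * cP j l b.
Proof.
have ab : a * b = \sum_j (a * e j) * (e j * b).
  rewrite -[in LHS](mulr1 a) -(bb_1 bbA) mulr_sumr mulr_suml.
  by apply: eq_bigr => j _; rewrite -[in LHS](bb_idem_id bbA j) !mulrA.
have eab : e i * (a * b) * e l = \sum_j (e i * a * e j) * (e j * b * e l).
  by rewrite ab mulr_sumr mulr_suml; apply: eq_bigr => j _; rewrite !mulrA.
rewrite (bb_peirce bbA) in eab.
pose al j := (~~ dbl j)%:R * cJ i j a * cJ j l b + cJ i j a * cP j l b + cP i j a * cJ j l b.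
pose be j := cP i j a * cP j l b.
have beE : \sum_j be j != 0 -> E i l.
  apply: contraNT => nE; rewrite big1 // => j _; rewrite /be.
  have [->|/cP_E Eij] := eqVneq (cP i j a) 0; first by rewrite mul0r.
  have [->|/cP_E Ejl] := eqVneq (cP j l b) 0; first by rewrite mulr0.
  by case/negP: nE; apply: (bb_trans bbA) Eij Ejl.
have {}eab : cJ i l (a * b) *: J i l + cP i l (a * b) *: P i l =
    (\sum_j al j) *: J i l + (\sum_j be j) *: P i l.
  rewrite eab !scaler_suml -big_split; apply: eq_bigr => j _ /=.
  rewrite !(bb_peirce bbA) mulrDl !mulrDr.
  have -> : cJ i j a *: J i j * (cJ j l b *: J j l) =
      ((~~ dbl j)%:R * cJ i j a * cJ j l b) *: J i l.
    by rewrite -scalerAl -scalerAr (bb_J1 bbA) dbl_char2 !scalerA mulrC !mulrA.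
  have -> : cJ i j a *: J i j * (cP j l b *: P j l) = (cJ i j a * cP j l b) *: J i l.
    by rewrite -scalerAl (bb_JcP_mul bbA) eqxx mul1r scalerA.
  have -> : cP i j a *: P i j * (cJ j l b *: J j l) = (cP i j a * cJ j l b) *: J i l.
    by rewrite -scalerAr (bb_cPJ_mul bbA) eqxx mul1r scalerA mulrC.
  have -> : cP i j a *: P i j * (cP j l b *: P j l) = be j *: P i l.
    rewrite /be -scalerAl -scalerAr scalerA.
    have [->|/cP_E Eij] := eqVneq (cP i j a) 0; first by rewrite mul0r !scale0r.
    have [->|/cP_E Ejl] := eqVneq (cP j l b) 0; first by rewrite mulr0 !scale0r.
    by rewrite (bb_PP bbA) // eqxx scale1r.
  by rewrite /al !scalerDl !addrA.
have [h1 h2] := cJ_comb (cJ i l (a * b)) (@cP_E i l (a * b)).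
have [h3 h4] := cJ_comb (\sum_j al j) beE.
by split; [rewrite -h1 eab h3 | rewrite -h2 eab h4].
Qed.

Lemma addrr_char2 (u : R) : u + u = 0.
Proof. by rewrite -mulr2n -mulr_natr char2 mulr0. Qed.

(** The cross terms add up to 2 m k and J J = 2 J, so both vanish. *)
Lemma corner_sq i (m k : R) : dbl i ->
  (m *: J i i + k *: P i i) * (m *: J i i + k *: P i i) = (k * k) *: P i i.
Proof.
move=> di; have Eii : E i i by rewrite (bb_refl bbA).
rewrite mulrDl !mulrDr -!scalerAl -!scalerAr (bb_J1 bbA) dbl_char2 di scale0r !scaler0 add0r.
rewrite (bb_JP bbA _ _ Eii) (bb_PJ bbA _ _ Eii) (bb_PP bbA Eii Eii) eqxx !scale1r.
by rewrite !scalerA addrA -scalerDl [k * m]mulrC addrr_char2 scale0r add0r.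
Qed.

Lemma bb_e_neq0 i : e i != 0.
Proof.
apply/eqP; rewrite /bb_idem; case: ifP => di; last exact: (bb_J_neq0 bbA).
by apply: (bb_P_neq0 bbA); rewrite (bb_refl bbA).
Qed.

(** An idempotent k J_oo has k k = k; an idempotent m J + k P squares to k k P, so m
vanishes as well. *)
Lemma corner_primitive v t : e (idx v) * t = t -> t * e (idx v) = t -> t * t = t ->
  t = 0 \/ t = e (idx v).
Proof.
move=> et te tt; set i := idx v in et te *.
have tE : t = cJ i i t *: J i i + cP i i t *: P i i by rewrite -(bb_peirce bbA) et te.
have idem01 (k : R) : k = k * k -> k = 0 \/ k = 1.
  move=> kk; have /eqP : k * (1 - k) = 0 by rewrite mulrBr mulr1 -kk subrr.
  by rewrite mulf_eq0 subr_eq0 => /orP[]/eqP ->; [left|right].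
rewrite /bb_idem; case: ifP => di.
  have Eii : E i i by rewrite (bb_refl bbA).
  have {}tt : t = (cP i i t * cP i i t) *: P i i by rewrite -{1}tt {1 2}tE corner_sq.
  have := congr1 (cP i i) tt; rewrite (bb_cPZ bbA) (bb_cPP bbA) // !eqxx mulr1.
  by move=> /idem01[] k; move: tt; rewrite k ?mulr0 ?mulr1 ?scale0r ?scale1r; [left|right].
have P0 : cP i i t = 0 by apply: (bb_cP0 bbA); rewrite (bb_refl bbA) di.
have {P0}tE : t = cJ i i t *: J i i by rewrite {1}tE P0 scale0r addr0.
have {}tt : t = (cJ i i t * cJ i i t) *: J i i.
  rewrite -{1}tt {1 2}tE -scalerAl -scalerAr (bb_J1 bbA) dbl_char2 di scale1r scalerA //.
have := congr1 (cJ i i) tt; rewrite (bb_cJZ bbA) (bb_cJJ bbA) !eqxx mulr1.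
by move=> /idem01[] k; move: tt; rewrite k ?mulr0 ?mulr1 ?scale0r ?scale1r; [left|right].
Qed.

Local Notation ev := (fun v => e (idx v)).

Lemma ev_idem v : ev v * ev v = ev v. Proof. exact: (bb_idem_id bbA). Qed.

Definition std_mod v : lmodType A := prin_mod (ev v).

Lemma std_gen v : exists g : std_mod v, idem_gen (ev v) g.
Proof. by exists (Subvs (mem_prin (ev v))); apply/prin_mod_gen/ev_idem. Qed.

Lemma std_projective v : projective (std_mod v).
Proof. exact/prin_mod_projective/ev_idem. Qed.

Lemma std_indecomposable v : indecomposable (std_mod v).
Proof.
have [g gP] := std_gen v.
apply: idem_gen_indec gP; [exact: bb_e_neq0 | exact: ev_idem | exact: corner_primitive].
Qed.

(** An isomorphism would factor the idempotent e i through J i j and J j i, as there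
is no P between distinct classes; but J i j J j i is 2 J i i = 0 or a multiple of
J i i, not e i. *)
Lemma std_iso v w : mod_iso (std_mod v) (std_mod w) -> v = w.
Proof.
have [g gP] := std_gen v; have [h0 hP0] := std_gen w.
move=> /idem_gen_transfer/(_ hP0)[h hP].
have [s [t]] := idem_gen_common gP hP.
rewrite ev_idem; set i := idx v; set j := idx w => est.
apply/eqP/negPn/negP => vw.
have nE (k l : V) : k != l -> ~~ E (idx k) (idx l) by apply: contra => /E_idx->.
have {}est : e i = (cJ i j s * cJ j i t) *: (J i j * J j i).
  have -> : e i = (e i * s * e j) * (e j * t * e i).
    by rewrite {1}est !mulrA -(mulrA _ (e j) (e j)) (bb_idem_id bbA).
  rewrite !(bb_peirce bbA).
  rewrite (bb_cP0 bbA) ?nE // [cP j i t](bb_cP0 bbA) ?nE 1?eq_sym // !scale0r !addr0.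
  by rewrite -scalerAl -scalerAr scalerA.
move: est; rewrite (bb_J1 bbA) dbl_char2 scalerA; have [v0|v0] := eqVneq v ord0.
  have w0 : w != ord0 by rewrite -v0 eq_sym.
  by rewrite dbl_idx w0 mulr0 scale0r => /eqP; rewrite (negPf (bb_e_neq0 _)).
have Eii : E i i by rewrite (bb_refl bbA) dbl_idx.
rewrite /bb_idem dbl_idx v0 => /(congr1 (cP i i)) /eqP.
by rewrite (bb_cPP bbA) // (bb_cPZ bbA) (bb_cPJ bbA) !eqxx mulr0 oner_eq0.
Qed.

(** The span of the J i j for which i or j is a two-point block. *)
Definition in_radical a := (forall i j, cP i j a = 0) /\
  (forall i j, ~~ dbl i -> ~~ dbl j -> cJ i j a = 0).

Lemma in_radical_mulr a b : in_radical a -> in_radical (a * b).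
Proof.
move=> [P0 J0]; split=> [i j|i l di dl].
  by rewrite (bb_cM i j a b).2 big1 // => k _; rewrite P0 mul0r.
rewrite (bb_cM i l a b).1 big1 // => j _; rewrite P0 mul0r addr0.
have [dj|dj] := boolP (dbl j); last by rewrite J0 // !mulr0 !mul0r addr0.
by rewrite !mul0r add0r (bb_cP0 bbA) ?mulr0 //; apply: contra dl => /(bb_dbl bbA)/andP[].
Qed.

Lemma in_radical_sum (F : I -> A) : (forall k, in_radical (F k)) -> in_radical (\sum_k F k).
Proof.
move=> FN; split=> [i j|i j di dj].
  by rewrite (bb_cPsum bbA) big1 // => k _; case: (FN k).
by rewrite (bb_cJsum bbA) big1 // => k _; have [_ ->] := FN k.
Qed.

(** In a product of two such elements only one-point blocks survive in the middle,
so the two outer blocks are two-point blocks; a third factor kills it. *)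
Lemma radical_cube0 a b c : in_radical a -> in_radical b -> in_radical c -> a * b * c = 0.
Proof.
move=> [aP aJ] [bP bJ] [cP0 cJ0].
have abJ i l : cJ i l (a * b) = \sum_(j | ~~ dbl j) cJ i j a * cJ j l b.
  rewrite (bb_cM i l a b).1 [RHS]big_mkcond; apply: eq_bigr => j _.
  by rewrite bP aP mulr0 mul0r !addr0; case: (dbl j); rewrite ?mul0r ?mul1r.
have abP i l : cP i l (a * b) = 0.
  by rewrite (bb_cM i l a b).2 big1 // => j _; rewrite aP mul0r.
rewrite [a * b * c](bb_decomp bbA) big1 // => i _; rewrite big1 // => l _.
have [-> ->] := bb_cM i l (a * b) c.
rewrite !big1 ?scale0r ?addr0 // => j _; first by rewrite abP mul0r.
rewrite cP0 abP mulr0 mul0r !addr0.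
have [dj|dj] := boolP (dbl j); first by rewrite !mul0r.
rewrite abJ big1 ?mulr0 ?mul0r // => k dk.
by rewrite bJ // mulr0.
Qed.

(** Outside the radical some coefficient at a one-point block, resp. at a P, is
nonzero; multiplying by the opposite basis element leads into the local corner,
where the element becomes invertible. *)
Lemma generator_outside_radical v x : x * ev v = x -> ~ in_radical x -> exists y, y * x = ev v.
Proof.
set i0 := idx v => xe nN.
have cx0 i j : j != i0 -> cJ i j x = 0 /\ cP i j x = 0.
  move=> ji; have : e i * x * e j = 0.
    by rewrite -xe -!mulrA (bb_ee bbA) eq_sym (negPf ji) scale0r !mulr0.
  rewrite (bb_peirce bbA) => x0; have [h1 h2] := cJ_comb (cJ i j x) (@cP_E i j x).
  by split; [rewrite -h1 x0 (bb_cJ0 bbA) | rewrite -h2 x0 (bb_cP00 bbA)].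
have [di|di] := boolP (dbl i0).
  have [i Pi] : exists i, cP i i0 x != 0.
    apply: contrapT => none; apply: nN; split=> [i j|i j di' dj].
      have [->|/(cx0 i j)[]//] := eqVneq j i0.
      by apply/eqP/negPn/negP => Pi; apply: none; exists i.
    by have [] := cx0 i j; first by apply: contraNneq dj => ->.
  have Eii := bb_E_sym bbA (cP_E Pi).
  have E00 : E i0 i0 by rewrite (bb_refl bbA).
  (* z is the image of x in the corner, and z z = k k P i0 i0 by [corner_sq] *)
  pose z := P i0 i * x; pose m := cJ i0 i0 z; pose k := cP i0 i0 z.
  have zE : z = m *: J i0 i0 + k *: P i0 i0.
    rewrite -(bb_peirce bbA) /z mulrA (bb_eP bbA _ Eii) eqxx scale1r -mulrA.
    by rewrite xe.
  have kE : k = cP i i0 x.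
    rewrite /k /z (bb_Pmul bbA _ Eii) (bb_cPsum bbA) (bigD1 i0) //= big1 ?addr0 => [|j ji].
      by rewrite (bb_cPlin bbA) (bb_cPJ bbA) mulr0 add0r (bb_cPZ bbA) (bb_cPP bbA) // !eqxx mulr1.
    by have [-> ->] := cx0 i _ ji; rewrite !scale0r addr0 (bb_cP00 bbA).
  exists ((k * k)^-1 *: (z * P i0 i)).
  rewrite -scalerAl -mulrA -/z zE corner_sq // scalerA mulVf ?scale1r.
    by rewrite /bb_idem di.
  by rewrite mulf_neq0 // kE.
have [i [dii Ji]] : exists i, ~~ dbl i /\ cJ i i0 x != 0.
  apply: contrapT => none; apply: nN; split=> [i j|i j di' dj].
    have [->|/(cx0 i j)[]//] := eqVneq j i0.
    by apply: (bb_cP0 bbA); apply: contra di => /(bb_dbl bbA)/andP[].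
  have [->|/(cx0 i j)[]//] := eqVneq j i0.
  by apply/eqP/negPn/negP => Pi; apply: none; exists i.
exists ((cJ i i0 x)^-1 *: J i0 i).
rewrite -scalerAl (bb_Jmul bbA) (bigD1 i0) //= big1 ?addr0 => [|j ji].
  rewrite dbl_char2 dii mul1r [cP _ _ _](bb_cP0 bbA) ?addr0.
    by rewrite scalerA mulVf // scale1r /bb_idem (negPf di).
  by apply: contra di => /(bb_dbl bbA)/andP[].
by have [-> ->] := cx0 i _ ji; rewrite mulr0 addr0 scale0r.
Qed.

(** Every block idempotent factors through a standard one, so all coefficients can
be tested on the standard modules. *)
Lemma std_cover i : exists v t t', [/\ t * ev v = t & e i = t * t'].
Proof.
have [di|di] := boolP (dbl i).
  have [v Eiv] := idx_ex di; exists v, (P i (idx v)), (P (idx v) i); split.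
    by rewrite (bb_Pe bbA _ Eiv) eqxx scale1r.
  by rewrite (bb_PP bbA Eiv (bb_E_sym bbA Eiv)) eqxx scale1r /bb_idem di.
exists ord0, (J i o), (J o i); split.
  by rewrite idx0 (bb_Ee bbA) eqxx scale1r.
by rewrite (bb_Joo bbA) /bb_idem (negPf di).
Qed.

(** Embed Q in a free module as a summand.  If all coordinate maps into the standard
modules missed their generators, all coordinates would lie in the nilpotent
radical N, and Q = N Q would vanish.  So some coordinate map is onto, hence an
isomorphism as Q is indecomposable. *)
Lemma std_complete (Q : lmodType A) : projective Q -> indecomposable Q ->
  exists v, mod_iso Q (std_mod v).
Proof.
move=> prQ indQ; have [c c_surj cE] := free_cover Q.
have [s sK] := projective_lift prQ c_surj.
have [allN|] := pselect (forall (q k : Q) v t, t * ev v = t ->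
    in_radical (monalg.mcoeff k (s q) * t)); last first.
  move=> /existsNP[q /existsNP[k /existsNP[v /existsNP[t /not_implyP[tv nN]]]]].
  exists v; have [g gP] := std_gen v; have [eg gE g0] := gP.
  pose th0 (u : Q) : std_mod v := (monalg.mcoeff k (s u) * t) *: g.
  have th_lin : linear th0.
    move=> a u u'; rewrite /th0 linearP monalg.mcoeffD monalg.mcoeffZ.
    by rewrite mulrDl scalerDl -mulrA scalerA.
  pose th := mk_linear th_lin.
  apply: (@indecomposable_epi _ _ _ th) => //; first exact: std_projective.
    by have [] := std_indecomposable v.
  move=> u; have [a ->] := gE u.
  have [|y yE] := @generator_outside_radical v (monalg.mcoeff k (s q) * t) _ nN.
    by rewrite -mulrA tv.
  exists (a *: (y *: q)); rewrite !linearZ /= /th0; congr (_ *: _); rewrite scalerA yE; exact: eg.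
have coefN : forall q k : Q, in_radical (monalg.mcoeff k (s q)).
  move=> u k; rewrite -[monalg.mcoeff k (s u)]mulr1 -(bb_1 bbA) mulr_sumr.
  apply: in_radical_sum => i.
  have [v [t [t' [tv ->]]]] := std_cover i.
  by rewrite mulrA; apply: in_radical_mulr; apply: allN tv.
have qE : forall u : Q,
    u = \sum_(k <- finmap.enum_fset (monalg.msupp (s u))) monalg.mcoeff k (s u) *: k.
  by move=> u; rewrite -{1}(sK u) cE.
have [Q0 _] := indQ; case: Q0 => u.
(* as N ^ 3 = 0, elements of N kill N Q = Q one factor at a time *)
have z2 x y (q' : Q) : in_radical x -> in_radical y -> x *: (y *: q') = 0.
  move=> xN yN; rewrite scalerA [q']qE scaler_sumr big1 // => k _.
  by rewrite scalerA radical_cube0 ?scale0r.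
have z1 x (q' : Q) : in_radical x -> x *: q' = 0.
  by move=> xN; rewrite [q']qE scaler_sumr big1 // => k _; apply: z2.
by rewrite [u]qE big1 // => k _; apply: z1.
Qed.

Lemma std_complete_indec : complete_indec_projectives std_mod.
Proof.
split; last exact: std_complete.
  by move=> v; split; [apply: std_projective | apply: std_indecomposable].
exact: std_iso.
Qed.

(** The corner at this idempotent is a basic algebra of A, up to opposites. *)
Definition basic_idem : A := \sum_v ev v.

Lemma ev_orth v w : ev v * ev w = (v == w)%:R * ev v.
Proof. by rewrite (bb_ee bbA) (inj_eq idx_inj) scaler_nat mulr_natl. Qed.

Lemma basic_idem_l v a : basic_idem * (ev v * a) = ev v * a.
Proof.
rewrite /basic_idem mulr_suml (bigD1 v) //= mulrA ev_orth eqxx mul1r.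
rewrite big1 ?addr0 // => w /negPf wv.
by rewrite mulrA ev_orth wv mul0r mul0r.
Qed.

Lemma basic_idem_r v a : (a * ev v) * basic_idem = a * ev v.
Proof.
rewrite /basic_idem mulr_sumr (bigD1 v) //= -mulrA ev_orth eqxx mul1r.
rewrite big1 ?addr0 // => w /negPf wv.
by rewrite -mulrA ev_orth eq_sym wv mul0r mulr0.
Qed.

Lemma basic_idemK : basic_idem * basic_idem = basic_idem.
Proof.
rewrite {2 3}/basic_idem mulr_sumr; apply: eq_bigr => v _.
by rewrite -[ev v]mulr1 basic_idem_l.
Qed.

Lemma basic_idem_J v w : basic_idem * J (idx v) (idx w) * basic_idem = J (idx v) (idx w).
Proof.
have -> : J (idx v) (idx w) = ev v * (J (idx v) (idx w) * ev w).
  by rewrite (bb_Ee bbA) eqxx scale1r (bb_eE bbA) eqxx scale1r.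
by rewrite basic_idem_l mulrA basic_idem_r.
Qed.

Lemma basic_idem_P v : v != ord0 ->
  basic_idem * P (idx v) (idx v) * basic_idem = P (idx v) (idx v).
Proof.
move=> v0; have PE : ev v = P (idx v) (idx v) by rewrite /bb_idem dbl_idx v0.
rewrite -PE -{1}[ev v]mulr1 basic_idem_l mulr1 -[ev v]mul1r basic_idem_r mul1r //.
Qed.

Lemma basic_idem_gen n (Q : 'I_n -> lmodType A) : complete_indec_projectives Q ->
  exists G : dsum Q, idem_gen basic_idem G.
Proof.
move=> [Qpi Qiso Qcomp].
have /choice[tau tauP] : forall k : 'I_n, exists v, mod_iso (Q k) (std_mod v).
  by move=> k; have [prk indk] := Qpi k; apply: std_complete.
have tau_inj : injective tau.
  move=> j k jk; apply: Qiso; apply: mod_iso_trans (tauP j) _.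
  by rewrite jk; apply: mod_iso_sym.
have tau_surj v : exists k : 'I_n, tau k = v.
  have [k vk] := Qcomp _ (@std_projective v) (@std_indecomposable v).
  by exists k; apply/esym/std_iso; apply: mod_iso_trans vk (tauP k).
have gen (k : 'I_n) : exists g : Q k, idem_gen (ev (tau k)) g.
  by have [g gP] := std_gen (tau k); apply: idem_gen_transfer (tauP k) gP.
pose g (k : 'I_n) := projT1 (cid (gen k)).
have gP (k : 'I_n) : idem_gen (ev (tau k)) (g k) by rewrite /g; case: cid.
have orth (j k : 'I_n) : ev (tau j) * ev (tau k) = (j == k)%:R * ev (tau j).
  by rewrite ev_orth (inj_eq tau_inj).
have -> : basic_idem = \sum_k ev (tau k).
  have [tau' tau'K tauK] : bijective tau.
    exists (fun v => projT1 (cid (tau_surj v))) => [k|v]; last by case: cid.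
    by case: cid => j /= /tau_inj.
  by rewrite /basic_idem (reindex tau) //; exists tau'; move=> ? _.
exact: ex_intro _ _ (dsum_idem_gen orth gP).
Qed.

Section BasicAlgebra.
Variable B : falgType R.

(** The basic algebra is opposite to the corner, so the indices of the transported
basis are exchanged. *)
Lemma basic_block_basis : is_basic_algebra A B ->
  exists (J' P' : V -> V -> B) (cJ' cP' : V -> V -> B -> R),
    block_basis ord0 (fun v => v != ord0) (fun v w => (v != ord0) && (v == w)) J' P' cJ' cP'.
Proof.
move=> [n [Q [Qc QB]]]; have [G GP] := basic_idem_gen Qc.
have [chi [chiI chi_lin chi1 chiM [chi_lr chi_surj]]] := End_algebra_corner basic_idemK GP QB.
have /choice[psi psiE] := chi_surj.
pose J' v w := psi (J (idx w) (idx v)).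
pose P' v w := psi (P (idx w) (idx v)).
pose cJ' v w (b : B) := cJ (idx w) (idx v) (chi b).
pose cP' v w (b : B) := cP (idx w) (idx v) (chi b).
have JE v w : chi (J' v w) = J (idx w) (idx v) by rewrite psiE basic_idem_J.
have PE v : v != ord0 -> chi (P' v v) = P (idx v) (idx v).
  by move=> v0; rewrite psiE basic_idem_P.
have chi0 : chi 0 = 0.
  by have := chi_lin (-1) 0 0; rewrite scaler0 addr0 scaleN1r addNr.
have chiZ (k : R) (b : B) : chi (k *: b) = k *: chi b.
  by rewrite -[k *: b]addr0 chi_lin chi0 addr0.
have chiD (b c : B) : chi (b + c) = chi b + chi c by rewrite -[b]scale1r chi_lin !scale1r.
have eE v : chi (bb_idem (fun v => v != ord0) J' P' v) = ev v.
  rewrite /bb_idem dbl_idx; case: ifP => v0; first by rewrite PE.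
  by rewrite JE.
have Evv v : v != ord0 -> E (idx v) (idx v) by rewrite (bb_refl bbA) dbl_idx.
exists J', P', cJ', cP'; split.
- by rewrite eqxx.
- by move=> v; rewrite eqxx andbT.
- by move=> v w /=; rewrite [w == v]eq_sym; case: (v =P w) => [->|] //; rewrite !andbF.
- by move=> v u w /= /andP[u0 /eqP->].
- move=> v w v' w'; apply: chiI; rewrite chiM chiZ !JE (bb_JJ bbA) (inj_eq idx_inj).
  by rewrite dbl_idx [v' == w]eq_sym; case: (w =P v') => [->|].
- move=> v w v' w' /andP[v0 /eqP <-]; apply: chiI; rewrite chiM chiZ !JE PE //.
  by rewrite (bb_PJ bbA _ _ (Evv _ v0)) (inj_eq idx_inj) eq_sym.
- move=> v w v' w' /andP[v0 /eqP <-]; apply: chiI; rewrite chiM chiZ !JE PE //.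
  by rewrite (bb_JP bbA _ _ (Evv _ v0)) (inj_eq idx_inj) eq_sym.
- move=> v w v' w' /andP[v0 /eqP <-] /andP[v'0 /eqP <-]; apply: chiI.
  rewrite chiM chiZ !PE // (bb_PP bbA (Evv _ v'0) (Evv _ v0)) (inj_eq idx_inj) eq_sym.
  by case: eqP => [->|]; rewrite ?scale0r // PE.
- apply: chiI; rewrite chi1 (big_morph chi chiD chi0).
  by apply: eq_bigr => v _; rewrite eE.
- move=> v w b; apply: chiI; rewrite !chiM !eE chi_lin chiZ JE mulrA (bb_peirce bbA).
  rewrite /cP'; have [->|/cP_E/E_idx wv] := eqVneq (cP (idx w) (idx v) (chi b)) 0.
    by rewrite !scale0r.
  have [v0|v0] := eqVneq v ord0; last by rewrite wv PE.
  by rewrite (bb_cP0 bbA) ?scale0r // wv (bb_refl bbA) dbl_idx v0 eqxx.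
- move=> v w b nE; apply: (bb_cP0 bbA); apply: contra nE => Ewv.
  rewrite (E_idx Ewv) eqxx andbT -dbl_idx.
  by have /andP[] := bb_dbl bbA Ewv.
- by move=> v w k b c; rewrite /cJ' chi_lin (bb_cJlin bbA).
- by move=> v w k b c; rewrite /cP' chi_lin (bb_cPlin bbA).
- by move=> v w v' w'; rewrite /cJ' JE (bb_cJJ bbA) !(inj_eq idx_inj) andbC.
- by move=> v w v' w' /andP[v0 /eqP <-]; rewrite /cJ' PE // (bb_cJP bbA _ _ (Evv _ v0)).
- by move=> v w v' w'; rewrite /cP' JE (bb_cPJ bbA).
- move=> v w v' w' /andP[v0 /eqP <-].
  by rewrite /cP' PE // (bb_cPP bbA _ _ (Evv _ v0)) !(inj_eq idx_inj) andbC.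
Qed.

End BasicAlgebra.

Fact corner_lin : linear (fun a : A => basic_idem * a * basic_idem).
Proof. by move=> k a b; rewrite mulrDr mulrDl -scalerAr -scalerAl. Qed.

Definition corner_space : {vspace A} := limg (linfun (mk_linear corner_lin)).

Lemma corner_spaceP a : reflect (basic_idem * a * basic_idem = a) (a \in corner_space).
Proof.
apply: (iffP memv_imgP) => [[b _ ->]|aE]; last by exists a; rewrite ?memvf // lfunE.
by rewrite lfunE /= !mulrA basic_idemK -!mulrA basic_idemK.
Qed.

Lemma basic_idem_corner : basic_idem * basic_idem * basic_idem = basic_idem.
Proof. by rewrite !basic_idemK. Qed.

Fact corner_aspace : is_aspace corner_space.
Proof.
apply/andP; split; last first.
  apply/prodvP => a b /corner_spaceP <- /corner_spaceP <-; apply/corner_spaceP.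
  by rewrite !mulrA basic_idemK -!mulrA basic_idemK.
apply/has_algidP; exists basic_idem; split; first exact/corner_spaceP/basic_idem_corner.
  apply/eqP => ep0; have := basic_idem_l ord0 1.
  by rewrite ep0 mul0r mulr1 => /esym/eqP; rewrite (negPf (bb_e_neq0 _)).
by move=> a /corner_spaceP <-; rewrite !mulrA basic_idemK -!mulrA basic_idemK.
Qed.

Definition corner_alg : falgType R := subvs_of (ASpace corner_aspace).

Local Notation flip := (bb_flip bbA).

Lemma flip_basic_idem : flip basic_idem = basic_idem.
Proof.
rewrite /basic_idem linear_sum; apply: eq_bigr => v _; rewrite /bb_idem.
case: ifP => dv; last exact: (bb_flipJ bbA).
by apply: (bb_flipP bbA); rewrite (bb_refl bbA).
Qed.

(** The flip identifies the corner with its opposite, hence with an endomorphism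
algebra. *)
Lemma basic_algebra_ex : is_basic_algebra A corner_alg.
Proof.
exists r.+1, std_mod; split; first exact: std_complete_indec.
have [G GP] := basic_idem_gen std_complete_indec.
pose chi (b : corner_alg) := flip (vsval (b : subvs_of (ASpace corner_aspace))).
have flipK := bb_flipK bbA; have flipM := bb_flipM bbA.
apply: (corner_End_algebra basic_idemK GP (chi := chi)).
- by move=> b c /(can_inj flipK)/val_inj.
- by move=> k b c; rewrite /chi !linearP.
- rewrite /chi -flip_basic_idem; congr (flip _) => /=.
  have epU : basic_idem \in corner_space by apply/corner_spaceP/basic_idem_corner.
  have /corner_spaceP idE := memv_algid (ASpace corner_aspace).
  have aE := algidl (A := ASpace corner_aspace) epU.
  by rewrite -[LHS]idE -mulrA aE basic_idemK.
- by move=> b c; apply: flipM.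
- move=> b; have /corner_spaceP bE := subvsP (b : subvs_of (ASpace corner_aspace)).
  by rewrite /chi -{2}bE !flipM flip_basic_idem mulrA.
move=> t; have tU : basic_idem * flip t * basic_idem \in corner_space.
  by apply/corner_spaceP; rewrite !mulrA basic_idemK -!mulrA basic_idemK.
exists (Subvs (tU : _ \in ASpace corner_aspace)).
by rewrite /chi !flipM flip_basic_idem flipK mulrA.
Qed.

End CharTwo.

(** The vertices of the star: o is the centre and the leaves are the classes of
two-point blocks. *)
Lemma class_reps (R : fieldType) (A : falgType R) (I : finType) (o : I) (dbl : pred I)
    (E : rel I) (J P : I -> I -> A) (cJ cP : I -> I -> A -> R) :
  block_basis o dbl E J P cJ cP ->
  exists (r : nat) (idx : 'I_r.+1 -> I),
    [/\ idx ord0 = o, forall v, dbl (idx v) = (v != ord0),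
        forall v w, E (idx v) (idx w) -> v = w
      & forall i, dbl i -> exists v, E i (idx v)].
Proof.
move=> bbA; pose D := [set i | dbl i && (bb_rep E i == i)].
pose idx (v : 'I_#|D|.+1) := if unlift ord0 v is Some k then enum_val k else o.
exists #|D|, idx; split.
- by rewrite /idx unlift_none.
- move=> v; rewrite /idx; case: unliftP => [k ->|->]; last by rewrite eqxx (negPf (bb_o bbA)).
  by have := enum_valP k; rewrite inE => /andP[-> _].
- move=> v w; rewrite /idx; case: unliftP => [k ->|->]; last first.
    by move/(bb_dbl bbA)/andP=> []; rewrite (negPf (bb_o bbA)).
  case: unliftP => [l ->|->]; last by move/(bb_dbl bbA)/andP=> []; rewrite (negPf (bb_o bbA)).
  have := enum_valP k; have := enum_valP l; rewrite !inE => /andP[_ /eqP rl] /andP[_ /eqP rk].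
  by move/(bb_rep_eq bbA); rewrite rl rk => /enum_val_inj->.
- move=> i di; have Ei := bb_repE bbA di.
  have rD : bb_rep E i \in D.
    have /andP[_ dr] := bb_dbl bbA Ei.
    by rewrite inE dr -(bb_rep_eq bbA Ei) eqxx.
  exists (lift ord0 (enum_rank_in rD (bb_rep E i))).
  by rewrite /idx liftK enum_rankK_in.
Qed.

(** * Global dimension of the star algebra *)

Section Restriction.
Variables (R : fieldType) (A : falgType R).

(** Complements of submodules are mere subspaces, so the underlying vector space is
needed as a module over the field. *)
Definition restr_mod (M : lmodType A) : Type := M.

Section Instances.
Variable M : lmodType A.
HB.instance Definition _ := GRing.Zmodule.on (restr_mod M).

Definition restr_scale (r : R) (m : restr_mod M) : restr_mod M := r%:A *: (m : M).

Fact restr_scaleA r s m : restr_scale r (restr_scale s m) = restr_scale (r * s) m.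
Proof. by rewrite /restr_scale scalerA -scalerAl mul1r scalerA. Qed.
Fact restr_scale1 : left_id 1 restr_scale.
Proof. by move=> m; rewrite /restr_scale scale1r (@scale1r A M). Qed.
Fact restr_scaleDr : right_distributive restr_scale +%R.
Proof. by move=> r m n; rewrite /restr_scale (@scalerDr A M). Qed.
Fact restr_scaleDl m : {morph restr_scale^~ m : r s / r + s}.
Proof. by move=> r s; rewrite /restr_scale scalerDl (@scalerDl A M). Qed.

HB.instance Definition _ := GRing.Zmodule_isLmodule.Build R (restr_mod M)
  restr_scaleA restr_scale1 restr_scaleDr restr_scaleDl.

Lemma restr_scaleE (r : R) (m : restr_mod M) : r *: m = r%:A *: (m : M) :> M.
Proof. by []. Qed.

End Instances.

Lemma alg_commute (M : lmodType A) (a : A) (r : R) (m : M) :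
  a *: (r%:A *: m) = r%:A *: (a *: m).
Proof. by rewrite !scalerA -scalerAl -scalerAr mul1r mulr1. Qed.

Lemma scaler_restr (M : lmodType A) (a : A) (r : R) (m : M) :
  (r *: a) *: m = r%:A *: (a *: m).
Proof. by rewrite scalerA -scalerAl mul1r. Qed.

Fact restr_lin (M N : lmodType A) (f : {linear M -> N}) :
  linear (f : restr_mod M -> restr_mod N).
Proof. by move=> r u v; rewrite !restr_scaleE linearP. Qed.

Definition restr_map (M N : lmodType A) (f : {linear M -> N}) :
  {linear restr_mod M -> restr_mod N} := mk_linear (restr_lin f).

End Restriction.

Section StarProjective.
Variables (R : fieldType) (A : falgType R) (I : finType) (o : I).
Variables (J P : I -> I -> A) (cJ cP : I -> I -> A -> R).
Local Notation E := (fun i j : I => (i != o) && (i == j)).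
Local Notation dbl := (fun i : I => i != o).
Hypothesis bbA : block_basis o dbl E J P cJ cP.
Hypothesis char2 : 2%:R = 0 :> R.
Implicit Types i j : I.

Lemma star_J1 i j k : J i j * J j k = (j == o)%:R *: J i k.
Proof. by rewrite (bb_J1 bbA); case: eqP => //= _; rewrite char2. Qed.

Lemma star_PJ i k : i != o -> P i i * J i k = J i k.
Proof. by move=> i0; rewrite (bb_PJ bbA) ?i0 ?eqxx // scale1r. Qed.
Lemma star_JP i k : i != o -> J k i * P i i = J k i.
Proof. by move=> i0; rewrite (bb_JP bbA) ?i0 ?eqxx // scale1r. Qed.
Lemma star_PP i : i != o -> P i i * P i i = P i i.
Proof. by move=> i0; rewrite (bb_PP bbA) ?i0 ?eqxx // scale1r. Qed.
Lemma star_PJ0 i j k : i != o -> i != j -> P i i * J j k = 0.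
Proof. by move=> i0 ij; rewrite (bb_PJ bbA) ?i0 ?eqxx // (negPf ij) scale0r. Qed.
Lemma star_JP0 i j k : i != o -> j != i -> J k j * P i i = 0.
Proof. by move=> i0 ij; rewrite (bb_JP bbA) ?i0 ?eqxx // (negPf ij) scale0r. Qed.
Lemma star_PP0 i j : i != o -> j != o -> i != j -> P i i * P j j = 0.
Proof. by move=> i0 j0 ij; rewrite (bb_PP bbA) ?i0 ?j0 ?eqxx // (negPf ij) scale0r. Qed.
Lemma star_1 : J o o + \sum_(i | i != o) P i i = 1.
Proof.
rewrite -(bb_1 bbA) [RHS](bigD1 o) //= /bb_idem /= eqxx; congr (_ + _).
by apply: eq_bigr => i ->.
Qed.

(** The vertex idempotents and the arrows generate: J i j is a composite of arrows. *)
Lemma star_gen (Q : A -> Prop) :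
  (forall r a b, Q a -> Q b -> Q (r *: a + b)) -> (forall a b, Q a -> Q b -> Q (a * b)) ->
  Q (J o o) -> (forall i, i != o -> [/\ Q (P i i), Q (J i o) & Q (J o i)]) ->
  forall a, Q a.
Proof.
move=> Qlin QM Qo Qi a; have Q0 : Q 0.
  by have := Qlin (-1) _ _ Qo Qo; rewrite scaleN1r addNr.
have QZ r b : Q b -> Q (r *: b) by move=> Qb; rewrite -[r *: b]addr0; apply: Qlin.
have QD b c : Q b -> Q c -> Q (b + c) by move=> Qb Qc; rewrite -[b]scale1r; apply: Qlin.
have QJ i j : Q (J i j).
  have Qio k : Q (J k o) by have [->|/Qi[]] := eqVneq k o.
  have Qoi k : Q (J o k) by have [->|/Qi[]] := eqVneq k o.
  by rewrite -(bb_Joo bbA); apply: QM.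
rewrite [a](bb_decomp bbA); elim/big_ind: _ => // i _; elim/big_ind: _ => // j _.
apply: QD; first exact: QZ.
have [Eij|/(bb_cP0 bbA)->] := boolP (E i j); last by rewrite scale0r.
by case/andP: Eij => i0 /eqP<-; apply: QZ; have [] := Qi _ i0.
Qed.

(** With M_v = e_v M: the arrows give M_0 -> M_i -> M_0, exact at the first two
places, and the images in the last place are independent over i.  All three
conditions pass to suitable kernels. *)
Definition star_flat (L : lmodType A) :=
  [/\ forall i (m : L), i != o -> J i o *: m = 0 -> J o o *: m = 0,
      forall i (m : L), i != o -> J o i *: m = 0 -> exists n, P i i *: m = J i o *: n
    & forall m : I -> L, \sum_(i | i != o) J o i *: m i = 0 ->
        forall i, i != o -> J o i *: m i = 0].

Section Criterion.
Variables (L : lmodType A).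
Hypothesis flatL : star_flat L.
Local Notation L' := (restr_mod L).

(** A linear projection of M_i onto the copy of M_0 in it, composed with the inverse
of the injection M_0 -> M_i. *)
Lemma star_coord1 i : i != o -> exists y : {linear L' -> L'}, forall m : L,
  [/\ y (P i i *: m) = y m, y (J i o *: m) = J o o *: m, J o o *: (y m : L) = y m
    & forall a, P i i * a = 0 -> y (a *: m) = 0]
  /\ (J o i *: m = 0 -> P i i *: m = J i o *: (y m : L)).
Proof.
move=> i0; have [inj1 ex1 _] := flatL.
pose U (m : L') := exists n : L, m = J i o *: n.
have [|r u v [n ->] [n' ->]|p [pU pid]] := @linear_projector R L' U.
- by exists 0; rewrite scaler0.
- by exists (r%:A *: n + n'); rewrite restr_scaleE scalerDr alg_commute.
pose y (m : L') : L' := J o o *: projT1 (cid (pU (P i i *: (m : L)))).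
have yE (m : L) : J i o *: (y m : L) = p (P i i *: m).
  by rewrite /y; case: cid => n /= ->; rewrite scalerA star_J1 eqxx scale1r.
have oy (m : L) : J o o *: (y m : L) = y m.
  by rewrite /y scalerA star_J1 eqxx scale1r.
have y_uniq (m : L) (n : L) : J i o *: n = p (P i i *: m) -> y m = J o o *: n.
  move=> nE; have /eqP : J o o *: ((y m : L) - n) = 0.
    by apply: (inj1 i) => //; rewrite scalerBr yE nE subrr.
  by rewrite scalerBr oy subr_eq0 => /eqP.
have y_lin : linear y.
  move=> r u v.
  have nE : J i o *: (r%:A *: (y u : L) + (y v : L)) = p (P i i *: ((r *: u + v : L') : L)).
    rewrite scalerDr alg_commute !yE restr_scaleE (@scalerDr A L) alg_commute.
    exact/esym/(linearP p r (P i i *: (u : L)) (P i i *: (v : L))).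
  by rewrite (y_uniq _ _ nE) scalerDr alg_commute !oy.
exists (mk_linear y_lin) => m /=; split; first split=> //.
- by rewrite (y_uniq _ (y m)) ?oy // yE scalerA star_PP.
- by apply: y_uniq; rewrite scalerA star_PJ // pid //; exists m.
- move=> a a0; rewrite (y_uniq _ 0) ?scaler0 // scalerA a0 scale0r.
  by rewrite (linear0 p).
by move=> /(ex1 _ _ i0)[n nE]; rewrite yE nE pid //; exists n.
Qed.


Definition rlin (N : lmodType A) (f : L -> N) :=
  forall (r : R) m n, f (r%:A *: m + n) = r%:A *: f m + f n.

(** Linear coordinates exhibiting a flat module as a direct sum of projectives:
[v i] and [w] take values in complements that play the role of generators at the
vertices i and o, [y i] is the part of M_i coming from M_0 and [z i] the part of
M_0 coming from M_i. *)
Record star_coords (v y z : I -> L -> L) (w : L -> L) : Prop := StarCoords {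
  sc_lin : forall i, i != o -> [/\ rlin (v i), rlin (y i) & rlin (z i)];
  sc_wlin : rlin w;
  sc_P : forall i m, i != o -> P i i *: m = v i m + J i o *: y i m;
  sc_J : forall m, J o o *: m = w m + \sum_(j | j != o) J o j *: z j m;
  sc_v : forall i m, i != o -> P i i *: v i m = v i m;
  sc_y : forall i m, i != o -> J o o *: y i m = y i m;
  sc_w : forall m, J o o *: w m = w m;
  sc_P0 : forall i m a, i != o -> P i i * a = 0 -> v i (a *: m) = 0 /\ y i (a *: m) = 0;
  sc_PP : forall i m, i != o -> v i (P i i *: m) = v i m /\ y i (P i i *: m) = y i m;
  sc_Jio : forall i m, i != o -> v i (J i o *: m) = 0 /\ y i (J i o *: m) = J o o *: m;
  sc_J0 : forall m a, J o o * a = 0 ->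
    w (a *: m) = 0 /\ forall j, j != o -> z j (a *: m) = 0;
  sc_JJ : forall m, w (J o o *: m) = w m /\ forall j, j != o -> z j (J o o *: m) = z j m;
  sc_Joi : forall i m, i != o -> w (J o i *: m) = 0 /\
    forall j, j != o -> z j (J o i *: m) = if i == j then v i m else 0
}.

Lemma star_coords_ex : exists v y z w, star_coords v y z w.
Proof.
have [_ _ inj0] := flatL.
have /choice[y yP] : forall i, exists y : {linear L' -> L'}, i != o -> forall m : L,
  [/\ y (P i i *: m) = y m, y (J i o *: m) = J o o *: m, J o o *: (y m : L) = y m
    & forall a, P i i * a = 0 -> y (a *: m) = 0]
  /\ (J o i *: m = 0 -> P i i *: m = J i o *: (y m : L)).
  move=> i; have [->|i0] := eqVneq i o; first by exists (\0 : {linear L' -> L'}).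
  by have [y yP] := star_coord1 i0; exists y.
pose v i (m : L) : L := P i i *: m - J i o *: (y i m : L).
have ylin i : rlin (y i : L -> L) by move=> r m n; apply: (linearP (y i)).
have vlin i : rlin (v i).
  move=> r m n; rewrite /v ylin !scalerDr !alg_commute opprD addrACA.
  by rewrite scalerN.
have v0 i m : i != o -> J o i *: m = 0 -> v i m = 0.
  by move=> i0 /(yP i i0 m).2 e; rewrite /v e subrr.
have Jv i m : i != o -> J o i *: v i m = J o i *: m.
  move=> i0; rewrite /v scalerBr !scalerA star_JP // star_J1 (negPf i0) !scale0r.
  by rewrite subr0.
pose U (m : L') := exists n : I -> L, m = \sum_(i | i != o) J o i *: n i.
have [|r u u' [n ->] [n' ->]|p [pU pid]] := @linear_projector R L' U.
- by exists (fun=> 0); rewrite big1 // => i _; rewrite scaler0.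
- exists (fun i => r%:A *: n i + n' i); rewrite restr_scaleE scaler_sumr -big_split.
  by apply: eq_bigr => i _; rewrite scalerDr alg_commute.
pose n_ (m : L) := projT1 (cid (pU (J o o *: m))).
have n_E m : p (J o o *: m) = \sum_(i | i != o) J o i *: n_ m i :> L.
  by rewrite /n_; case: cid.
pose z i m := v i (n_ m i).
have z_uniq (m : L) (n : I -> L) : p (J o o *: m) = \sum_(i | i != o) J o i *: n i :> L ->
    forall i, i != o -> z i m = v i (n i).
  move=> nE i i0; apply/eqP; rewrite -subr_eq0 addrC -scaleN1r; apply/eqP.
  have -> : -1 = (-1)%:A :> A by rewrite scaleN1r.
  rewrite -vlin; apply: v0 => //; move: i i0.
  apply: (inj0 (fun i => (-1)%:A *: n i + n_ m i)).
  under eq_bigr do rewrite scalerDr alg_commute.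
  by rewrite big_split -scaler_sumr /= -nE -n_E scaleN1r scaleN1r addNr.
have zE m : p (J o o *: m) = \sum_(i | i != o) J o i *: z i m :> L.
  by rewrite n_E; apply: eq_bigr => i i0; rewrite /z Jv.
have zlin i : i != o -> rlin (z i).
  move=> i0 r m n; rewrite (z_uniq _ (fun i => r%:A *: n_ m i + n_ n i)) ?vlin //.
  rewrite scalerDr alg_commute -restr_scaleE linearP /= !n_E restr_scaleE.
  rewrite scaler_sumr -big_split; apply: eq_bigr => j _.
  by rewrite scalerDr alg_commute.
pose w m : L := J o o *: m - (p (J o o *: m) : L).
have wlin : rlin w.
  move=> r m n; rewrite /w scalerDr alg_commute -restr_scaleE linearP /=.
  by rewrite !restr_scaleE opprD addrACA scalerBr.
exists v, (fun i => y i), z, w; split=> //.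
- by move=> i i0; split; [exact: vlin | exact: ylin | exact: zlin].
- by move=> i m i0; rewrite /v subrK.
- by move=> m; rewrite -zE /w subrK.
- by move=> i m i0; rewrite /v scalerBr !scalerA star_PP // star_PJ.
- by move=> i m i0; have [[]] := yP i i0 m.
- move=> m; rewrite /w zE scalerBr scalerA star_J1 eqxx scale1r scaler_sumr.
  congr (_ - _); apply: eq_bigr => i i0.
  by rewrite scalerA star_J1 eqxx scale1r.
- move=> i m a i0 a0; have [[_ _ _ y0] _] := yP i i0 m.
  by rewrite /v y0 // scalerA a0 scale0r scaler0 subr0.
- move=> i m i0; have [[yy _ _ _] _] := yP i i0 m.
  by rewrite /v yy scalerA star_PP.
- move=> i m i0; have [[_ yJ _ _] _] := yP i i0 m.
  by rewrite /v yJ !scalerA star_PJ // star_J1 eqxx scale1r subrr.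
- move=> m a a0; rewrite /w scalerA a0 scale0r (linear0 p) subrr; split=> // j j0.
  rewrite (z_uniq _ (fun=> 0)) //; first by apply: v0; rewrite ?scaler0.
  by rewrite scalerA a0 scale0r (linear0 p) big1 // => i _; rewrite scaler0.
- move=> m; rewrite /w scalerA star_J1 eqxx scale1r; split=> // j j0.
  by rewrite (z_uniq _ (n_ m)) // scalerA star_J1 eqxx scale1r n_E.
- move=> i m i0; rewrite /w scalerA star_J1 eqxx scale1r.
  have pJ : p (J o i *: m) = J o i *: m.
    apply: pid; exists (fun j => if j == i then m else 0).
    rewrite (bigD1 i) //= eqxx big1 ?addr0 // => j /andP[_ /negPf->].
    by rewrite scaler0.
  rewrite pJ subrr; split=> // j j0.
  rewrite (z_uniq _ (fun j => if j == i then m else 0)) //.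
    by rewrite [j == i]eq_sym; case: eqP => [->|_] //; apply: v0; rewrite ?scaler0.
  rewrite scalerA star_J1 eqxx scale1r pJ (bigD1 i) //= eqxx big1 ?addr0 //.
  by move=> k /andP[_ /negPf->]; rewrite scaler0.
Qed.

End Criterion.

(** To lift f through g, lift it linearly on the generators, i.e. on the values of
[v i] and [w], and extend by the formulas that rebuild a vector from its
coordinates; compatibility with vertices and arrows suffices by [star_gen]. *)
Lemma star_projective (L : lmodType A) : star_flat L -> projective L.
Proof.
move=> flatL M N g f g_surj.
have [v [y [z [w sc]]]] := star_coords_ex flatL.
have [s sK] := @linear_section R _ _ (restr_map g) g_surj.
pose t (l : L) : M := s (f l).
have tlin : rlin t.
  by move=> r m n; rewrite /t linearP -restr_scaleE; apply: (linearP s).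
have gt l : g (t l) = f l by apply: sK.
have t0 : t 0 = 0 by rewrite /t linear0; apply: (linear0 s).
pose H l : M := J o o *: t (w l) + \sum_(j | j != o) J o j *: t (z j l).
have Hlin : rlin H.
  move=> r m n; rewrite /H (sc_wlin sc) tlin scalerDr alg_commute.
  rewrite (eq_bigr (fun j => r%:A *: (J o j *: t (z j m)) + J o j *: t (z j n))).
    by rewrite big_split -scaler_sumr /= addrACA scalerDr.
  by move=> j j0; have [_ _ ->] := sc_lin sc j0; rewrite tlin scalerDr alg_commute.
have H0 m a : J o o * a = 0 -> H (a *: m) = 0.
  move=> a0; have [w0 z0] := sc_J0 sc m a0.
  rewrite /H w0 t0 scaler0 add0r big1 // => j j0.
  by rewrite z0 // t0 scaler0.
have HJ m : H (J o o *: m) = H m.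
  have [wE zE] := sc_JJ sc m; rewrite /H wE; congr (_ + _).
  by apply: eq_bigr => j j0; rewrite zE.
have H00 : H 0 = 0 by rewrite -[0](scale0r (0 : L)) H0 // mulr0.
pose T i l : M := P i i *: t (v i l) + J i o *: H (y i l).
pose h l : M := H l + \sum_(i | i != o) T i l.
have Tlin i : i != o -> rlin (T i).
  move=> i0 r m n; rewrite /T; have [-> -> _] := sc_lin sc i0.
  by rewrite tlin Hlin !scalerDr !alg_commute addrACA.
have hlin : rlin h.
  move=> r m n; rewrite /h Hlin.
  rewrite (eq_bigr (fun j => r%:A *: T j m + T j n)).
    by rewrite big_split -scaler_sumr /= addrACA -scalerDr.
  by move=> j j0; apply: Tlin.
have T0 i m a : i != o -> P i i * a = 0 -> T i (a *: m) = 0.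
  move=> i0 a0; have [v0 y0] := sc_P0 sc m i0 a0.
  by rewrite /T v0 y0 t0 H00 !scaler0 addr0.
have JH i m : i != o -> J o i *: H m = 0 /\ P i i *: H m = 0.
  move=> i0; rewrite /H; split; rewrite scalerDr scalerA scaler_sumr.
    rewrite (bb_J0 bbA) // scale0r add0r big1 // => j _.
    by rewrite scalerA (bb_J0 bbA) // scale0r.
  rewrite star_PJ0 // scale0r add0r big1 // => j _.
  by rewrite scalerA star_PJ0 // scale0r.
have JoH m : J o o *: H m = H m.
  rewrite /H scalerDr scalerA star_J1 eqxx scale1r scaler_sumr; congr (_ + _).
  by apply: eq_bigr => j _; rewrite scalerA star_J1 eqxx scale1r.
have JioH i m : J i o *: H m = J i o *: h m.
  rewrite /h [RHS]scalerDr scaler_sumr big1 ?addr0 // => j j0.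
  have oj : o != j by rewrite eq_sym.
  rewrite /T scalerDr !scalerA star_JP0 // (bb_J0 bbA) //.
  by rewrite !scale0r addr0.
have hA : forall a m, h (a *: m) = a *: h m.
  apply: star_gen => [r a b ha hb m|a b ha hb m|m|i i0].
  - rewrite scalerDl scaler_restr hlin ha hb.
    by rewrite -scaler_restr -scalerDl.
  - by rewrite -!scalerA ha hb.
  - rewrite -JioH JoH /h HJ big1 ?addr0 // => i i0.
    by apply: T0; rewrite // star_PJ0.
  - have oi : o != i by rewrite eq_sym.
    split=> m.
    + have [vE yE] := sc_PP sc m i0.
      have [_ PH] := JH _ m i0.
      rewrite {2}/h scalerDr PH add0r /h H0 ?star_JP0 // add0r.
      rewrite scaler_sumr (bigD1 i) //= [RHS](bigD1 i) //=; congr (_ + _).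
        by rewrite /T vE yE [RHS]scalerDr !scalerA star_PP // star_PJ.
      rewrite !big1 // => j /andP[j0 ji]; have ij : i != j by rewrite eq_sym.
        rewrite /T scalerDr !scalerA star_PP0 // star_PJ0 //.
        by rewrite !scale0r addr0.
      by apply: T0; rewrite ?star_PP0.
    + have [vE yE] := sc_Jio sc m i0.
      rewrite -JioH /h H0 ?(bb_J0 bbA) // add0r (bigD1 i) //=.
      rewrite big1 ?addr0 => [|j /andP[j0 ji]]; last by apply: T0; rewrite ?star_PJ0.
      by rewrite /T vE yE t0 scaler0 add0r HJ.
    + have [wE zE] := sc_Joi sc m i0; have [JH0 _] := JH _ m i0.
      rewrite {2}/h scalerDr JH0 add0r /h /H wE t0 scaler0 add0r.
      rewrite [X in _ + X]big1 => [|j j0]; last by apply: T0; rewrite ?star_PJ0.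
      rewrite addr0 (bigD1 i) //= zE // eqxx scaler_sumr [RHS](bigD1 i) //=.
      rewrite /T scalerDr !scalerA star_JP // star_J1 (negPf i0) !scale0r addr0.
      rewrite !big1 // => j /andP[j0 ji]; have ij : i != j by rewrite eq_sym.
        rewrite scalerDr !scalerA star_JP0 // (bb_J0 bbA) //.
        by rewrite !scale0r addr0.
      by rewrite zE // eq_sym (negPf ji) t0 scaler0.
have h_lin : linear h.
  move=> a m n; have hD u u' : h (u + u') = h u + h u'.
    by have := hlin 1 u u'; rewrite !scale1r.
  by rewrite hD hA.
exists (mk_linear h_lin) => l /=.
have gH m : g (H m) = f (J o o *: m).
  rewrite /H linearD linear_sum linearZ /= gt (sc_J sc m) linearD linear_sum.
  rewrite -linearZ (sc_w sc); congr (_ + _); apply: eq_bigr => j _.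
  by rewrite !linearZ /= gt.
rewrite /h linearD gH linear_sum -[in RHS](scale1r l) -star_1 scalerDl.
rewrite [in RHS]linearD scaler_suml [in RHS]linear_sum; congr (_ + _).
apply: eq_bigr => i i0; rewrite (sc_P sc _ i0) /T !linearD !linearZ /= gt gH.
by rewrite -linearZ (sc_v sc) // (sc_y sc).
Qed.

Lemma star_Joi_mul i x : i != o -> J o i * x = cP i i x *: J o i.
Proof.
move=> i0; rewrite (bb_Jmul bbA) (bigD1 i) //= i0 /= char2 mul0r add0r big1 ?addr0 //.
move=> j /negPf ji; rewrite mul0r add0r (bb_cP0 bbA) ?scale0r //.
by rewrite /= [i == j]eq_sym ji andbF.
Qed.

Lemma star_Jko_mul k x : J k o * x = \sum_j cJ o j x *: J k j.
Proof.
rewrite (bb_Jmul bbA); apply: eq_bigr => j _.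
by rewrite (bb_cP0 bbA) ?eqxx //= addr0 mul1r.
Qed.

Lemma star_Pii_mul i x : i != o ->
  P i i * x = J i o * (\sum_j cJ i j x *: J o j) + cP i i x *: P i i.
Proof.
move=> i0; rewrite (bb_Pmul bbA) ?i0 ?eqxx // big_split /=; congr (_ + _).
  by rewrite mulr_sumr; apply: eq_bigr => j _; rewrite -scalerAr (bb_Joo bbA).
rewrite (bigD1 i) //= big1 ?addr0 // => j /negPf ji.
by rewrite (bb_cP0 bbA) ?scale0r //= [i == j]eq_sym ji andbF.
Qed.

Section FreeFlat.
Import finmap monalg.

Lemma free_modE (K : choiceType) (m : free_mod A K) :
  m = \sum_(k <- msupp m) m@_k *: (<< k >> : free_mod A K).
Proof.
rewrite {1}[m]monalgE; apply: eq_bigr => k _; apply/malgP => k'.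
by rewrite mcoeffZ !mcoeffU; case: eqP; rewrite ?mulr1 ?mulr0.
Qed.

(** Coordinatewise, this is a computation in A. *)
Lemma star_free_flat (K : choiceType) : star_flat (free_mod A K).
Proof.
split=> [i m i0 /malgP m0|i m i0 /malgP m0|m m0 i i0].
- apply/malgP => k; have := m0 k; rewrite !mcoeffZ mcoeff0 !star_Jko_mul => m0k.
  rewrite big1 // => j _; have /(congr1 (cJ i j)) := m0k.
  rewrite (bb_cJsum bbA) (bb_cJ0 bbA) (bigD1 j) //= big1 => [|l /negPf lj].
    by rewrite addr0 (bb_cJZ bbA) (bb_cJJ bbA) !eqxx mulr1 => ->; rewrite scale0r.
  by rewrite (bb_cJZ bbA) (bb_cJJ bbA) [j == l]eq_sym lj andbF mulr0.
- exists (\sum_(k <- msupp m) (\sum_j cJ i j m@_k *: J o j) *: (<< k >> : free_mod A K)).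
  rewrite {1}[m]free_modE !scaler_sumr; apply: eq_bigr => k _; rewrite !scalerA.
  rewrite star_Pii_mul //; suff -> : cP i i m@_k = 0 by rewrite scale0r addr0.
  have := m0 k; rewrite mcoeffZ mcoeff0 star_Joi_mul // => /(congr1 (cJ o i)).
  by rewrite (bb_cJZ bbA) (bb_cJJ bbA) !eqxx mulr1 (bb_cJ0 bbA).
- apply/malgP => k; rewrite mcoeffZ mcoeff0 star_Joi_mul //.
  suff -> : cP i i (m i)@_k = 0 by rewrite scale0r.
  have /(congr1 (cJ o i)) : \sum_(j | j != o) J o j * (m j)@_k = 0.
    transitivity (mcoeff k (\sum_(j | j != o) J o j *: m j)); last by rewrite m0 mcoeff0.
    by rewrite [RHS]raddf_sum; apply: eq_bigr => j _; rewrite /= mcoeffZ.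
  rewrite (bb_cJsum bbA) (bb_cJ0 bbA) (bigD1 i) //= big1 => [|l /andP[l0 /negPf li]].
    by rewrite addr0 star_Joi_mul // (bb_cJZ bbA) (bb_cJJ bbA) !eqxx mulr1.
  by rewrite star_Joi_mul // (bb_cJZ bbA) (bb_cJJ bbA) [i == l]eq_sym li andbF mulr0.
Qed.

End FreeFlat.

(** For the kernel L of d : F1 -> N with N inside F0, the only condition that is not
inherited at once from F1 is exactness at M_i: the preimage n in F1 of an element
of L has d n killed by the injective map M_0 -> M_i of F0, so d n = 0 and n is
in L. *)
Theorem star_gldim : gldim_le A 2.
Proof.
apply: gldim_le2 => K0 K1 N d j j_inj; apply: star_projective.
have [F1 _ _] := star_free_flat K0.
have [G1 G2 G3] := star_free_flat K1.
split=> [i m i0 /(congr1 val) /= m0|i m i0 /(congr1 val) /= m0|m m0 i i0].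
- by apply: val_inj; apply: (G1 i).
- have [n nE] := G2 _ _ i0 m0.
  have dn : d (J i o *: n) = 0 by rewrite -nE linearZ /= ker_valP scaler0.
  have [u uE] : exists u : ker_mod d, val u = J o o *: n.
    apply: ker_ex; apply: j_inj; rewrite linear0 !linearZ; apply: (F1 i) => //=.
    have : j (d (J i o *: n)) = 0 by rewrite dn linear0.
    by rewrite !linearZ.
  exists u; apply: val_inj; rewrite /= nE uE scalerA star_J1 eqxx scale1r //.
- apply: val_inj => /=; apply: (G3 (fun i => val (m i))) i0.
  pose vl : {linear ker_mod d -> free_mod A K1} := val.
  have := congr1 vl m0; rewrite linear0 linear_sum => m0v; rewrite -[RHS]m0v.
  by apply: eq_bigr => k _; rewrite linearZ.
Qed.

End StarProjective.

(** * The quiver of the star algebra *)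

Section StarQuiver.
Import finmap.
Variables (R : fieldType) (A : falgType R) (r : nat).
Local Notation I := 'I_r.+1.
Variables (J P : I -> I -> A) (cJ cP : I -> I -> A -> R).
Local Notation o := (ord0 : I).
Local Notation E := (fun i j : I => (i != o) && (i == j)).
Local Notation dbl := (fun i : I => i != o).
Hypothesis bbA : block_basis o dbl E J P cJ cP.
Hypothesis char2 : 2%:R = 0 :> R.
Local Notation e := (bb_idem dbl J P).
Local Notation DQ := (double_quiver (star r)).
Local Notation D := (path_alg R DQ).
Implicit Types (p q : qpath DQ) (f g : D).

Definition star_arrow (a : arrow DQ) : A :=
  match a with inl i => J (lift ord0 i) o | inr i => J o (lift ord0 i) end.

Definition star_val p : A := e (pstart p) * \prod_(a <- parrows p) star_arrow a.

Lemma star_arrow_ends (a : arrow DQ) v :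
  e v * star_arrow a = (v == src a)%:R *: star_arrow a /\
  star_arrow a * e v = (tgt a == v)%:R *: star_arrow a.
Proof. by case: a => i; split; rewrite /= ?(bb_eE bbA) ?(bb_Ee bbA). Qed.

Lemma star_val_end (v w : vertex DQ) (s : seq (arrow DQ)) : is_walk v s ->
  e v * \prod_(a <- s) star_arrow a * e w =
  (walk_end v s == w)%:R *: (e v * \prod_(a <- s) star_arrow a).
Proof.
elim: s v => [|a s IHs] v.
  rewrite big_nil mulr1 (bb_ee bbA) /walk_end /=.
  by case: eqP => [->|]; rewrite ?scale0r.
move=> W; have {W}/andP[/eqP <- /IHs{}IHs] : (src a == v) && is_walk (tgt a) s := W.
have [ea _] := star_arrow_ends a (src a); have [_ ta] := star_arrow_ends a (tgt a).
rewrite eqxx scale1r in ea; rewrite eqxx scale1r in ta; rewrite big_cons mulrA ea.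
by rewrite -ta -!mulrA [e (tgt a) * (_ * _)]mulrA IHs -scalerAr.
Qed.

Lemma star_valM p q :
  star_val p * star_val q = oapp star_val 0 (pcat p q).
Proof.
have pE := star_val_end _ (valP p).
rewrite {2}/star_val mulrA pE -/(pend p).
have [pq|npq] := eqVneq (pend p) (pstart q); last by rewrite pcat_neq // scale0r mul0r.
have [u -> uE] := pcatP pq.
by rewrite scale1r /= /star_val /pstart /parrows uE /= big_cat mulrA.
Qed.

Definition star_pi f : A := \sum_(p <- psupp f) pcoef p f *: star_val p.

Lemma star_piw (d : {fset qpath DQ}) f :
  (psupp f `<=` d)%fset -> star_pi f = \sum_(p <- d) pcoef p f *: star_val p.
Proof.
move=> le; apply: big_fset_incl => // p _ pf.
by rewrite pcoef_out // scale0r.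
Qed.

Lemma star_pi_lin : linear star_pi.
Proof.
move=> k f g; pose d := (psupp f `|` psupp g)%fset.
rewrite (@star_piw d f) ?fsubsetUl // (@star_piw d g) ?fsubsetUr //.
rewrite (@star_piw d (k *: f + g)); last first.
  apply: fsubset_trans (psuppD_le _ _) _; apply: fsetUSS => //.
  exact: psuppZ_le.
rewrite scaler_sumr -big_split; apply: eq_bigr => p _.
by rewrite pcoefD pcoefZ scalerDl scalerA.
Qed.

Definition star_map : {linear D -> A} := mk_linear star_pi_lin.

Lemma star_map_elt p : star_map (path_elt R p) = star_val p.
Proof.
rewrite /= (star_piw (psuppU_le R p)) big_seq_fset1.
by rewrite pcoefU eqxx scale1r.
Qed.

Lemma star_map_vertex v : star_map (@vertex_elt R DQ v) = e v.
Proof. by rewrite star_map_elt /star_val big_nil mulr1. Qed.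

Lemma star_map_arrow (a : arrow DQ) : star_map (@arrow_elt R DQ a) = star_arrow a.
Proof.
rewrite star_map_elt /star_val big_seq1 (star_arrow_ends a _).1.
by rewrite eqxx scale1r.
Qed.

Lemma star_map_mult : monoid_morphism star_map.
Proof.
split.
  have -> : 1 = \sum_v @vertex_elt R DQ v :> D by [].
  rewrite (linear_sum star_map) -(bb_1 bbA).
  by apply: eq_bigr => v _; apply: star_map_vertex.
move=> f g; elim/path_alg_ind: f => [|f1 f2 E1 E2|k f E1|p].
- by rewrite !(mul0r, linear0).
- by rewrite mulrDl !linearD mulrDl E1 E2.
- have -> : k *: f * g = k *: (f * g) by apply: path_mulZl.
  by rewrite !linearZ E1 /= -scalerAl.
elim/path_alg_ind: g => [|g1 g2 E1 E2|k g E1|q].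
- by rewrite !(mulr0, linear0).
- by rewrite mulrDr !linearD mulrDr E1 E2.
- have -> : path_elt R p * (k *: g) = k *: (path_elt R p * g) by apply: path_mulZr.
  by rewrite !linearZ E1 /= -scalerAr.
rewrite path_eltM !star_map_elt star_valM.
by case: (pcat p q) => [u|] /=; [apply: star_map_elt | apply: (linear0 star_map)].
Qed.

Lemma star_map_surj : surjective star_map.
Proof.
have [m1 mM] := star_map_mult.
have im0 : exists f, star_map f = 0 by exists 0; apply: linear0.
have imD a b : (exists f, star_map f = a) -> (exists f, star_map f = b) ->
    exists f, star_map f = a + b.
  by move=> [f <-] [g <-]; exists (f + g); rewrite linearD.
have imZ k a : (exists f, star_map f = a) -> exists f, star_map f = k *: a.
  by move=> [f <-]; exists (k *: f); rewrite linearZ.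
move=> a; rewrite [a](bb_decomp bbA); apply: (big_ind (fun a => exists f, star_map f = a)) => //.
move=> i _; apply: (big_ind (fun a => exists f, star_map f = a)) => // j _.
have imv v : exists f, star_map f = e v.
  by exists (vertex_elt R (v : vertex DQ)); apply: star_map_vertex.
have ima (b : arrow DQ) : exists f, star_map f = star_arrow b.
  by exists (arrow_elt R b); apply: star_map_arrow.
have imJo : exists f, star_map f = J o o.
  by have := imv o; rewrite /bb_idem eqxx.
have imJio k : exists f, star_map f = J k o.
  by have [k' ->|->] := unliftP o k; [exact: (ima (inl k')) | exact: imJo].
have imJoi k : exists f, star_map f = J o k.
  by have [k' ->|->] := unliftP o k; [exact: (ima (inr k')) | exact: imJo].
apply: imD; first apply: imZ.
  rewrite -(bb_Joo bbA); have [f <-] := imJio i; have [g <-] := imJoi j.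
  by exists (f * g); apply: mM.
have [Eij|/(bb_cP0 bbA)->] := boolP (E i j); last by exists 0; rewrite scale0r linear0.
case/andP: Eij => i0 /eqP <-; apply: imZ.
by have := imv i; rewrite /bb_idem i0.
Qed.

(** Trivial paths at a leaf are the paths sent to a P; all other paths that survive
in the quotient are sent to some J. *)
Definition leaf_path p := (parrows p == [::]) && (pstart p != o).

(** A normal path, i.e. one that never goes from the centre to a leaf and back,
is determined by its ends and by whether it is trivial at a leaf. *)
Definition normal_val (b : bool) (v w : I) : I * seq ('I_r + 'I_r) :=
  (v, if b then [::] else
      oapp (fun i => [:: inl i]) [::] (unlift o v) ++
      oapp (fun j => [:: inr j]) [::] (unlift o w)).

Definition normal p := val p == normal_val (leaf_path p) (pstart p) (pend p).

(** No arrow can follow an arrow, nor an opposite arrow an opposite arrow; and an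
opposite arrow ends at a leaf, where the same arrow is the only way on. *)
Lemma star_path_cases p : normal p \/
  exists i s1 s2, parrows p = s1 ++ [:: inr i, inl i & s2].
Proof.
case: p => -[v s] W; rewrite /normal /leaf_path /normal_val /pend /parrows /pstart /walk_end /=.
have lift0 i : lift ord0 i == ord0 :> 'I_r.+1 = false by [].
have unlift0 : unlift ord0 (ord0 : 'I_r.+1) = None by case: unliftP.
case: s W => [_|a s] /=.
  by left; have [i ->|->] := unliftP ord0 v; rewrite ?unlift0 /=.
move=> /andP[/eqP <-]; case: a => i; case: s => [_|b s] /=.
- by left; rewrite liftK unlift0.
- case: b => j //=.
  case: s => [_|c s] /=; first by left; rewrite !liftK.
  case: c => k //= /andP[/eqP /lift_inj-> _].
  by right; exists j, [:: inl i], s.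
- by left; rewrite liftK unlift0.
case: b => j //= /andP[/eqP /lift_inj-> _].
by right; exists i, [::], s.
Qed.

Definition normal_coord p : A -> R :=
  if leaf_path p then cP (pstart p) (pstart p) else cJ (pstart p) (pend p).

Lemma normal_star_val p : normal p ->
  star_val p = if leaf_path p then P (pstart p) (pstart p) else J (pstart p) (pend p).
Proof.
move=> /eqP pE; rewrite /star_val.
have -> : parrows p = (normal_val (leaf_path p) (pstart p) (pend p)).2 by rewrite -pE.
have [lp|nlp] := boolP (leaf_path p).
  by case/andP: lp => _ p0; rewrite big_nil mulr1 /bb_idem p0.
rewrite /normal_val /= big_cat /=.
have [i pi|p0] := unliftP ord0 (pstart p); have [j pj|p1] := unliftP ord0 (pend p);
  rewrite /= ?big_nil ?big_seq1 ?mulr1 ?mul1r /=.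
- by rewrite (bb_Joo bbA) -pi (bb_eE bbA) eqxx scale1r pj.
- by rewrite -pi p1 (bb_eE bbA) eqxx scale1r.
- by rewrite -pj (bb_eE bbA) p0 eqxx scale1r.
- by rewrite p0 p1 /bb_idem eqxx.
Qed.

Lemma normal_coordE p q : normal p -> normal q ->
  normal_coord p (star_val q) = (q == p)%:R.
Proof.
move=> np nq; rewrite (normal_star_val nq) /normal_coord.
have -> : (q == p) =
    [&& leaf_path p == leaf_path q, pstart p == pstart q & pend p == pend q].
  apply/eqP/and3P => [->|[/eqP lpq /eqP spq /eqP epq]]; first by rewrite !eqxx.
  by apply: val_inj; rewrite (eqP np) (eqP nq) lpq spq epq.
have lpE u : leaf_path u -> pend u = pstart u.
  by case/andP=> /eqP; rewrite /pend /walk_end => ->.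
case: ifP => lp; case: ifP => lq; rewrite /= ?(bb_cPJ bbA) ?(bb_cJJ bbA) //.
- rewrite (lpE _ lp) (lpE _ lq) (bb_cPP bbA) //=.
  by case/andP: lq => _ ->; rewrite eqxx.
- by rewrite (bb_cJP bbA) //; case/andP: lq => _ ->; rewrite eqxx.
Qed.

Local Notation star_ideal := (ideal_gen (dual_relation (@no_relations R (star r)))).

Lemma star_ideal_ker f : star_ideal f -> star_map f = 0.
Proof.
have [_ mM] := star_map_mult; move/(_ (fun g => star_map g = 0)); apply.
  split=> [|g h g0 h0|g h k h0]; first exact: linear0.
    by rewrite linearD g0 h0 addr0.
  by rewrite !mM h0 mulr0 mul0r.
move=> g []; [by case | by case | move=> a b].
by rewrite mM !star_map_arrow /= (bb_JJ bbA) /= natrM char2 mulr0 scale0r.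
Qed.

(** The path contains a subpath a' a, which is one of the relations. *)
Lemma nonnormal_ideal p : ~~ normal p -> star_ideal (path_elt R p).
Proof.
case: (star_path_cases p) => [->//|[i [s1 [s2 pE]]] _] K [K0 KD KM] Krel.
have := valP p; rewrite -/(parrows p) -/(pstart p) pE walk_cat => /andP[W1].
rewrite /= => /and3P[/eqP v0 _ W2].
pose p1 : qpath DQ := @QPath DQ (pstart p, s1) W1.
pose p2 : qpath DQ := @QPath DQ (ord0, s2) W2.
suff -> : path_elt R p = path_elt R p1 *
    (@dual_arrow' R (star r) i * @dual_arrow R (star r) i) * path_elt R p2.
  by apply: KM; apply: Krel; apply: DualRelMixed.
rewrite /dual_arrow /dual_arrow' /arrow_elt path_eltM.
have [//|u -> uE] := @pcatP DQ (arrow_path (inr i : arrow DQ)) (arrow_path (inl i : arrow DQ)).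
rewrite /= path_eltM.
have [|w -> wE] := @pcatP DQ p1 u; first by rewrite [pstart u]/pstart uE; exact: esym v0.
rewrite /= path_eltM.
have [|x -> xE] := @pcatP DQ w p2.
  rewrite /pend [pstart w]/pstart [parrows w]/parrows wE /= walk_end_cat.
  by rewrite [parrows u]/parrows uE.
congr path_elt; apply: val_inj.
rewrite xE [pstart w]/pstart [parrows w]/parrows wE /= [parrows u]/parrows uE /= -catA /=.
rewrite -pE; exact: (surjective_pairing (qpath_val p)).
Qed.

(** Modulo the relations only normal paths are left, and these are sent to distinct
basis elements. *)
Lemma star_map_ker f : star_map f = 0 <-> star_ideal f.
Proof.
split=> [f0 K Kid Krel|]; last exact: star_ideal_ker.
have [K0 KD KM] := Kid.
have bad0 p : ~~ normal p -> K (path_elt R p) by move/nonnormal_ideal; apply.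
have KZ k g : K g -> K (k *: g).
  move=> Kg; have -> : k *: g = ((k *: (1 : D)) : D) * g * 1.
    have -> : ((k *: (1 : D)) : D) * g = k *: ((1 : D) * g : D) by apply: path_mulZl.
    by rewrite mul1r mulr1.
  exact: KM.
rewrite [f]path_algE; apply: big_ind => // p _.
have [np|/bad0/KZ//] := boolP (normal p).
suff -> : pcoef p f = 0 by rewrite scale0r.
have /(congr1 (normal_coord p)) : star_pi f = 0 := f0.
have cZ k a : normal_coord p (k *: a) = k * normal_coord p a.
  by rewrite /normal_coord; case: ifP => _; rewrite ?(bb_cPZ bbA) ?(bb_cJZ bbA).
have cD a b : normal_coord p (a + b) = normal_coord p a + normal_coord p b.
  by rewrite /normal_coord; case: ifP => _; rewrite ?(bb_cPD bbA) ?(bb_cJD bbA).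
have c0 : normal_coord p 0 = 0 by rewrite -(scale0r (0 : A)) cZ mul0r.
rewrite /star_pi (big_morph _ cD c0) c0.
have [pf|/pcoef_out//] := boolP (p \in psupp f).
rewrite (big_fsetD1 p) //= big1_fset => [|q].
  by rewrite addr0 cZ normal_coordE // eqxx mulr1.
rewrite in_fsetD1 => /andP[/negPf qp _] _; rewrite cZ.
have [nq|nq] := boolP (normal q); first by rewrite normal_coordE // qp mulr0.
suff -> : star_val q = 0 by rewrite c0 mulr0.
by rewrite -star_map_elt; apply: star_ideal_ker; apply: nonnormal_ideal.
Qed.

Theorem star_dual_extension : is_dual_extension_of_star A.
Proof.
exists r, star_map; split; first exact: star_map_mult.
  exact: star_map_surj.
exact: star_map_ker.
Qed.

End StarQuiver.

(** * The Terwilliger algebra of a quasi-thin scheme *)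

Theorem theorem1p1 (R : fieldType) (X : finType) (d : nat)
    (S : assoc_scheme X d) (x : X) (qtS : quasi_thin S) :
  [/\ quasi_hereditary (terwilliger R S x),
      cellular (terwilliger R S x)
    & 2%N \in [pchar R] ->
        (exists B : falgType R, is_basic_algebra (terwilliger R S x) B) /\
        (forall B : falgType R, is_basic_algebra (terwilliger R S x) B ->
           is_dual_extension_of_star B /\ gldim_le B 2)].
Proof.
have bbT := terwilliger_block_basis R x qtS.
split; [exact: bb_quasi_hereditary bbT | exact: bb_cellular bbT | move=> /pcharf0 char2].
have [r [idx [idx0 dbl_idx E_idx idx_ex]]] := class_reps bbT; split.
  by eexists; apply: (basic_algebra_ex bbT char2 idx0 dbl_idx E_idx idx_ex).
move=> B /(basic_block_basis bbT char2 idx0 dbl_idx E_idx idx_ex)[J [P [cJ [cP bbB]]]].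
by split; [exact: star_dual_extension bbB char2 | exact: star_gldim bbB char2].
Qed.
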